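(* Let $k\ge 1$ and let $\lambda_1,\ldots,\lambda_k$ be integers with $\gcd(\lambda_1,\ldots,\lambda_k)=1$. Then there is a constant $C\ge 0$, depending only on $\lambda_1,\ldots,\lambda_k$, such that for every finite set $A\subset\mathbb{Z}$, $$|\lambda_1\cdot A+\cdots+\lambda_k\cdot A|\ \ge\ (|\lambda_1|+\cdots+|\lambda_k|)\,|A|-C.$$
   Context: For a real number $d$ and a finite set $A$, $d\cdot A=\{da: a\in A\}$. For finite sets $B_1,\dots,B_k$, $B_1+\cdots+B_k=\{b_1+\cdots+b_k: b_i\in B_i\}$. $|X|$ denotes the cardinality of a finite set $X$. *)

(* Defs.v *)
(* Finite sets of integers are represented by sequences
   [A : seq int]; their cardinality is [size (undup A)]. *)
From mathcomp Require Import all_boot all_order all_algebra.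
Set Implicit Arguments. Unset Strict Implicit. Unset Printing Implicit Defensive.
Import Order.TTheory GRing.Theory Num.Theory.
Local Open Scope ring_scope.

Definition card_set (X : seq int) : nat := size (undup X).

Definition dilate (d : int) (A : seq int) : seq int := [seq d * a | a <- A].

Definition sumset (B C : seq int) : seq int := [seq b + c | b <- B, c <- C].

Definition dilated_sumset (lam : seq int) (A : seq int) : seq int :=
  match lam with
  | [::] => [::]
  | l :: ls => foldl (fun S d => sumset S (dilate d A)) (dilate l A) ls
  end.

Definition gcd_list (lam : seq int) : nat := foldr (fun x g => gcdn `|x|%N g) 0%N lam.

Definition abs_sum (lam : seq int) : nat := \sum_(l <- lam) `|l|%N.

(* Main.v *)
Require Import Defs.
From HB Require Import structures.
From mathcomp Require Import all_boot all_order all_algebra.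
From mathcomp Require Import finmap boolp zify ring.
Set Implicit Arguments. Unset Strict Implicit. Unset Printing Implicit Defensive.
Import Order.TTheory GRing.Theory Num.Theory.
Local Open Scope fset_scope.
Local Open Scope ring_scope.

(* For a set P of slots write S_P(A) for the sum of the lam_i A, i in P; let g_i be
   the gcd of the lam_j with j != i, and G the product of the g_i.  We induct on the
   number of nonzero coefficients.  For fixed coefficients with sum of absolute
   values L, the constant r in |S(A)| >= r|A| - C is raised by a fixed amount 1/q
   until it reaches L: a set A either satisfies the improved bound or is nearly
   extremal for r.  Splitting S(A) modulo G, near-extremality passes to the rescaled
   fibres of A modulo G and forces them to meet every class modulo g_i; iterating,
   they meet every class modulo a large power of G.

   For such a fibre A the sharp bound is proved directly.  S(A) splits modulo g_k into
   the pieces T + lam_k B, where T is the sum over the other slots and B a class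
   of A modulo g_k, and the claim is |T + lam_k B| >= |T| + |lam_k||B| - C.  This
   holds if, for some m, B has a large subset B' constant modulo m and T meets enough
   classes modulo m lam_k, since |X + l B| >= |X| + N(|B'| - 1) when X meets N classes
   modulo l m.  Along a chain of moduli built from nested subsets of B
   most classes of T split completely at some level, and a counting argument shows
   that otherwise T meets every class modulo lam_k, where m = 1 works. *)

(** * Congruences, sumsets and dilates *)

(** The gain [1 / q] must not shrink as the constant rises. Passing to a fibre modulo [G] turns a
    relative loss [t] into at most [(t + 1) * 4 L^2], and the number of passages needed is fixed by
    the coefficients; so [q] can be chosen once, beyond the accumulated loss. Only the additive [C]
    deteriorates, over finitely many steps.

    Near-extremality is rigid because [lam_i a] modulo [G] depends only on [a] modulo [g_i]: the
    slots can be restricted to unrelated classes, and all the sums still fall in one class modulo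
    [G], where they would be too many if [A] did not have a large class there.

    The obstacle to the sharp bound lies in the primes of [lam_k] that divide no [g_i], about which
    fullness says nothing. For (2, 3, 5) one has [G = 1], and [2A + 3A] need not meet every class
    modulo 5. The chain of moduli handles such primes. *)

Definition cg (m : nat) (x y : int) : bool := (m%:Z %| x - y)%Z.

Lemma cg_refl m x : cg m x x.
Proof. by rewrite /cg subrr dvdz0. Qed.

Lemma cg_sym m x y : cg m x y = cg m y x.
Proof. by rewrite /cg -opprB rpredN. Qed.

Lemma cg_trans m y x z : cg m x y -> cg m y z -> cg m x z.
Proof. by move=> h1 h2; rewrite /cg -(subrKA y) rpredD. Qed.

Lemma cgD m x y x' y' : cg m x y -> cg m x' y' -> cg m (x + x') (y + y').
Proof. by rewrite /cg opprD addrACA; apply: rpredD. Qed.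

Lemma cgM m a x y : cg m x y -> cg m (a * x) (a * y).
Proof. by rewrite /cg -mulrBr; apply: dvdz_mull. Qed.

Lemma cgN m x y : cg m x y -> cg m (- x) (- y).
Proof. by rewrite /cg -opprD rpredN. Qed.

Lemma cgDl m a x y : cg m (a + x) (a + y) = cg m x y.
Proof. by rewrite /cg opprD addrACA subrr add0r. Qed.

Lemma cgDr m a x y : cg m (x + a) (y + a) = cg m x y.
Proof. by rewrite ![_ + a]addrC cgDl. Qed.

Lemma cg_dvd m n x y : (n %| m)%N -> cg m x y -> cg n x y.
Proof. by move=> h; apply: dvdz_trans. Qed.

Lemma cg_sum m (I : finType) (P : pred I) (a b : I -> int) :
  (forall i, P i -> cg m (a i) (b i)) ->
  cg m (\sum_(i | P i) a i) (\sum_(i | P i) b i).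
Proof. by move=> h; rewrite /cg -sumrB; apply: rpred_sum => i /h. Qed.

Definition addS (X Y : {fset int}) : {fset int} := [fset x + y | x in X, y in Y].
Definition dil (l : int) (X : {fset int}) : {fset int} := [fset l * x | x in X].
Definition cls (m : nat) (c : int) (X : {fset int}) : {fset int} :=
  [fset x in X | cg m x c].
Definition inj_mod (m : nat) (X : {fset int}) : Prop :=
  {in X &, forall x y, cg m x y -> x = y}.

Lemma in_addS X Y z :
  reflect (exists x y, [/\ x \in X, y \in Y & z = x + y]) (z \in addS X Y).
Proof.
apply: (iffP idP) => [/imfset2P [x xX [y yY ->]]|[x [y [xX yY ->]]]].
  by exists x, y.
by apply/imfset2P; exists x => //; exists y.
Qed.

Lemma mem_addS X Y x y : x \in X -> y \in Y -> x + y \in addS X Y.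
Proof. by move=> xX yY; apply/in_addS; exists x, y. Qed.

Lemma in_dil l X z : reflect (exists2 x, x \in X & z = l * x) (z \in dil l X).
Proof. exact: imfsetP. Qed.

Lemma mem_dil l X x : x \in X -> l * x \in dil l X.
Proof. by move=> xX; apply/in_dil; exists x. Qed.

Lemma card_dil l X : l != 0 -> #|` dil l X| = #|` X|.
Proof. by move=> l0; apply: card_imfset; apply: mulfI. Qed.

Lemma in_cls m c X x : (x \in cls m c X) = (x \in X) && cg m x c.
Proof. by rewrite !inE. Qed.

Lemma cls_sub m c X : cls m c X `<=` X.
Proof. by apply/fsubsetP => x; rewrite in_cls => /andP[]. Qed.

Lemma cls_eq m c c' X : cg m c c' -> cls m c X = cls m c' X.
Proof.
move=> h; apply/fsetP => x; rewrite !in_cls; congr (_ && _).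
by apply/idP/idP => h'; [apply: cg_trans h' h | apply: cg_trans h' _; rewrite cg_sym].
Qed.

Lemma addSC : commutative addS.
Proof.
move=> X Y; apply/fsetP => z.
by apply/in_addS/in_addS => -[x [y [? ? ->]]]; exists y, x; rewrite addrC.
Qed.

Lemma addSA : associative addS.
Proof.
move=> X Y Z; apply/fsetP => t; apply/in_addS/in_addS.
  move=> [x [_ [xX /in_addS[y [z [yY zZ ->]]] ->]]].
  by exists (x + y), z; rewrite mem_addS // addrA.
move=> [_ [z [/in_addS[x [y [xX yY ->]]] zZ ->]]].
by exists x, (y + z); rewrite mem_addS // addrA.
Qed.

Lemma add0S : left_id [fset 0] addS.
Proof.
move=> X; apply/fsetP => z; apply/in_addS/idP.
  by move=> [x [y []]]; rewrite inE => /eqP -> yX ->; rewrite add0r.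
by move=> zX; exists 0, z; rewrite inE add0r.
Qed.

(** Sums over slots become big operators, from which [bigD1] splits off one slot. *)
HB.instance Definition _ :=
  Monoid.isComLaw.Build {fset int} [fset 0] addS addSA addSC add0S.

Lemma addSS X X' Y Y' : X `<=` X' -> Y `<=` Y' -> addS X Y `<=` addS X' Y'.
Proof.
move=> /fsubsetP hX /fsubsetP hY; apply/fsubsetP => _ /in_addS[x [y [xX yY ->]]].
by rewrite mem_addS ?hX ?hY.
Qed.

Lemma card_transl (a : int) (X : {fset int}) : #|` [fset a + x | x in X]| = #|` X|.
Proof. by apply: card_imfset; apply: addrI. Qed.

Lemma card_addSl X Y y : y \in Y -> (#|` X| <= #|` addS X Y|)%N.
Proof.
move=> yY; rewrite -(card_transl y); apply: fsubset_leq_card.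
by apply/fsubsetP => _ /imfsetP[x /= xX ->]; rewrite addrC mem_addS.
Qed.

Lemma card_addSr X Y x : x \in X -> (#|` Y| <= #|` addS X Y|)%N.
Proof. by rewrite addSC; apply: card_addSl. Qed.

Lemma fset_max (X : {fset int}) x0 : x0 \in X ->
  exists2 x, x \in X & forall y, y \in X -> y <= x.
Proof.
elim/finSet_rect: X x0 => X IH x0 x0X.
have [E|[x1]] := fset_0Vmem (X `\ x0).
  exists x0 => // y yX; have : y \notin X `\ x0 by rewrite E.
  by rewrite !inE yX andbT negbK => /eqP ->.
move=> x1X; have [x xX hx] := IH _ (fproperD1 x0X) _ x1X.
exists (Num.max x0 x).
  by rewrite /Num.max; case: ifP => // _; move: xX; rewrite !inE => /andP[].
move=> y yX; have [->|ne] := eqVneq y x0; first by rewrite le_max lexx.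
by rewrite le_max hx ?orbT // !inE ne.
Qed.

(** Induction on [X]: removing its maximum [x] loses the sum of [x] and the maximum of [Y], which no
    remaining pair reaches. *)
Lemma card_addS X Y x0 y0 : x0 \in X -> y0 \in Y ->
  (#|` X| + #|` Y| <= #|` addS X Y|.+1)%N.
Proof.
move=> + y0Y; have [y yY hy] := fset_max y0Y.
elim/finSet_rect: X x0 => X IH x0 x0X.
have [x xX hx] := fset_max x0X.
have [E|[x1]] := fset_0Vmem (X `\ x).
  rewrite (cardfsD1 x X) xX E cardfs0 addn0 add1n ltnS.
  exact: card_addSr xX.
move=> x1X; have h := IH _ (fproperD1 xX) _ x1X.
rewrite (cardfsD1 x X) xX -addnA add1n.
apply: leq_ltn_trans h _; rewrite ltnS.
apply: fproper_ltn_card; apply/andP; split.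
  by apply: addSS => //; apply: fsubD1set.
apply/fsubsetPn; exists (x + y); first exact: mem_addS.
apply/negP => /in_addS[x' [y' [+ y'Y e]]]; rewrite !inE => /andP[ne x'X].
have := hx _ x'X; have := hy _ y'Y => h1 h2.
by move: ne; rewrite neq_lt => /orP[]; lia.
Qed.

(** The pieces are disjoint because they lie in different classes. Most splittings of a sumset below
    go through this bound. *)
Lemma sum_card_le (J : eqType) (r : seq J) (m : nat) (X : {fset int})
    (F : J -> {fset int}) (e : J -> int) :
  uniq r -> (forall j, j \in r -> F j `<=` X) ->
  (forall j x, j \in r -> x \in F j -> cg m x (e j)) ->
  {in r &, forall i j, cg m (e i) (e j) -> i = j} ->
  (\sum_(j <- r) #|` F j| <= #|` X|)%N.
Proof.
elim: r X => [|j r IH] X /=; first by rewrite big_nil.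
move=> /andP[jr ur] hF he hinj; rewrite big_cons.
rewrite -(cardfsID (F j) X).
have /fsetIidPr -> := hF _ (mem_head _ _).
rewrite leq_add2l; apply: IH => //.
- move=> i ir; apply/fsubsetP => x xF; rewrite !inE.
  have ir' : i \in j :: r by rewrite inE ir orbT.
  rewrite (fsubsetP (hF _ ir')) // andbT; apply/negP => xF'.
  have h1 := he _ _ ir' xF; have h2 := he _ _ (mem_head _ _) xF'.
  have E : i = j by apply: hinj; rewrite ?mem_head //; apply: cg_trans h2; rewrite cg_sym.
  by rewrite -E ir in jr.
- by move=> i x ir; apply: he; rewrite inE ir orbT.
- by move=> i i' ir ir'; apply: hinj; rewrite inE ?ir ?ir' orbT.
Qed.

(** Overlaps only increase the right side. The weights serve the count of nonfull levels, which vary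
    from point to point. *)
Lemma sum_le_cover (J : eqType) (r : seq J) (X : {fset int})
    (F : J -> {fset int}) (w : int -> nat) :
  (forall x, x \in X -> exists2 j, j \in r & x \in F j) ->
  (\sum_(x <- X) w x <= \sum_(j <- r) \sum_(x <- F j) w x)%N.
Proof.
move=> h.
apply: (@leq_trans (\sum_(x <- X) \sum_(j <- r) (x \in F j) * w x)%N).
  rewrite big_seq [X in (_ <= X)%N]big_seq; apply: leq_sum => x /h[j jr xF].
  by rewrite (big_rem j) //= xF mul1n leq_addr.
rewrite exchange_big /=; apply: leq_sum => j _.
rewrite (eq_bigr (fun x => if x \in F j then w x else 0%N)); last first.
  by move=> x _; case: (x \in F j); rewrite ?mul1n ?mul0n.
rewrite -big_mkcond /= -big_filter.
have -> : (\sum_(x <- F j) w x = \sum_(x <- [seq x <- F j | true]) w x)%N.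
  by rewrite filter_predT.
rewrite [X in (_ <= X)%N](bigID (mem X)) /= filter_predT.
apply: leq_trans (leq_addr _ _).
rewrite -[X in (_ <= X)%N]big_filter; apply: eq_leq; apply: perm_big.
apply: uniq_perm; rewrite ?filter_uniq ?fset_uniq //.
by move=> x; rewrite !mem_filter /= andbC.
Qed.

Lemma card_le_cover (J : eqType) (r : seq J) (X : {fset int})
    (F : J -> {fset int}) :
  (forall x, x \in X -> exists2 j, j \in r & x \in F j) ->
  (#|` X| <= \sum_(j <- r) #|` F j|)%N.
Proof.
move=> h; rewrite card_fset_sum1.
apply: leq_trans (sum_le_cover (fun=> 1%N) h) _.
by apply: leq_sum => j _; rewrite card_fset_sum1.
Qed.

(** [R] is a transversal of the classes that [X] meets; numbers of classes are measured below as
    cardinalities of such sets. *)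
Lemma reps_exist m (X : {fset int}) : exists R : {fset int},
  [/\ R `<=` X, inj_mod m R & forall x, x \in X -> exists2 z, z \in R & cg m x z].
Proof.
elim/finSet_rect: X => X IH.
have [->|[x xX]] := fset_0Vmem X.
  by exists fset0; split => // x; rewrite inE.
have [R [RX iR cR]] := IH _ (fproperD1 xX).
have RX' : R `<=` X by apply: fsubset_trans RX (fsubD1set _ _).
case: (pselect (exists2 z, z \in R & cg m x z)) => [[z zR xz]|no].
  exists R; split => // y yX; have [->|ne] := eqVneq y x; first by exists z.
  by apply: cR; rewrite !inE ne.
exists (x |` R); split.
- by rewrite fsubUset fsub1set xX.
- move=> y y'; rewrite !inE => /orP[/eqP ->|yR] /orP[/eqP ->|y'R] // h.
  + by case: no; exists y'.
  + by case: no; exists y => //; rewrite cg_sym.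
  + exact: iR.
- move=> y yX; have [->|ne] := eqVneq y x.
    by exists x; rewrite ?cg_refl // !inE eqxx.
  have [|z zR h] := cR y; first by rewrite !inE ne.
  by exists z; rewrite // !inE zR orbT.
Qed.

Lemma card_inj_mod m (U Z : {fset int}) : inj_mod m U ->
  (forall u, u \in U -> exists2 z, z \in Z & cg m u z) -> (#|` U| <= #|` Z|)%N.
Proof.
move=> iU h.
apply: leq_trans (card_le_cover (r := Z) (F := fun z => cls m z U) _) _.
  by move=> u uU; have [z zZ uz] := h _ uU; exists z; rewrite // in_cls uU.
rewrite card_fset_sum1; apply: leq_sum => z _.
have [->|[x]] := fset_0Vmem (cls m z U); first by rewrite cardfs0.
rewrite in_cls => /andP[xU xz].
have -> : cls m z U = [fset x].
  apply/fsetP => y; rewrite in_cls !inE; apply/andP/eqP => [[yU yz]|-> //].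
  by apply: iU => //; apply: cg_trans yz _; rewrite cg_sym.
by rewrite cardfs1.
Qed.

(** * Sumsets modulo m *)

Definition constm (m : nat) (X : {fset int}) : Prop :=
  {in X &, forall x y, cg m x y}.

Lemma constm_sub m X Y : X `<=` Y -> constm m Y -> constm m X.
Proof. by move=> /fsubsetP h hY x y /h xY /h; apply: hY. Qed.

Lemma constm_cls m c X : constm m (cls m c X).
Proof.
move=> x y; rewrite !in_cls => /andP[_ xc] /andP[_ yc].
by apply: cg_trans xc _; rewrite cg_sym.
Qed.

Lemma constm_dvd m n X : (n %| m)%N -> constm m X -> constm n X.
Proof. by move=> h hX x y xX yX; apply: cg_dvd h _; apply: hX. Qed.

Lemma constm_dil m l X : constm m X -> constm m (dil l X).
Proof. by move=> h _ _ /in_dil[x xX ->] /in_dil[y yX ->]; apply/cgM/h. Qed.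

Lemma constm_addS m X Y : constm m X -> constm m Y -> constm m (addS X Y).
Proof.
by move=> hX hY _ _ /in_addS[x [y [? ? ->]]] /in_addS[x' [y' [? ? ->]]];
  apply: cgD; [apply: hX | apply: hY].
Qed.

Lemma constm_big m (J : Type) (r : seq J) (P : pred J) (F : J -> {fset int}) :
  (forall j, P j -> constm m (F j)) ->
  constm m (\big[addS/[fset 0]]_(j <- r | P j) F j).
Proof.
move=> h; apply: big_ind => //.
  by move=> x y; rewrite !inE => /eqP -> /eqP ->; apply: cg_refl.
exact: constm_addS.
Qed.

Lemma mem_big (J : Type) (r : seq J) (P : pred J) (F : J -> {fset int}) (a : J -> int) :
  (forall j, P j -> a j \in F j) ->
  \sum_(j <- r | P j) a j \in \big[addS/[fset 0]]_(j <- r | P j) F j.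
Proof.
move=> h; elim/big_ind2: _ => //; first by rewrite inE.
by move=> x X y Y; apply: mem_addS.
Qed.

Lemma big_dec (J : eqType) (r : seq J) (P : pred J) (F : J -> {fset int}) x :
  uniq r -> x \in \big[addS/[fset 0]]_(j <- r | P j) F j ->
  exists2 a : J -> int, forall j, j \in r -> P j -> a j \in F j &
    x = \sum_(j <- r | P j) a j.
Proof.
elim: r x => [|i r IH] x /=.
  by rewrite big_nil inE => _ /eqP ->; exists (fun=> 0) => //; rewrite big_nil.
move=> /andP[ir ur]; rewrite big_cons; case: ifP => Pi.
  move=> /in_addS[y [z [yF /(IH _ ur)[a ha ->] ->]]].
  exists (fun j => if j == i then y else a j).
    move=> j; rewrite inE; have [->|_] := eqVneq j i; first by [].
    exact: ha.
  rewrite big_cons Pi eqxx; congr (_ + _).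
  rewrite -[LHS]big_filter -[RHS]big_filter.
  apply: eq_big_seq => j; rewrite mem_filter => /andP[_ jr].
  by case: eqVneq => // E; rewrite -E jr in ir.
move=> /(IH _ ur)[a ha ->]; exists a; last by rewrite big_cons Pi.
move=> j; rewrite inE => /orP[/eqP ->|]; first by rewrite Pi.
exact: ha.
Qed.

Lemma big_addS_sub (J : Type) (r : seq J) (P : pred J) (F F' : J -> {fset int}) :
  (forall j, P j -> F j `<=` F' j) ->
  \big[addS/[fset 0]]_(j <- r | P j) F j `<=` \big[addS/[fset 0]]_(j <- r | P j) F' j.
Proof.
by move=> h; elim/big_ind2: _ => // X X' Y Y'; apply: addSS.
Qed.

Lemma dilS l X Y : X `<=` Y -> dil l X `<=` dil l Y.
Proof. by move=> /fsubsetP h; apply/fsubsetP => _ /in_dil[x /h xX ->]; apply: mem_dil. Qed.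

(* Apply [card_addS] to [B'] and each class of X modulo [l m]. *)
Lemma card_add_dil (l : int) m (X R B B' : {fset int}) b0 :
  l != 0 -> R `<=` X -> inj_mod (`|l| * m) R -> B' `<=` B -> constm m B' ->
  b0 \in B' ->
  (#|` X| + #|` R| * (#|` B'|.-1) <= #|` addS X (dil l B)|)%N.
Proof.
move=> l0 RX iR BB cB b0B.
have [R' [R'X iR' cR']] := reps_exist (`|l| * m) X.
have le_R : (#|` R| <= #|` R'|)%N.
  by apply: card_inj_mod iR _ => u uR; apply/cR'/(fsubsetP RX).
pose F z := addS (cls (`|l| * m) z X) (dil l B').
have hF : (\sum_(z <- R') #|` F z| <= #|` addS X (dil l B)|)%N.
  apply: (@sum_card_le _ _ (`|l| * m) _ _ (fun z => z + l * b0)).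
  - exact: fset_uniq.
  - by move=> z _; apply: addSS; [apply: cls_sub | apply: dilS].
  - move=> z x _ /in_addS[u [_ [+ /in_dil[b bB ->] ->]]].
    rewrite in_cls => /andP[_ uz]; apply: cgD => //.
    have := cB _ _ bB b0B; rewrite /cg -mulrBr !dvdzE abszM.
    by rewrite absz_nat; apply: dvdn_mul.
  - by move=> z z' zR z'R; rewrite cgDr; apply: iR'.
apply: leq_trans hF.
apply: (@leq_trans (\sum_(z <- R') (#|` cls (`|l| * m) z X| + #|` B'|.-1))%N).
  rewrite big_split /= leq_add //.
    apply: card_le_cover => x xX; have [z zR h] := cR' _ xX.
    by exists z; rewrite // in_cls xX.
  by rewrite big_const_seq count_predT iter_addn_0 mulnC leq_mul2l le_R orbT.
rewrite big_seq [X in (_ <= X)%N]big_seq; apply: leq_sum => z zR.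
have zc : z \in cls (`|l| * m) z X by rewrite in_cls cg_refl (fsubsetP R'X).
have := card_addS zc (mem_dil l b0B); rewrite card_dil // /F.
have : (0 < #|` B'|)%N by rewrite cardfs_gt0; apply/fset0Pn; exists b0.
by case: #|` B'| => // n _; rewrite addnS.
Qed.

Lemma fset_argmax (f : int -> nat) (X : {fset int}) x0 : x0 \in X ->
  exists2 x, x \in X & forall y, y \in X -> (f y <= f x)%N.
Proof.
move=> x0X.
have [x _ hx] := @arg_maxnP X [` x0X] predT (fun x => f (val x)) isT.
exists (val x); first exact: valP.
by move=> y yX; apply: (hx [` yX]).
Qed.

Lemma cg_coprime m n x y : coprime m n -> cg m x y -> cg n x y -> cg (m * n) x y.
Proof. by rewrite /cg !dvdzE => cmn h1 h2; rewrite absz_nat Gauss_dvd // h1. Qed.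

Lemma inj_mod_card1 (D : {fset int}) : inj_mod 1 D -> (#|` D| <= 1)%N.
Proof.
move=> h; have := @card_inj_mod 1 D [fset 0] h; rewrite cardfs1; apply.
by move=> u _; exists 0; rewrite ?inE // /cg dvd1z.
Qed.

(* Induction on r, peeling off one coefficient nu_j: modulo the part Q of m coprime to
   nu_j that summand alone provides the classes, while the remaining summands are
   taken inside a largest fibre of D modulo Q. *)
Lemma reps_big (I : eqType) (nu : I -> int) (r : seq I) m (D : {fset int}) :
  (0 < m)%N -> (forall j, j \in r -> nu j != 0) ->
  (forall p, prime p -> (p %| m)%N -> exists2 j, j \in r & ~~ (p %| `|nu j|)%N) ->
  inj_mod m D ->
  exists R : {fset int}, [/\ R `<=` \big[addS/[fset 0]]_(j <- r) dil (nu j) D,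
    inj_mod m R & (#|` D| <= #|` R|)%N].
Proof.
elim: r m D => [|j r IH] m D m0 nz hp iD.
  have m1 : m = 1%N.
    apply/eqP; rewrite eqn_leq m0 andbT leqNgt; apply/negP => m1.
    by have [] := hp _ (pdiv_prime m1) (pdiv_dvd m).
  exists [fset 0]; rewrite big_nil fsubset_refl cardfs1; split => //.
    by move=> x y; rewrite !inE => /eqP -> /eqP ->.
  by apply: inj_mod_card1; rewrite -m1.
have [->|[x0 x0D]] := fset_0Vmem D.
  by exists fset0; rewrite fsub0set cardfs0; split.
set n := `|nu j|%N.
have n0 : (0 < n)%N by rewrite lt0n absz_eq0 nz // mem_head.
set Q := (m`_(\pi(n)^'))%N; set m1 := (m`_\pi(n))%N.
have mE : (m1 * Q = m)%N by apply: partnC.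
have cQ : coprime m1 Q by apply: coprime_partC.
have Q0 : (0 < Q)%N := part_gt0 _ _.
have m10 : (0 < m1)%N := part_gt0 _ _.
have nQ : coprime Q n.
  rewrite coprime_has_primes // -all_predC; apply/allP => p /=.
  rewrite !mem_primes => /and3P[pp _ pn].
  rewrite Q0 /= pp /=; apply/negP => pQ.
  have := part_pnat (\pi(n)^') m; rewrite -/Q => /pnatP h.
  by have := h Q0 _ pp pQ; rewrite !inE /= mem_primes pp n0 pn.
have [R0 [R0D iR0 cR0]] := reps_exist Q D.
have [z0 z0R _] := cR0 _ x0D.
have [b bR hb] := fset_argmax (fun z => #|` cls Q z D|) z0R.
set Db := cls Q b D.
have cDb : constm Q Db := constm_cls (m := Q) (c := b) (X := D).
have [|||R1 [R1s iR1 le1]] := IH m1 Db m10.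
- by move=> i ir; rewrite nz // inE ir orbT.
- move=> p pp pm1.
  have pn : (p %| n)%N.
    have := part_pnat \pi(n) m; rewrite -/m1 => /pnatP h.
    by have := h m10 _ pp pm1; rewrite mem_primes => /and3P[].
  have [|i] := hp p pp; first by rewrite -mE dvdn_mulr.
  rewrite inE => /orP[/eqP ->|ir hi]; first by rewrite pn.
  by exists i.
(* [Db] is constant modulo [Q], so incongruence modulo [m = m1 * Q] becomes incongruence modulo
   [m1]. *)
- move=> x y xD yD h; apply: iD; try exact: (fsubsetP (cls_sub _ _ _)).
    exact: (fsubsetP (cls_sub Q b D)).
    exact: (fsubsetP (cls_sub Q b D)).
  by rewrite -mE; apply: cg_coprime => //; apply: cDb.
have cR1 : constm Q R1.
  by apply: constm_sub R1s _; apply: constm_big => i _; apply: constm_dil.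
exists (addS (dil (nu j) R0) R1); split.
- rewrite big_cons; apply: addSS; first exact: dilS.
  by apply: fsubset_trans R1s _; apply: big_addS_sub => i _; apply/dilS/cls_sub.
- move=> _ _ /in_addS[_ [y [/in_dil[x xR ->] yR ->]]]
    /in_addS[_ [y' [/in_dil[x' x'R ->] y'R ->]]] h.
  (* [R1] is constant modulo [Q], so the sum determines [nu j * x], hence [x]; the other summand is
     then settled modulo [m1]. *)
  have hQ : cg Q (nu j * x) (nu j * x').
    have h1 : cg Q (nu j * x + y) (nu j * x' + y') by apply: cg_dvd h; rewrite -mE dvdn_mull.
    have := cgD h1 (cgN (cR1 _ _ yR y'R)).
    by rewrite !addrK.
  have xx : x = x'.
    apply: iR0 => //; move: hQ; rewrite /cg -mulrBr !dvdzE abszM Gauss_dvdr //.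
  rewrite xx in h *; move: h; rewrite cgDl => h; congr (_ + _).
  by apply: iR1 => //; apply: cg_dvd h; rewrite -mE dvdn_mulr.
- apply: (@leq_trans (#|` R0| * #|` Db|)%N).
    apply: (@leq_trans (\sum_(z <- R0) #|` cls Q z D|)%N).
      apply: card_le_cover => x xD; have [z zR h] := cR0 _ xD.
      by exists z; rewrite // in_cls xD.
    rewrite big_seq; apply: (@leq_trans (\sum_(z <- R0 | z \in R0) #|` Db|)%N).
      by apply: leq_sum => z zR; apply: hb.
    by rewrite -big_seq big_const_seq count_predT iter_addn_0 mulnC.
  apply: (@leq_trans (#|` R0| * #|` R1|)%N); first by rewrite leq_mul2l le1 orbT.
  have [->|[y0 y0R]] := fset_0Vmem R1; first by rewrite cardfs0 muln0.
  have := @sum_card_le _ R0 Q (addS (dil (nu j) R0) R1)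
     (fun x => [fset nu j * x + y | y in R1]) (fun x => nu j * x + y0) (fset_uniq _).
  rewrite (eq_bigr (fun=> #|` R1|)) => [|x _]; last exact: card_transl.
  rewrite big_const_seq count_predT iter_addn_0 mulnC; apply.
  + move=> x xR; apply/fsubsetP => _ /imfsetP[y /= yR ->].
    by apply: mem_addS => //; apply: mem_dil.
  + by move=> x z xR /imfsetP[y /= yR ->]; rewrite cgDl; apply: cR1.
  + move=> x x' xR x'R; rewrite cgDr => h; apply: iR0 => //.
    by move: h; rewrite /cg -mulrBr !dvdzE abszM Gauss_dvdr.
Qed.

(** * Periods of sets of integers closed under shifts *)

Lemma subgroupZ (H : int -> Prop) (L : nat) :
  (0 < L)%N -> H L%:Z -> (forall x y, H x -> H y -> H (x - y)) ->
  exists2 h : nat, (0 < h)%N & forall d, H d <-> (h%:Z %| d)%Z.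
Proof.
move=> L0 HL HB.
have H0 : H 0 by rewrite -(subrr L%:Z); apply: HB.
have HN x : H x -> H (- x) by move=> hx; rewrite -sub0r; apply: HB.
have HD x y : H x -> H y -> H (x + y) by move=> hx hy; rewrite -(opprK y); apply/HB/HN.
pose P n := (0 < n)%N && `[< H n%:Z >].
have exP : exists n, P n by exists L; rewrite /P L0; apply/asboolP.
case: (ex_minnP exP) => h /andP[h0 /asboolP Hh] hmin; exists h => // d.
have HM z : H (z * h%:Z).
  have HMn (n : nat) : H (n%:Z * h%:Z).
    elim: n => [|n IH]; first by rewrite mul0r.
    by rewrite -addn1 PoszD mulrDl mul1r; apply: HD.
  by case: (intP z) => [|n|n]; rewrite ?mul0r // ?mulNr //; apply/HN/HMn.
split => [Hd|/dvdzP[z ->]]; last exact: HM.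
apply/dvdz_mod0P; apply/eqP; apply/negPn/negP => ne.
have Hr : H (d %% h)%Z.
  have -> : (d %% h)%Z = d - (d %/ h)%Z * h by rewrite /modz.
  exact: HB.
have r0 : 0 <= (d %% h)%Z by rewrite modz_ge0 // -lt0n.
have rl : (d %% h)%Z < h by apply: ltz_pmod; rewrite ltz_nat.
have := hmin `|(d %% h)%Z|%N; rewrite /P gez0_abs // absz_gt0 ne /=.
by rewrite asboolT // => /(_ isT); lia.
Qed.

Lemma shift_group (W : int -> Prop) (L : nat) : (0 < L)%N ->
  (forall x z, W x -> W (x + L%:Z * z)) ->
  exists2 h : nat, (0 < h)%N &
    forall d, (forall x, W x -> W (x + d)) <-> (h%:Z %| d)%Z.
Proof.
move=> L0 hW; apply: (@subgroupZ (fun d => forall x, W x -> W (x + d)) L) => //.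
  by move=> x Wx; rewrite -[L%:Z]mulr1; apply: hW.
move=> d d' hd hd' x Wx.
have hM (n : nat) y : W y -> W (y + d' * n%:Z).
  move=> Wy; elim: n => [|n IH]; first by rewrite mulr0 addr0.
  by rewrite -addn1 PoszD mulrDr mulr1 addrA; apply: hd'.
(* Only forward shifts are available: subtracting [d'] is adding it [L - 1] times and going back by
   a multiple of the period [L]. *)
have -> : x + (d - d') = x + d + d' * L.-1%:Z + L%:Z * (- d').
  have -> : L%:Z = L.-1%:Z + 1 by lia.
  ring.
by apply/hW/hM/hd.
Qed.

(** The period of [W] divides [L] and every element of [D], so it has no prime factor. *)
Lemma shift_all (W : int -> Prop) (L : nat) (D : int -> Prop) x0 : (0 < L)%N ->
  (forall x z, W x -> W (x + L%:Z * z)) ->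
  (forall d, D d -> forall x, W x -> W (x + d)) ->
  (forall p, prime p -> (p %| L)%N -> exists2 d, D d & ~~ (p%:Z %| d)%Z) ->
  W x0 -> forall x, W x.
Proof.
move=> L0 hW hD hp W0 x.
have [h h0 hh] := shift_group L0 hW.
have hL : (h %| L)%N.
  have /hh : forall y, W y -> W (y + L%:Z) by move=> y Wy; rewrite -[L%:Z]mulr1; apply: hW.
  by rewrite dvdzE.
have h1 : h = 1%N.
  apply/eqP; rewrite eqn_leq h0 andbT leqNgt; apply/negP => h1.
  have [d Dd] := hp _ (pdiv_prime h1) (dvdn_trans (pdiv_dvd h) hL).
  case/negP; apply: (@dvdz_trans h); first by rewrite dvdzE pdiv_dvd.
  by apply/hh/hD.
have /hh : (h%:Z %| x - x0)%Z by rewrite h1 dvd1z.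
by move=> /(_ _ W0); rewrite subrKC.
Qed.

(* The sets of residues where [V j] holds increase with j, so two consecutive ones
   coincide before step L; such a set is closed under the moves. *)
Lemma chain_full (L : nat) (V : nat -> int -> bool) (mv : int -> int -> Prop) x0 :
  (0 < L)%N -> (forall j x z, V j x -> V j (x + L%:Z * z)) ->
  (forall j x, V j x -> V j.+1 x) ->
  (forall j x y, (j < L)%N -> V j x -> mv x y -> V j.+1 y) -> V 0%N x0 ->
  (forall W : int -> Prop, (forall x z, W x -> W (x + L%:Z * z)) -> W x0 ->
    (forall x y, W x -> mv x y -> W y) -> forall x, W x) ->
  forall x, V L x.
Proof.
move=> L0 per mono step V0 all.
pose S j := [set i : 'I_L | V j (i : nat)%:Z].
have V0j j : V j x0 by elim: j => // j; apply: mono.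
(* Each step either gains a residue or finds everything already filled; at [j = L] there is no room
   left to gain. *)
have key j : (j <= L)%N -> (forall x, V j x) \/ (j < #|S j|)%N.
  have ex : exists i : 'I_L, forall k, V k i%:Z.
    have lt : (`|(x0 %% L)%Z| < L)%N.
      have := @ltz_pmod x0 L; have := @modz_ge0 x0 L.
      by rewrite -lt0n ltz_nat L0 => /(_ isT) h1 /(_ isT) h2; lia.
    exists (Ordinal lt) => k /=; rewrite gez0_abs; last by rewrite modz_ge0 // -lt0n.
    have -> : (x0 %% L)%Z = x0 + L%:Z * (- (x0 %/ L)%Z) by rewrite /modz; ring.
    exact: per.
  case: ex => i0 hi0.
  elim: j => [_|j IHj jL].
    by right; apply/card_gt0P; exists i0; rewrite inE.
  case: (IHj (ltnW jL)) => [IH|IH].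
  - by left => x; apply/mono/IH.
  - have sub : S j \subset S j.+1 by apply/subsetP => i; rewrite !inE; apply: mono.
    have [E|ne] := eqVneq (S j) (S j.+1).
      left => x; apply: mono; move: x; apply: all => //; first exact: per.
      move=> x y Vx mxy; have Vy := step _ _ _ jL Vx mxy.
      have lt : (`|(y %% L)%Z| < L)%N.
        have := @ltz_pmod y L; have := @modz_ge0 y L.
        by rewrite -lt0n ltz_nat L0 => /(_ isT) h1 /(_ isT) h2; lia.
      have yE : y = (Ordinal lt : nat)%:Z + L%:Z * (y %/ L)%Z.
        by rewrite /= gez0_abs; [rewrite {1}(divz_eq y L) addrC mulrC | rewrite modz_ge0 // -lt0n].
      rewrite yE; apply/per.
      have : Ordinal lt \in S j.+1.
        rewrite inE.
        have e : (Ordinal lt : nat)%:Z = y + L%:Z * (- (y %/ L)%Z).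
          by rewrite {2}yE; ring.
        by rewrite e; apply: per.
      by rewrite -E inE.
    right; apply: leq_ltn_trans IH _; apply: proper_card.
    by rewrite properEneq ne.
case: (key L (leqnn L)) => // h x.
by have := max_card (mem (S L)); rewrite card_ord leqNgt h.
Qed.

(** * Full classes along a chain of moduli *)

(* The class of c modulo P is full when X meets all the L classes modulo [P * L] inside it. *)
Definition full (P L : nat) (X : {fset int}) (c : int) : bool :=
  [forall j : 'I_L, [exists x : X, cg (P * L) (val x) (c + P%:Z * (j : nat)%:Z)]].

Lemma cg_addM (m : nat) (x z : int) : cg m (x + m%:Z * z) x.
Proof. by rewrite /cg addrAC subrr add0r dvdz_mulr. Qed.

Lemma cg_ord (L : nat) (x : int) : (0 < L)%N -> exists i : 'I_L, cg L x (i : nat)%:Z.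
Proof.
move=> L0.
have lt : (`|(x %% L)%Z| < L)%N.
  have := @ltz_pmod x L; have := @modz_ge0 x L.
  by rewrite -lt0n ltz_nat L0 => /(_ isT) h1 /(_ isT) h2; lia.
exists (Ordinal lt); rewrite /= gez0_abs; last by rewrite modz_ge0 // -lt0n.
by rewrite /cg {1}(divz_eq x L) addrK dvdz_mull.
Qed.

Lemma cg_ord_inj (L : nat) (i j : 'I_L) : cg L (i : nat)%:Z (j : nat)%:Z -> i = j.
Proof.
case: i j => i hi [j hj] /=; rewrite /cg dvdzE => h; apply/val_inj => /=.
by have := @dvdn_leq L `|i%:Z - j%:Z|%N; rewrite absz_nat in h *; lia.
Qed.

Lemma cgMl (P L : nat) (x y : int) : cg L x y -> cg (P * L) (P%:Z * x) (P%:Z * y).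
Proof. by rewrite /cg -mulrBr PoszM; apply: dvdz_mul. Qed.

Lemma cgMlE (P L : nat) (x y : int) : (0 < P)%N ->
  cg (P * L) (P%:Z * x) (P%:Z * y) = cg L x y.
Proof. by move=> P0; rewrite /cg -mulrBr PoszM dvdz_mul2l // eqz_nat -lt0n. Qed.

Lemma fullP P L X c : (0 < L)%N ->
  reflect (forall j : int, exists2 x, x \in X & cg (P * L) x (c + P%:Z * j))
    (full P L X c).
Proof.
move=> L0; apply: (iffP forallP) => [h j|h j].
  have [i hi] := cg_ord j L0; have /existsP[x hx] := h i.
  exists (val x); first exact: valP.
  by apply: cg_trans hx _; rewrite cgDl; apply: cgMl; rewrite cg_sym.
have [x xX hx] := h (j : nat)%:Z.
by apply/existsP; exists [` xX].
Qed.

Lemma full_cg P L X c c' : (0 < L)%N -> cg P c c' -> full P L X c -> full P L X c'.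
Proof.
move=> L0 /dvdzP[q hq] /(fullP _ _ _ L0) h; apply/(fullP _ _ _ L0) => j.
have [x xX hx] := h (j - q); exists x => //; apply: cg_trans hx _.
have -> : c = c' + q * P%:Z by rewrite -hq subrKC.
rewrite (_ : c' + q * P%:Z + P%:Z * (j - q) = c' + P%:Z * j) ?cg_refl //; ring.
Qed.

Lemma full_eq P L X c c' : (0 < L)%N -> cg P c c' -> full P L X c = full P L X c'.
Proof.
move=> L0 h; apply/idP/idP; apply: full_cg => //; by rewrite cg_sym.
Qed.

Lemma full_sub P L X Y c : X `<=` Y -> full P L X c -> full P L Y c.
Proof.
move=> /fsubsetP s /forallP h; apply/forallP => j; have /existsP[x hx] := h j.
by apply/existsP; exists [` s _ (valP x)].
Qed.

Lemma full_cls P L X c : (0 < L)%N -> full P L (cls P c X) c = full P L X c.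
Proof.
move=> L0; apply/idP/idP; first by apply/full_sub/cls_sub.
move=> /(fullP _ _ _ L0) h; apply/(fullP _ _ _ L0) => j.
have [x xX hx] := h j; exists x => //; rewrite in_cls xX /=.
by apply: cg_trans (cg_dvd (dvdn_mulr _ (dvdnn P)) hx) (cg_addM _ _ _).
Qed.

(* [w] is the weight inherited from the deeper levels.  If replacing one subclass of X by
   a shifted copy of another never gains [#|` X|], then the sizes of the subclasses
   are within a factor [2 W] along each generating step, hence all positive. *)
Lemma node_gain (L W P : nat) (X Y Y' : {fset int}) (c y0 : int) (w : int -> nat) :
  let H := (2 * (L * (2 * W) ^ L))%N in
  (0 < L)%N -> (0 < W)%N -> (0 < P)%N -> (forall x, x \in X -> cg P x c) ->
  Y' `<=` Y -> y0 \in Y' -> constm P Y -> constm (P * L) Y' ->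
  (forall p, prime p -> (p %| L)%N -> exists2 y, y \in Y & ~~ cg (P * p) y y0) ->
  (forall x, (w x <= W * H)%N) ->
  (forall l : int, (\sum_(x <- cls (P * L) (c + P%:Z * l) X) w x <=
     H * #|` addS (cls (P * L) (c + P%:Z * l) X) Y'|)%N) ->
  (\sum_(x <- X) w x + ~~ full P L X c * #|` X| <= H * #|` addS X Y|)%N.
Proof.
move=> H L0 W0 P0 Xc Y'Y y0Y cY cY' gen wle hsub.
pose N l := cls (P * L) (c + P%:Z * l) X.
pose Om l := (\sum_(x <- N l) w x)%N.
have Nper l z : N (l + L%:Z * z) = N l.
  apply: cls_eq; rewrite mulrDr addrA mulrA -PoszM; exact: cg_addM.
have Ncg l l' : cg L l l' -> N l = N l'.
  by move=> h; apply: cls_eq; rewrite cgDl; apply: cgMl.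
have cov x : x \in X -> exists2 l : 'I_L, l \in index_enum 'I_L & x \in N (l : nat)%:Z.
  move=> xX; have /dvdzP[q hq] := Xc _ xX.
  have [i hi] := cg_ord q L0; exists i; first exact: mem_index_enum.
  rewrite in_cls xX /= (_ : x = c + P%:Z * q) ?cgDl; first exact: cgMl.
  by rewrite mulrC -hq subrKC.
have covw : (\sum_(x <- X) w x <= \sum_(l < L) Om (l : nat)%:Z)%N.
  exact: sum_le_cover cov.
have base (G : 'I_L -> {fset int}) : (forall i, G i `<=` addS X Y) ->
    (forall i x, x \in G i -> cg (P * L) x (c + P%:Z * (i : nat)%:Z + y0)) ->
    (\sum_i #|` G i| <= #|` addS X Y|)%N.
  move=> h1 h2; apply: (@sum_card_le _ _ (P * L) _ _
     (fun i : 'I_L => c + P%:Z * (i : nat)%:Z + y0)) => //.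
  - exact: index_enum_uniq.
  - by move=> j x _; apply: h2.
  - by move=> i j _ _; rewrite cgDr cgDl cgMlE //; apply: cg_ord_inj.
have dflt_sub i : addS (N i) Y' `<=` addS X Y by apply: addSS => //; apply: cls_sub.
have dflt_cg i x : x \in addS (N i) Y' -> cg (P * L) x (c + P%:Z * i + y0).
  move=> /in_addS[u [y [+ yY ->]]]; rewrite in_cls => /andP[_ hu].
  by apply: cgD => //; apply: cY'.
case Ful: (full P L X c).
  rewrite mul0n addn0; apply: leq_trans covw _.
  apply: (@leq_trans (\sum_(i < L) H * #|` addS (N (i : nat)%:Z) Y'|)%N).
    by apply: leq_sum => i _; apply: hsub.
  rewrite -big_distrr leq_mul2l /=; apply/orP; right; apply: base => i.
    exact: dflt_sub.
  exact: dflt_cg.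
rewrite mul1n; set F := #|` X|.
have [F0|Fpos] := posnP F.
  rewrite F0 addn0; have -> : X = fset0 by apply/cardfs0_eq.
  by rewrite big_seq_fset0.
rewrite leqNgt; apply/negP => lt.
have {}lt : (H * #|` addS X Y| < \sum_(l < L) Om (l : nat)%:Z + F)%N.
  by apply: leq_trans lt _; rewrite leq_add2r.
(* The translate [N l' + y] lies in the same class as [N l + Y']; putting it in that place must not
   reach the bound assumed to fail. *)
have key l l' y : y \in Y -> cg (P * L) (P%:Z * l' + y) (P%:Z * l + y0) ->
    (H * #|` N l'| < Om l + F)%N.
  move=> yY hy; have [i0 hi0] := cg_ord l L0.
  have El : Om l = Om (i0 : nat)%:Z by rewrite /Om (Ncg _ _ hi0).
  rewrite El ltnNge; apply/negP => ge.
  pose G (i : 'I_L) := if i == i0 then [fset x + y | x in N l'] else addS (N (i : nat)%:Z) Y'.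
  have hG : (\sum_i #|` G i| <= #|` addS X Y|)%N.
    apply: base => i; rewrite /G; case: (i =P i0) => [E|_].
    - apply/fsubsetP => _ /imfsetP[x /= xN ->]; apply: mem_addS => //.
      exact: (fsubsetP (cls_sub _ _ _) _ xN).
    - exact: dflt_sub.
    - move=> _ /imfsetP[x /= + ->]; rewrite in_cls => /andP[_ hx].
    apply: (@cg_trans _ (c + P%:Z * l' + y)); first by rewrite cgDr.
    rewrite E -!addrA cgDl; apply: cg_trans hy _.
      by rewrite cgDr; apply: cgMl.
    - exact: dflt_cg.
  move: lt; rewrite ltnNge => /negP; apply.
  apply: leq_trans (leq_mul (leqnn H) hG).
  rewrite [X in (X + _ <= _)%N](bigD1 i0) //= [X in (_ <= _ * X)%N](bigD1 i0) //=.
  rewrite {1}/G eqxx card_imfset; last exact: addIr.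
  rewrite mulnDr -addnA [X in (_ + X <= _)%N]addnC addnA leq_add //.
  rewrite big_distrr /=; apply: leq_sum => i /negbTE ne.
  by rewrite /G ne; apply: hsub.
have Omle l : (Om l <= W * H * #|` N l|)%N.
  rewrite /Om card_fset_sum1 big_distrr /=; apply: leq_sum => x _.
  by rewrite muln1.
pose V j l := (F <= #|` N l| * (L * (2 * W) ^ j))%N.
pose mv l l2 := exists2 y, y \in Y & cg (P * L) (P%:Z * l + y) (P%:Z * l2 + y0).
have [l0 Vl0] : exists l0 : 'I_L, V 0%N (l0 : nat)%:Z.
  apply: contrapT => no.
  have : (F * L <= \sum_(l < L) #|` N (l : nat)%:Z| * L)%N.
    by rewrite -big_distrl leq_mul2r /=; apply/orP; right; apply: card_le_cover cov.
  rewrite leqNgt => /negP; apply.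
  apply: (@leq_trans (\sum_(l < L) (#|` N (l : nat)%:Z| * L).+1)%N).
    under [X in (_ <= X)%N]eq_bigr do rewrite -addn1.
    by rewrite big_split /= sum_nat_const card_ord muln1 -[X in (X <= _)%N]addn1 leq_add2l.
  rewrite -[X in (_ <= _ * X)%N]card_ord mulnC -sum_nat_const.
  apply: leq_sum => i _; rewrite ltnNge; apply/negP => h.
  by apply: no; exists i; rewrite /V expn0 muln1.
have all := @chain_full L V mv (l0 : nat)%:Z L0.
have {}all : forall l, V L l.
  apply: all => //.
  - by move=> j l z; rewrite /V Nper.
  - move=> j l; rewrite /V => /leq_trans; apply; rewrite leq_mul2l leq_mul2l expnS.
    by rewrite leq_pmull ?orbT // muln_gt0.
  - move=> j l l2 jL Vl [y yY hy]; have := key _ _ _ yY hy => lt2.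
    rewrite /V leqNgt; apply/negP => lt3.
    (* [H] is [2 t] times the factor of [V j]. If [V j.+1 l2] failed, [key] would give
       [2 t F < t F + F]; the factor 2 in [H] makes room for both terms. *)
    pose t := ((2 * W) ^ (L - j))%N.
    have t0 : (0 < t)%N by rewrite expn_gt0 muln_gt0 W0.
    have HE : H = (2 * (L * (2 * W) ^ j) * t)%N.
      have -> : H = (2 * (L * ((2 * W) ^ j * t)))%N by rewrite /t -expnD subnKC // ltnW.
      by rewrite !mulnA.
    move: Vl lt3; rewrite /V expnS => Vl lt3.
    set n := #|` N l| in lt2 Vl; set n' := #|` N l2| in lt3 *.
    have := Omle l2; rewrite -/n' HE => h4; rewrite HE in lt2.
    set h := (L * (2 * W) ^ j)%N in Vl lt3 h4 lt2 *.
    have e1 : (2 * h * t * n = 2 * t * (n * h))%N by lia.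
    have e2 : (W * (2 * h * t) * n' = t * (n' * (2 * W * h)))%N by lia.
    have e3 : (n' * (L * (2 * W * (2 * W) ^ j)) = n' * (2 * W * h))%N by rewrite /h; lia.
    rewrite e1 in lt2; rewrite e2 in h4; rewrite e3 in lt3.
    have h5 : (2 * t * F <= 2 * t * (n * h))%N by rewrite leq_mul2l Vl orbT.
    have h6 : (t * (n' * (2 * W * h)) <= t * F)%N by rewrite leq_mul2l (ltnW lt3) orbT.
    have h7 : (F <= t * F)%N by rewrite leq_pmull.
    by move: lt2 h4 h5 h6 h7; lia.
  (* The quotients [(y - y0) / P] are shifts of [Wp], and by [gen] no prime of [L] divides them
     all. *)
  - move=> Wp perW W1 clW; apply: (@shift_all Wp L (fun d => exists2 y, y \in Y & P%:Z * d = y - y0) _ L0 perW _ _ W1).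
      move=> d [y yY hd] x Wx; apply: (clW x) => //; exists y => //.
      by rewrite mulrDr hd -addrA subrK cg_refl.
    move=> p pp pL; have [y yY hy] := gen _ pp pL.
    have /dvdzP[q hq] := cY _ _ yY (fsubsetP Y'Y _ y0Y).
    exists q; first by exists y; rewrite // hq mulrC.
    apply: contra hy; rewrite /cg hq PoszM mulrC => h; exact: dvdz_mul.
move/negbT/negP: Ful; apply; apply/(fullP _ _ _ L0) => j.
have /fset0Pn[x] : N j != fset0.
  by rewrite -cardfs_gt0 lt0n; apply/negP => /eqP E; have := all j; rewrite /V E mul0n leqNgt Fpos.
by rewrite in_cls => /andP[xX hx]; exists x.
Qed.

(** [Z] is a union of classes of [U]. As [Y] is constant modulo [m], different classes have disjoint
    sumsets with [Y], so their bounds add up. *)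
Lemma sum_cls_le (m H : nat) (Z U Y : {fset int}) (w : int -> nat) :
  constm m Y -> (exists y, y \in Y) ->
  (forall z, z \in Z -> cls m z U `<=` Z) ->
  (forall z, z \in Z -> z \in U) ->
  (forall z, (\sum_(x <- cls m z U) w x <= H * #|` addS (cls m z U) Y|)%N) ->
  (\sum_(x <- Z) w x <= H * #|` addS Z Y|)%N.
Proof.
move=> cY [y0 y0Y] hsub ZU hw.
have [R [RZ iR cR]] := reps_exist m Z.
apply: (@leq_trans (\sum_(z <- R) \sum_(x <- cls m z U) w x)%N).
  apply: sum_le_cover => x xZ; have [z zR h] := cR _ xZ.
  by exists z; rewrite // in_cls ZU.
apply: (@leq_trans (\sum_(z <- R) H * #|` addS (cls m z U) Y|)%N).
  by apply: leq_sum => z _; apply: hw.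
rewrite -big_distrr leq_mul2l /=; apply/orP; right.
apply: (@sum_card_le _ _ m _ _ (fun z => z + y0)).
- exact: fset_uniq.
- by move=> z zR; apply: addSS => //; apply: hsub; apply: (fsubsetP RZ).
- move=> z _ _ /in_addS[u [y [+ yY ->]]]; rewrite in_cls => /andP[_ h].
  by apply: cgD => //; apply: cY.
- by move=> z z' zR z'R; rewrite cgDr; apply: iR.
Qed.

(** Induction from the deepest level upwards: each level adds 1 to the weight of the points it
    leaves in a nonfull class, and [node_gain] pays for that. The cap [W * H] preserves the
    hypothesis of [node_gain] on weights. *)
Lemma sum_nonfull_chain (L W N : nat) (P : nat -> nat) (Y : nat -> {fset int})
    (X0 : {fset int}) :
  let H := (2 * (L * (2 * W) ^ L))%N in
  (0 < L)%N -> (0 < W)%N -> (forall s, 0 < P s)%N ->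
  (forall s, (s <= N)%N -> constm (P s) (Y s)) ->
  (forall s, (s < N)%N -> Y s.+1 `<=` Y s) ->
  (forall s, (s < N)%N -> constm (P s * L) (Y s.+1)) ->
  (forall s, (s < N)%N -> (P s * L %| P s.+1)%N) ->
  (forall s, (s <= N)%N -> exists y, y \in Y s) ->
  (forall s p, (s < N)%N -> prime p -> (p %| L)%N ->
     exists2 y, y \in Y s & exists2 y', y' \in Y s & ~~ cg (P s * p) y y') ->
  forall n s c, (s + n <= N)%N ->
  (\sum_(x <- cls (P s) c X0)
     minn (W * H) (H + \sum_(s <= t < s + n) ~~ full (P t) L X0 x)
   <= H * #|` addS (cls (P s) c X0) (Y s)|)%N.
Proof.
move=> H L0 W0 P0 cY sY cY' dvP neY gen; elim=> [|n IH] s c sn.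
  rewrite addn0; have [y yY] : exists y, y \in Y s by apply: neY; lia.
  apply: leq_trans (leq_mul (leqnn H) (card_addSl _ yY)).
  rewrite card_fset_sum1 big_distrr /=; apply: leq_sum => x _.
  by rewrite big_geq // addn0 muln1 geq_minr.
have sN : (s < N)%N by lia.
set X := cls (P s) c X0.
pose w x := minn (W * H) (H + \sum_(s.+1 <= t < s.+1 + n) ~~ full (P t) L X0 x)%N.
have [y0 y0Y] := neY _ sN.
have fullX x : x \in X -> full (P s) L X0 x = full (P s) L X c.
  rewrite in_cls => /andP[_ h]; rewrite full_cls //; exact: full_eq.
(* Fullness at level [s] is the same for all points of [X], and raising the second argument of a
   minimum by 1 raises the minimum by at most 1. *)
apply: (@leq_trans (\sum_(x <- X) w x + ~~ full (P s) L X c * #|` X|)%N).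
  rewrite card_fset_sum1 big_distrr /= -big_split /= big_seq [X in (_ <= X)%N]big_seq.
  apply: leq_sum => x xX; rewrite /w addnS -addSn big_ltn; last by lia.
  rewrite fullX // muln1; set b := (~~ _ : nat); set u := (\sum_(_ <= _ < _) _)%N.
  by rewrite addnCA addnC -addnA; lia.
apply: (@node_gain L W (P s) X (Y s) (Y s.+1) c y0 w) => //.
- by move=> x; rewrite in_cls => /andP[].
- exact: sY.
- by apply: cY; lia.
- exact: cY'.
- move=> p pp pL; have [y yY [y' y'Y ne]] := gen _ _ sN pp pL.
  have [h|h] := boolP (cg (P s * p) y y0); last by exists y.
  exists y' => //; apply: contra ne => h'; apply: cg_trans h _; by rewrite cg_sym.
- by move=> x; rewrite /w geq_minl.
- move=> l; apply: (@sum_cls_le (P s.+1) H _ X0).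
  + by apply: cY; lia.
  + by exists y0.
  + move=> z; rewrite in_cls => /andP[zX hz]; apply/fsubsetP => x; rewrite !in_cls.
    move: zX; rewrite in_cls => /andP[_ zc] /andP[-> xz] /=.
    have h1 : cg (P s * L) x z by apply: cg_dvd xz; apply: dvP.
    apply/andP; split; last exact: cg_trans h1 hz.
    by apply: cg_trans zc; apply: cg_dvd h1; apply: dvdn_mulr.
  + by move=> z /(fsubsetP (cls_sub _ _ _)) /(fsubsetP (cls_sub _ _ _)).
  + by move=> z; apply: IH; lia.
Qed.

(** With [N = W * H] levels the cap is never active. On average over the levels, at most |X0 + Y 0|
    / W points are nonfull. *)
Lemma sum_nonfull_le (L W : nat) (P : nat -> nat) (Y : nat -> {fset int}) (X0 : {fset int}) :
  let H := (2 * (L * (2 * W) ^ L))%N in let N := (W * H)%N in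
  (0 < L)%N -> (0 < W)%N -> (forall s, 0 < P s)%N ->
  (forall s, (s <= N)%N -> constm (P s) (Y s)) ->
  (forall s, (s < N)%N -> Y s.+1 `<=` Y s) ->
  (forall s, (s < N)%N -> constm (P s * L) (Y s.+1)) ->
  (forall s, (s < N)%N -> (P s * L %| P s.+1)%N) ->
  (forall s, (s <= N)%N -> exists y, y \in Y s) ->
  (forall s p, (s < N)%N -> prime p -> (p %| L)%N ->
     exists2 y, y \in Y s & exists2 y', y' \in Y s & ~~ cg (P s * p) y y') ->
  (\sum_(t < N) #|` [fset x in X0 | ~~ full (P t) L X0 x]| <= H * #|` addS X0 (Y 0%N)|)%N.
Proof.
move=> H N L0 W0 P0 cY sY cY' dvP neY gen.
apply: (@leq_trans (\sum_(x <- X0) \sum_(0 <= t < N) ~~ full (P t) L X0 x)%N).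
  rewrite exchange_big /= big_mkord; apply: leq_sum => t _.
  rewrite card_fset_sum1 (eq_bigr (fun x => if ~~ full (P t) L X0 x then 1 else 0)%N); last first.
    by move=> x _; case: (full _ _ _ _).
  rewrite -big_mkcond /= -[X in (_ <= X)%N]big_filter; apply: eq_leq.
  apply: perm_big; apply: uniq_perm; rewrite ?filter_uniq ?fset_uniq // => x.
  by rewrite mem_filter !inE andbC.
apply: (@sum_cls_le (P 0%N) H _ X0) => //.
- exact: cY.
- exact: neY.
- by move=> z _; apply: cls_sub.
move=> z; apply: leq_trans (@sum_nonfull_chain L W N P Y X0 L0 W0 P0 cY sY cY' dvP neY gen N 0 z _) => //.
apply: leq_sum => x _; rewrite add0n leq_min; apply/andP; split; last exact: leq_addl.
apply: (@leq_trans (\sum_(0 <= t < N) 1)%N); first by apply: leq_sum => t _; apply: leq_b1.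
by rewrite sum_nat_const_nat subn0 muln1.
Qed.

(** * Primary parts of the coefficients *)

Definition gcdS (I : finType) (lam : I -> int) (P : {set I}) : nat :=
  \big[gcdn/0%N]_(i in P) `|lam i|%N.

(* The part of the gcd of the coefficients other than [lam i] that is supported on the
   primes of l. *)
Definition gam (I : finType) (lam : I -> int) (P : {set I}) (l : nat) (i : I) : nat :=
  ((gcdS lam (P :\ i))`_\pi(l))%N.

Lemma dvdn_gcdS (I : finType) (lam : I -> int) (P : {set I}) m :
  reflect (forall i, i \in P -> (m %| `|lam i|)%N) (m %| gcdS lam P)%N.
Proof. exact: dvdn_biggcdP. Qed.

Lemma gcdS_dvd (I : finType) (lam : I -> int) (P : {set I}) i :
  i \in P -> (gcdS lam P %| `|lam i|)%N.
Proof. by move=> iP; apply/(dvdn_gcdS lam P). Qed.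

Lemma gcdS_gt0 (I : finType) (lam : I -> int) (P : {set I}) i :
  i \in P -> lam i != 0 -> (0 < gcdS lam P)%N.
Proof.
move=> iP nz; have := gcdS_dvd lam iP; rewrite lt0n; apply: contraL => /eqP ->.
by rewrite dvd0n absz_eq0.
Qed.

Lemma prime_dvd_part p n l : prime p -> (0 < n)%N -> (0 < l)%N ->
  (p %| n`_\pi(l))%N = (p %| n)%N && (p %| l)%N.
Proof.
move=> pp n0 l0; apply/idP/andP => [h|[pn pl]].
  split; first by apply: dvdn_trans h (dvdn_part _ _).
  have := part_pnat \pi(l) n => /pnatP h'.
  by have := h' (part_gt0 _ _) _ pp h; rewrite mem_primes => /and3P[].
have e := partnC \pi(l) n0; move: pn; rewrite -{1}e Euclid_dvdM // => /orP[//|h].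
have := part_pnat (\pi(l)^') n => /pnatP h'.
by have := h' (part_gt0 _ _) _ pp h; rewrite !inE /= mem_primes pp l0 pl.
Qed.

Lemma solve_cg (m : nat) (l x : int) : coprime m `|l| ->
  exists y : int, cg m (l * y) x.
Proof.
move=> c; have [u [v e]] := Bezoutz l m%:Z.
have g1 : gcdz l m = 1 by rewrite /gcdz absz_nat gcdnC (eqP c).
exists (u * x); rewrite /cg; apply/dvdzP; exists (- (v * x)).
have -> : l * (u * x) = (u * l) * x by ring.
have -> : u * l = 1 - v * m by rewrite -g1 -e addrK.
ring.
Qed.

Lemma chinese_int (m n : nat) (x y : int) : coprime m n ->
  exists z, cg m z x /\ cg n z y.
Proof.
move=> c; have cn : coprime n `|m%:Z| by rewrite absz_nat coprime_sym.
have [u hu] := solve_cg (y - x) cn.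
exists (x + m%:Z * u); split; first exact: cg_addM.
by rewrite -[y](subrKC x) cgDl.
Qed.

Section Gam.
Context (I : finType) (lam : I -> int) (P : {set I}) (l : nat).
Context (l0 : (0 < l)%N) (nz : forall i, i \in P -> lam i != 0) (P2 : (1 < #|P|)%N).
Context (cop : forall p, prime p -> (p %| l)%N -> exists2 i, i \in P & ~~ (p %| `|lam i|)%N).
Local Notation gm := (gam lam P l).

Lemma rest_ex i : exists j, j \in P :\ i.
Proof using P2.
apply/set0Pn; rewrite -card_gt0; move: P2; rewrite (cardsD1 i P).
by case: (i \in P); rewrite ?add1n ?add0n ?ltnS // => /ltnW.
Qed.

Lemma gcd_rest_gt0 i : (0 < gcdS lam (P :\ i))%N.
Proof using nz P2.
have [j jP] := rest_ex i; apply: (gcdS_gt0 jP); apply: nz.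
by move: jP; rewrite !inE => /andP[].
Qed.

Lemma gam_gt0 i : (0 < gm i)%N. Proof. exact: part_gt0. Qed.

Lemma gam_prime i p : prime p ->
  reflect ((p %| l)%N /\ forall j, j \in P -> j != i -> (p %| `|lam j|)%N) (p %| gm i)%N.
Proof.
move=> pp; rewrite /gam prime_dvd_part ?gcd_rest_gt0 // andbC.
apply: (iffP andP) => -[pl h]; split => //.
  by move=> j jP ji; apply: (dvdn_gcdS _ _ _ h); rewrite !inE ji.
by apply/dvdn_gcdS => j; rewrite !inE => /andP[ji jP]; apply: h.
Qed.

Lemma gam_dvd i j : j \in P -> j != i -> (gm i %| `|lam j|)%N.
Proof.
move=> jP ji; apply: dvdn_trans (dvdn_part _ _) _.
by apply: gcdS_dvd; rewrite !inE ji.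
Qed.

Lemma coprime_primeP m n : (forall p, prime p -> (p %| m)%N -> (p %| n)%N -> False) ->
  (0 < m)%N -> coprime m n.
Proof.
move=> h m0; rewrite /coprime eqn_leq gcdn_gt0 m0 /= andbT leqNgt; apply/negP => g1.
apply: (h _ (pdiv_prime g1)); apply: dvdn_trans (pdiv_dvd _) _.
  exact: dvdn_gcdl.
exact: dvdn_gcdr.
Qed.

(** A common prime factor would divide every coefficient in [P], against [cop]. *)
Lemma coprime_gam_lam i : i \in P -> coprime (gm i) `|lam i|.
Proof.
move=> iP; apply: coprime_primeP (gam_gt0 i) => p pp /(gam_prime _ pp)[pl h] pi.
have [j jP /negP] := cop pp pl; apply.
by have [->|ji] := eqVneq j i; [|apply: h].
Qed.

Lemma coprime_gam i j : i \in P -> j \in P -> i != j -> coprime (gm i) (gm j).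
Proof.
move=> iP jP ij; apply: coprime_dvdr (coprime_gam_lam iP).
exact: gam_dvd.
Qed.

Definition Gam : nat := \prod_(i in P) gm i.

Lemma Gam_gt0 : (0 < Gam)%N.
Proof. by apply: prodn_gt0 => i; apply: gam_gt0. Qed.

Lemma gam_Gam i : i \in P -> (gm i %| Gam)%N.
Proof. by move=> iP; rewrite /Gam (bigD1 i) //= dvdn_mulr. Qed.

Lemma Gam_prime p : prime p -> (p %| Gam)%N -> exists2 i, i \in P & (p %| gm i)%N.
Proof.
move=> pp; rewrite /Gam; elim/big_ind: _ => //.
- by rewrite dvdn1 => /eqP p1; rewrite p1 in pp.
- by move=> m n hm hn; rewrite Euclid_dvdM // => /orP[/hm|/hn].
- by move=> i iP h; exists i.
Qed.

Lemma gam2_Gam i j : i \in P -> j \in P -> i != j -> (gm i * gm j %| Gam)%N.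
Proof.
move=> iP jP ij; rewrite Gauss_dvd ?coprime_gam // !gam_Gam //.
Qed.

(* The period h of W divides [l * Gam]; comparing, for each prime, the shifts
   [lam i * (a' - a)] with [a] and [a'] congruent modulo [gm i] shows that h divides
   [Gam], and the moves reach every class modulo [Gam]. *)
Lemma closed_all (A : {fset int}) (W : int -> Prop) x0 :
  (forall x, exists2 a, a \in A & cg (Gam ^ 2) a x) ->
  (forall p, prime p -> (p %| l)%N ->
     exists2 a, a \in A & exists2 a', a' \in A & ~~ cg p a a') ->
  (forall x z, W x -> W (x + (l * Gam)%N%:Z * z)) ->
  (forall i a a' x, i \in P -> a \in A -> a' \in A -> cg (gm i) x (lam i * a) ->
     W x -> W (x + lam i * (a' - a))) ->
  W x0 -> forall x, W x.
Proof.
move=> fullA redA perW clW W0.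
have R0 : (0 < l * Gam)%N by rewrite muln_gt0 l0 Gam_gt0.
have Gam_sq i : i \in P -> (gm i %| Gam ^ 2)%N.
  by move=> iP; rewrite expnS dvdn_mulr // gam_Gam.
have solve i x : i \in P -> exists2 a, a \in A & cg (gm i) (lam i * a) x.
  move=> iP; have [y hy] := solve_cg x (coprime_gam_lam iP).
  have [a aA ha] := fullA y; exists a => //.
  by apply: cg_trans hy; apply/cgM/(cg_dvd _ ha)/Gam_sq.
have [h h0 hh] := shift_group R0 perW.
have hR : (h %| l * Gam)%N.
  have /hh : forall x, W x -> W (x + (l * Gam)%N%:Z).
    by move=> x Wx; rewrite -[X in _ + X]mulr1; apply: perW.
  by rewrite dvdzE.
(* A move is allowed only from the class of [lam i * a]. Going there first with some [b], then
   moving, then undoing the first move shifts an arbitrary [x]. *)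
have hd i a a' : i \in P -> a \in A -> a' \in A -> cg (gm i) a a' ->
    (h%:Z %| lam i * (a' - a))%Z.
  move=> iP aA a'A aa'; apply/hh => x Wx.
  have [b bA hb] := solve i x iP; rewrite cg_sym in hb.
  have W1 := clW _ _ _ _ iP bA aA hb Wx.
  have c1 : cg (gm i) (x + lam i * (a - b)) (lam i * a).
    by rewrite (_ : lam i * a = lam i * b + lam i * (a - b)) ?cgDr //; ring.
  have W2 := clW _ _ _ _ iP aA a'A c1 W1.
  have c2 : cg (gm i) (x + lam i * (a - b) + lam i * (a' - a)) (lam i * a).
    apply: (@cg_trans _ (x + lam i * (a - b) + lam i * 0)); last by rewrite mulr0 addr0.
    by rewrite cgDl; apply: cgM; rewrite /cg subr0 -[a' - a]opprB rpredN; apply: aa'.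
  have := clW _ _ _ _ iP aA bA c2 W2.
  by congr W; ring.
have hG : (h %| Gam)%N.
  apply/dvdn_partP => // p; rewrite mem_primes => /and3P[pp _ ph].
  have cpe n : ~~ (p %| n)%N -> coprime (h`_p)%N n.
    move=> pn; rewrite p_part coprimeXl // prime_coprime //.
  have phd : (h`_p %| h)%N := dvdn_part _ _.
  case: (pselect (exists2 i, i \in P & (p %| gm i)%N)) => [[i iP pg]|no].
    have [pl hj] := gam_prime i pp pg.
    have npi : ~~ (p %| `|lam i|)%N.
      have [j jP nj] := cop pp pl; have [<- //|ji] := eqVneq j i.
      by rewrite hj in nj.
    (* Here [a' - a] is [gm i] times a number congruent to 1 modulo [p]. This needs fullness modulo
       a multiple of [gm i * p], which [Gam ^ 2] is. *)
    have [a aA ha] := fullA 0; have [a' a'A ha'] := fullA (gm i)%:Z.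
    have aa' : cg (Gam ^ 2) (a' - a) (gm i)%:Z.
      by have := cgD ha' (cgN ha); rewrite oppr0 addr0.
    have ci : cg (gm i) a a'.
      rewrite cg_sym -(cgDr _ (- a)) subrr.
      by apply: cg_trans (cg_dvd (Gam_sq i iP) aa') _; rewrite /cg subr0 dvdzz.
    have := hd _ _ _ iP aA a'A ci; rewrite dvdzE absz_nat abszM => d1.
    have d2 : (h`_p %| `|a' - a|)%N.
      by have := dvdn_trans phd d1; rewrite Gauss_dvdr // cpe.
    have /dvdzP[q hq] := aa'.
    have [r hr] : exists r : nat, (Gam ^ 2 = gm i * (p * r))%N.
      have /dvdnP[u hu] := gam_Gam iP.
      have /dvdnP[v hv] : (p %| Gam)%N by apply: dvdn_trans pg (gam_Gam iP).
      by exists (u * v)%N; rewrite expnS expn1 {1}hu hv; lia.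
    have e : a' - a = (gm i)%:Z * (1 + p%:Z * (r%:Z * q)).
      have -> : a' - a = q * (Gam ^ 2)%N + (gm i)%:Z by rewrite -hq subrK.
      by rewrite hr !PoszM; ring.
    move: d2; rewrite e abszM absz_nat Gauss_dvdl.
      by move=> d2; apply: dvdn_trans d2 (gam_Gam iP).
    apply: cpe; apply: contraTN isT => pd.
    have /negP[] : ~~ (p%:Z %| 1)%Z by rewrite dvdzE absz_nat dvdn1 neq_ltn prime_gt1 ?orbT.
    have := rpredB (_ : 1 + p%:Z * (r%:Z * q) \in dvdz p) (_ : p%:Z * (r%:Z * q) \in dvdz p).
    rewrite addrK; apply; last exact: dvdz_mulr.
    by rewrite dvdzE absz_nat.
  (* Such a [p] cannot divide [h]: an element [c] congruent to [a] modulo [gm i] and to [a'] modulo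
     [gm j] would make [a] and [a'] congruent modulo [p]. *)
  have pl : (p %| l)%N.
    have := dvdn_trans ph hR; rewrite Euclid_dvdM // => /orP[//|/(Gam_prime pp)[i iP pg]].
    by case: no; exists i.
  have [i iP ni] := cop pp pl.
  have [j jP /andP[ji nj]] : exists2 j, j \in P & (j != i) && ~~ (p %| `|lam j|)%N.
    apply: contrapT => no'; apply: no; exists i => //; apply/gam_prime => //; split => // j jP ji.
    by apply: contrapT => /negP nj; apply: no'; exists j => //; rewrite ji.
  have [a aA [a' a'A ne]] := redA _ pp pl.
  have ij : i != j by rewrite eq_sym.
  have [z [z1 z2]] := chinese_int a a' (coprime_gam iP jP ij).
  have [c cA hc] := fullA z.
  have h2 : (gm i * gm j %| Gam ^ 2)%N by rewrite expnS dvdn_mulr // gam2_Gam.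
  have hpc k b : k \in P -> ~~ (p %| `|lam k|)%N -> b \in A -> cg (gm k) b c -> cg p c b.
    move=> kP nk bA hb; have := hd _ _ _ kP bA cA hb; rewrite dvdzE absz_nat => d1.
    by have := dvdn_trans ph d1; rewrite abszM Gauss_dvdr ?prime_coprime //.
  case/negP: ne; apply: (@cg_trans _ c).
    rewrite cg_sym; apply: (hpc i) => //; rewrite cg_sym.
    by apply: cg_trans z1; apply: cg_dvd hc; apply: dvdn_trans h2; apply: dvdn_mulr.
  apply: (hpc j) => //; rewrite cg_sym.
  by apply: cg_trans z2; apply: cg_dvd hc; apply: dvdn_trans h2; apply: dvdn_mull.
move=> t.
(* The slots are adjusted one after another; a move in slot [i] does not disturb the class modulo
   [gm j], which divides [lam i]. *)
have key (r : seq I) : uniq r -> {subset r <= P} ->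
    exists2 x, W x & cg (\prod_(i <- r) gm i)%N x t /\ forall i, i \in r -> cg (gm i) x t.
  elim: r => [|i r IH] /=.
    by move=> _ _; exists x0; rewrite // big_nil; split=> //; rewrite /cg dvd1z.
  move=> /andP[ir ur] sub.
  have iP : i \in P by apply: sub; rewrite mem_head.
  have subr : {subset r <= P} by move=> j jr; apply: sub; rewrite inE jr orbT.
  have [x Wx [_ hx]] := IH ur subr.
  have [b bA hb] := solve i x iP; have [a aA ha] := solve i t iP.
  rewrite cg_sym in hb.
  have E : cg (gm i) (x + lam i * (a - b)) t.
    apply: cg_trans ha.
    by rewrite (_ : lam i * a = lam i * b + lam i * (a - b)) ?cgDr //; ring.
  have all j : j \in i :: r -> cg (gm j) (x + lam i * (a - b)) t.
    rewrite inE => /orP[/eqP -> //|jr].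
    apply: cg_trans (hx _ jr); rewrite -[X in cg _ _ X]addr0 cgDl /cg subr0 dvdzE abszM.
    apply: dvdn_mulr; rewrite absz_nat; apply: gam_dvd => //.
    by apply: contraNneq ir => ->.
  exists (x + lam i * (a - b)); first exact: clW.
  split => //.
  have : uniq (i :: r) by rewrite /= ir.
  elim: (i :: r) all sub => [|k r' IH'] al sub' /=; first by rewrite big_nil /cg dvd1z.
  move=> /andP[kr ur']; rewrite big_cons; apply: cg_coprime.
  - rewrite big_seq; elim/big_ind: _; rewrite ?coprimen1 //.
      by move=> u v hu hv; rewrite coprimeMr hu hv.
    move=> j jr; apply: coprime_gam; rewrite ?sub' ?mem_head // ?inE ?jr ?orbT //.
    by apply: contraNneq kr => ->.
  - by apply: al; rewrite mem_head.
  - by apply: IH' => // j jr; [apply: al | apply: sub']; rewrite inE jr orbT.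
have sub : {subset enum P <= P} by move=> i; rewrite mem_enum.
have [x Wx [hx _]] := key (enum P) (enum_uniq _) sub.
have : (h%:Z %| t - x)%Z.
  apply: (@dvdz_trans Gam%:Z); first by rewrite dvdzE.
  by move: hx; rewrite big_enum cg_sym.
by move=> /hh /(_ _ Wx); rewrite subrKC.
Qed.

End Gam.

(** * Counting full classes *)

(* [gd X = 0] when X has at most one element. *)
Definition gd (X : {fset int}) : nat :=
  \big[gcdn/0%N]_(u : X * X) `|val u.1 - val u.2|%N.

Lemma gdP m X : reflect (constm m X) (m %| gd X)%N.
Proof.
apply: (iffP (dvdn_biggcdP _ _ _)) => [h x y xX yX|h u _].
  by rewrite /cg dvdzE absz_nat (h ([` xX], [` yX])).
by have := h _ _ (valP u.1) (valP u.2); rewrite /cg dvdzE absz_nat.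
Qed.

Lemma constm_gd X : constm (gd X) X.
Proof. exact/gdP. Qed.

Lemma gd_gt0 X x y : x \in X -> y \in X -> x != y -> (0 < gd X)%N.
Proof.
move=> xX yX ne; rewrite lt0n; apply: contra ne => /eqP E.
have := constm_gd xX yX; rewrite E /cg dvd0z subr_eq0; exact.
Qed.

Lemma pigeon X m l : (0 < l)%N -> constm m X ->
  exists X', [/\ X' `<=` X, constm (m * l) X' & (#|` X| <= l * #|` X'|)%N].
Proof.
move=> l0 cX; have [m0|m0] := posnP m.
  (* Congruence modulo 0 is equality, and [X] is its own class. *)
  by exists X; split=> //; [rewrite m0 mul0n -m0 | rewrite leq_pmull].
have [->|[x0 x0X]] := fset_0Vmem X.
  by exists fset0; rewrite cardfs0 muln0; split => // x y; rewrite inE.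
pose N (j : 'I_l) := cls (m * l) (x0 + m%:Z * (j : nat)%:Z) X.
have cov x : x \in X -> exists2 j : 'I_l, j \in index_enum 'I_l & x \in N j.
  move=> xX; have /dvdzP[q hq] := cX _ _ xX x0X.
  have [i hi] := cg_ord q l0; exists i; first exact: mem_index_enum.
  rewrite in_cls xX /= (_ : x = x0 + m%:Z * q) ?cgDl; first exact: cgMl.
  by rewrite mulrC -hq subrKC.
have le := card_le_cover cov.
have [j _ hj] := @arg_maxnP 'I_l (Ordinal l0) predT (fun j => #|` N j|) isT.
exists (N j); split; [exact: cls_sub | exact: constm_cls |].
apply: leq_trans le _.
apply: (@leq_trans (\sum_(i < l) #|` N j|)%N); first by apply: leq_sum => i _; apply: hj.
by rewrite sum_nat_const card_ord.
Qed.

(** Each refinement is relative to [gd (Y s)], the exact gcd of the differences, so when this is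
    positive [Y s] is not constant modulo it times a further prime. *)
Lemma nested_classes l Y0 : (0 < l)%N -> exists Y : nat -> {fset int},
  [/\ Y 0%N = Y0, forall s, Y s.+1 `<=` Y s,
      forall s, constm (gd (Y s) * l) (Y s.+1) &
      forall s, (#|` Y0| <= l ^ s * #|` Y s|)%N].
Proof.
move=> l0.
have /choice[f hf] X := pigeon l0 (@constm_gd X).
exists (fun s => iter s f Y0); split => //.
- by move=> s /=; case: (hf (iter s f Y0)).
- by move=> s /=; case: (hf (iter s f Y0)).
- elim=> [|s IH] /=; first by rewrite expn0 mul1n.
  apply: leq_trans IH _; rewrite expnSr -mulnA leq_mul2l.
  by case: (hf (iter s f Y0)) => _ _ ->; rewrite orbT.
Qed.

(** Slots form a subset of a fixed type, so that dropping one is [P :\ i] and [lam] is never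
    reindexed. *)
Definition SL (I : finType) (lam : I -> int) (P : {set I}) (A : {fset int}) : {fset int} :=
  \big[addS/[fset 0]]_(i in P) dil (lam i) A.

Lemma SLS (I : finType) (lam : I -> int) (P : {set I}) A B :
  A `<=` B -> SL lam P A `<=` SL lam P B.
Proof. by move=> h; rewrite /SL; apply: big_addS_sub => i _; apply: dilS. Qed.

Lemma SL_D1 (I : finType) (lam : I -> int) (P : {set I}) i A : i \in P ->
  SL lam P A = addS (dil (lam i) A) (SL lam (P :\ i) A).
Proof.
move=> iP; rewrite /SL (bigD1 i) //=; congr addS.
by apply: eq_bigl => j; rewrite !inE andbC.
Qed.

Lemma mem_SL (I : finType) (lam : I -> int) (P : {set I}) A (a : I -> int) :
  (forall i, i \in P -> a i \in A) -> \sum_(i in P) lam i * a i \in SL lam P A.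
Proof. by move=> h; rewrite /SL; apply: mem_big => i iP; apply/mem_dil/h. Qed.

Lemma SL_dec (I : finType) (lam : I -> int) (P : {set I}) A x : x \in SL lam P A ->
  exists2 a : I -> int, forall i, i \in P -> a i \in A & x = \sum_(i in P) lam i * a i.
Proof.
move=> /(big_dec (index_enum_uniq I)) [c hc ->].
have /choice[a ha] i : exists y, i \in P -> y \in A /\ c i = lam i * y.
  case: (boolP (i \in P)) => iP; last by exists 0.
  by have /in_dil[y yA e] := hc i (mem_index_enum _) iP; exists y.
exists a; first by move=> i /ha[].
by apply: eq_bigr => i /ha[].
Qed.

Lemma SL_ne (I : finType) (lam : I -> int) (P : {set I}) A a :
  a \in A -> exists x, x \in SL lam P A.
Proof.
by move=> aA; exists (\sum_(i in P) lam i * (fun=> a) i); apply: mem_SL.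
Qed.

Section Count.
Context (I : finType) (lam : I -> int) (P : {set I}) (l : int).
Context (l0 : l != 0) (nz : forall i, i \in P -> lam i != 0) (P2 : (1 < #|P|)%N).
Context (cop : forall p, prime p -> (p %| `|l|)%N -> exists2 i, i \in P & ~~ (p %| `|lam i|)%N).
Context (A B : {fset int}) (BA : B `<=` A).
Local Notation ell := (`|l|%N).
Local Notation gm := (gam lam P ell).
Local Notation T := (SL lam P A).
Local Notation T1 i := (SL lam (P :\ i) A).

Lemma ell0 : (0 < ell)%N. Proof. by rewrite lt0n absz_eq0. Qed.

(** By [reps_big], [T] meets at least |D| classes modulo [m], and each of them carries a translate
    of [l * cls m c B]. *)
Lemma count_T m D c : (0 < m)%N -> (forall p, prime p -> (p %| m)%N -> (p %| ell)%N) ->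
  D `<=` A -> inj_mod m D ->
  (#|` D| * #|` cls m c B| <= #|` addS T (dil l B)|)%N.
Proof.
move=> m0 pm DA iD.
have [b0|[b bB]] := fset_0Vmem (cls m c B); first by rewrite b0 cardfs0 muln0.
have [|||R [RT iR leR]] := @reps_big _ lam (enum P) m D m0.
- by move=> j; rewrite mem_enum; apply: nz.
- by move=> p pp /(pm _ pp) pl; have [i iP h] := cop pp pl; exists i; rewrite ?mem_enum.
- exact: iD.
have {}RT : R `<=` T.
  by apply: fsubset_trans RT _; rewrite big_enum; apply: SLS.
apply: (@leq_trans (#|` R| * #|` cls m c B|)%N); first by rewrite leq_mul2r leR orbT.
have := @sum_card_le _ R m (addS T (dil l B))
  (fun z => [fset z + y | y in dil l (cls m c B)]) (fun z => z + l * b) (fset_uniq _).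
rewrite (eq_bigr (fun=> #|` cls m c B|)); last first.
  by move=> z _; rewrite card_transl card_dil.
rewrite big_const_seq count_predT iter_addn_0 mulnC; apply.
- move=> z zR; apply/fsubsetP => _ /imfsetP[y /= yB ->]; apply: mem_addS.
    exact: (fsubsetP RT).
  exact: (fsubsetP (dilS l (cls_sub m c B))).
- move=> z _ zR /imfsetP[_ /= /in_dil[y yB ->] ->]; rewrite cgDl; apply: cgM.
  exact: (constm_cls yB bB).
- by move=> z z' zR z'R; rewrite cgDr; apply: iR.
Qed.

Lemma part_prime m p n : prime p -> (p %| n`_\pi(m))%N -> (p %| m)%N.
Proof.
move=> pp h; have := part_pnat \pi(m) n => /pnatP h'.
by have := h' (part_gt0 _ _) _ pp h; rewrite mem_primes => /and3P[].
Qed.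

(* D1 collects the classes of B modulo [Pm / gm i] of size comparable to the largest
   one; all but few of the sums of elements of D1 lie in full classes of [T1 i], because
   a nonfull one would carry many elements. *)
Lemma count_T1 i (Pm K E M : nat) (Zi : {fset int}) :
  let s := (2 * E * K)%N in let e := (2 * E * s)%N in
  let b := #|` B| in
  i \in P -> (0 < Pm)%N -> (gm i %| Pm)%N ->
  (forall p, prime p -> (p %| Pm)%N -> (p %| ell)%N) ->
  (0 < K)%N -> (0 < E)%N ->
  (#|` addS T (dil l B)| <= K * b)%N ->
  (#|` [fset x in T1 i | ~~ full Pm ell (T1 i) x]| * e <= b)%N ->
  (forall x, x \in T1 i -> full Pm ell (T1 i) x -> exists2 z, z \in Zi & cg Pm x z) ->
  (forall c, #|` cls Pm c B| <= M)%N ->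
  (E.-1 * b <= E * (gm i * #|` Zi| * M))%N.
Proof.
move=> s e b iP Pm0 gP pP K0 E0 leK lebad cZ leM.
set bad := [fset x in T1 i | ~~ full Pm ell (T1 i) x].
have [g h gE] : exists2 m, (0 < m)%N & Pm = (gm i * m)%N.
  have /dvdnP[m hm] := gP; exists m; last by rewrite mulnC.
  by move: Pm0; rewrite hm muln_gt0 => /andP[].
set m := g in h gE.
have g0 : (0 < gm i)%N := gam_gt0 _ _ _ _.
have pm p : prime p -> (p %| m)%N -> (p %| ell)%N.
  by move=> pp pm; apply: pP => //; rewrite gE dvdn_mull.
have [B0|[b0 b0B]] := fset_0Vmem B; first by rewrite /b B0 cardfs0 muln0.
have [D0 [D0B iD0 cD0]] := reps_exist m B.
have [b1 b1D _] := cD0 _ b0B.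
have [bm bmD hbm] := fset_argmax (fun z => #|` cls m z B|) b1D.
set Mi := #|` cls m bm B|.
have leKb : (#|` D0| * Mi <= K * b)%N.
  apply: leq_trans leK; apply: count_T => //; exact: fsubset_trans D0B BA.
(* The classes outside [D1] hold at most b / (2 E) elements of [B] in all, and the nonfull points
   will cost another b / (2 E); this fixes [s] and [e]. *)
pose D1 := [fset z in D0 | (Mi <= s * #|` cls m z B|)%N].
have D1D : D1 `<=` D0 by apply: fset_sub.
have h1 : (s * b <= s * #|` D1| * Mi + K * b)%N.
  apply: (@leq_trans (s * \sum_(z <- D0) #|` cls m z B|)%N).
    rewrite leq_mul2l; apply/orP; right; apply: card_le_cover => x xB.
    by have [z zD hz] := cD0 _ xB; exists z; rewrite // in_cls xB.
  rewrite (bigID (fun z => (Mi <= s * #|` cls m z B|)%N)) /= mulnDr leq_add //.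
    rewrite -mulnA leq_mul2l; apply/orP; right.
    rewrite card_fset_sum1 big_distrl /= big_seq_cond.
    apply: (@leq_trans (\sum_(z <- D0 | (z \in D0) && (Mi <= s * #|` cls m z B|)%N) Mi)%N).
      by apply: leq_sum => z /andP[zD _]; apply: hbm.
    rewrite -big_seq_cond -big_filter; apply: eq_leq; rewrite [RHS](eq_bigr (fun=> Mi)); last first.
      by move=> z _; rewrite mul1n.
    apply: perm_big; apply: uniq_perm; rewrite ?filter_uniq ?fset_uniq // => x.
    by rewrite mem_filter !inE andbC.
  apply: leq_trans leKb; rewrite big_distrr /= card_fset_sum1 big_distrl /=.
  rewrite big_mkcond; apply: leq_sum => z _; rewrite mul1n /=.
  by case: (leqP Mi (s * #|` cls m z B|)%N) => h1 //=; exact: ltnW.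
pose nu j := (lam j %/ gm i)%Z.
have nuE j : j \in P -> j != i -> lam j = (gm i)%:Z * nu j.
  move=> jP ji; rewrite mulrC /nu divzK // dvdzE absz_nat.
  exact: gam_dvd.
have inP j : (j \in P :\ i) = (j != i) && (j \in P) by rewrite !inE.
have [|||R1 [R1s iR1 leR1]] := @reps_big _ nu (enum (P :\ i)) m D1 h.
- move=> j; rewrite mem_enum inP => /andP[ji jP].
  by apply: contraNneq (nz jP) => nu0; rewrite nuE // nu0 mulr0.
(* If [p] divided every [nu j], then [gm i * p] would divide the gcd of the remaining coefficients,
   whose whole part on the primes of [l] is [gm i]. *)
- move=> p pp ppm; apply: contrapT => no.
  have : (gm i * p %| gcdS lam (P :\ i))%N.
    apply/dvdn_gcdS => j jP; have := jP; rewrite inP => /andP[ji jP'].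
    rewrite nuE // abszM absz_nat dvdn_pmul2l //.
    by apply: contrapT => /negP np; apply: no; exists j; rewrite ?mem_enum.
  have gg := gcd_rest_gt0 nz P2 i.
  rewrite -(partnC \pi(ell) gg) -/(gm i) dvdn_pmul2l // => pc.
  have := part_pnat (\pi(ell)^') (gcdS lam (P :\ i)) => /pnatP h'.
  have := h' (part_gt0 _ _) _ pp pc.
  by rewrite !inE /= mem_primes pp ell0 (pm _ pp ppm).
- by move=> x y xD yD; apply: iD0; apply: (fsubsetP D1D).
have dilR1 : dil (gm i)%:Z R1 `<=` SL lam (P :\ i) D1.
  apply/fsubsetP => _ /in_dil[x xR ->].
  have := fsubsetP R1s _ xR; rewrite big_enum => /SL_dec[a ha ->].
  have -> : (gm i)%:Z * (\sum_(j in P :\ i) nu j * a j) = \sum_(j in P :\ i) lam j * a j.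
    rewrite mulr_sumr; apply: eq_bigr => j; rewrite inP => /andP[ji jP].
    by rewrite mulrA -nuE.
  exact: mem_SL.
set U := dil (gm i)%:Z R1 in dilR1.
have cU : #|` U| = #|` R1| by apply: card_dil; rewrite eqz_nat -lt0n.
have iU : inj_mod Pm U.
  move=> _ _ /in_dil[x xR ->] /in_dil[y yR ->]; rewrite gE cgMlE // => hxy.
  by congr (_ * _); apply: iR1.
have D1A : D1 `<=` A by apply: fsubset_trans D1D (fsubset_trans D0B BA).
have UT : U `<=` T1 i by apply: fsubset_trans dilR1 (SLS _ _ D1A).
(* Vary one slot [j0] within its class modulo [m]: as [gm i] divides [lam j0], the sum stays in the
   class of [u] modulo [Pm = gm i * m]. *)
have node u : u \in U -> (Mi <= s * #|` cls Pm u (T1 i)|)%N.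
  move=> uU; have [a ha hu] := SL_dec (fsubsetP dilR1 _ uU).
  have [j0 j0P] := rest_ex P2 i; have := j0P; rewrite inP => /andP[j0i j0P'].
  have := ha _ j0P; rewrite !inE => /andP[_ /leq_trans]; apply.
  rewrite leq_mul2l; apply/orP; right.
  rewrite -(card_dil _ (nz j0P')) -(card_transl (\sum_(j in P :\ i | j != j0) lam j * a j)).
  apply: fsubset_leq_card; apply/fsubsetP => _ /imfsetP[_ /= /in_dil[y yB ->] ->].
  move: yB; rewrite in_cls => /andP[yB hy].
  have hs : u = \sum_(j in P :\ i | j != j0) lam j * a j + lam j0 * a j0.
    by rewrite hu (bigD1 j0) //= addrC.
  rewrite in_cls hs cgDl; apply/andP; split; last first.
    rewrite nuE // -!mulrA gE cgMlE //; exact: cgM.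
  rewrite (SL_D1 _ _ j0P) addrC; apply: mem_addS.
    by apply: mem_dil; apply: (fsubsetP BA).
  rewrite (eq_bigl (fun j => j \in (P :\ i) :\ j0)); last by move=> j; rewrite !inE andbC.
  by apply: mem_SL => j; rewrite in_setD1 => /andP[_ jP]; apply: (fsubsetP D1A); apply: ha.
have le1 : (#|` D1| * Mi <= #|` Zi| * Mi + s * #|` bad|)%N.
  apply: (@leq_trans (#|` U| * Mi)%N); first by rewrite leq_mul2r cU leR1 orbT.
  rewrite -(cardfsID [fset x in T1 i | full Pm ell (T1 i) x] U) mulnDl leq_add //.
    rewrite leq_mul2r; apply/orP; right.
    apply: (@card_inj_mod Pm) => [x y|x].
      by rewrite !in_fsetI => /andP[xU _] /andP[yU _]; apply: iU.
    by rewrite !inE => /and3P[_ xT hf]; apply: cZ.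
  set Ub := _ `\` _.
  apply: (@leq_trans (\sum_(u <- Ub) s * #|` cls Pm u (T1 i)|)%N).
    rewrite card_fset_sum1 big_distrl /= big_seq [X in (_ <= X)%N]big_seq.
    by apply: leq_sum => u; rewrite mul1n !inE => /andP[_ uU]; apply: node.
  rewrite -big_distrr leq_mul2l /=; apply/orP; right.
  apply: (@sum_card_le _ _ Pm _ _ id).
  - exact: fset_uniq.
  - move=> u; rewrite !inE => /andP[nf uU]; apply/fsubsetP => x; rewrite in_cls => /andP[xT hx].
    rewrite !inE xT /=; apply: contra nf => hf; rewrite (fsubsetP UT) //=.
    exact: full_cg ell0 hx hf.
  - by move=> u x _; rewrite in_cls => /andP[].
  - by move=> u v; rewrite !inE => /andP[_ uU] /andP[_ vU]; apply: iU.
(* A class modulo [m] splits into [gm i] classes modulo [Pm]. *)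
have leMi : (Mi <= gm i * M)%N.
  have [X' [X'B cX' leX']] := pigeon g0 (constm_cls (m := m) (c := bm) (X := B)).
  apply: leq_trans leX' _; rewrite leq_mul2l; apply/orP; right.
  have [->|[x xX']] := fset_0Vmem X'; first by rewrite cardfs0.
  apply: leq_trans (leM x); apply: fsubset_leq_card; apply/fsubsetP => y yX'.
  rewrite in_cls (fsubsetP (cls_sub _ _ _) _ (fsubsetP X'B _ yX')) /=.
  by rewrite gE mulnC; apply: cX'.
have s0 : (0 < s)%N by rewrite /s !muln_gt0 K0 E0.
have fin : (E.-1 * b <= E * (#|` Zi| * Mi))%N.
  have e1 : (s * b <= s * (#|` Zi| * Mi + s * #|` bad|) + K * b)%N.
    apply: leq_trans h1 _; rewrite leq_add2r -mulnA leq_mul2l le1 orbT //.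
  have e2 : (s * (2 * E * s * #|` bad|) <= s * b)%N.
    by rewrite leq_mul2l mulnC lebad orbT.
  have e3 : (2 * E * (K * b) = s * b)%N by rewrite /s; lia.
  have e4 : (2 * E * (s * b) <= 2 * E * (s * (#|` Zi| * Mi + s * #|` bad|) + K * b))%N.
    by rewrite leq_mul2l e1 orbT.
  have e5 : (s * (2 * E * b) <= s * (2 * (E * (#|` Zi| * Mi)) + 2 * b))%N.
    move: e2 e3 e4; set z := (#|` Zi| * Mi)%N; set bd := #|` bad|.
    move=> e2 e3 e4.
    have q1 : (2 * E * (s * (z + s * bd) + K * b) =
      s * (2 * (E * z)) + s * (2 * E * s * bd) + 2 * E * (K * b))%N by ring.
    have q2 : (2 * E * (s * b) = s * (2 * E * b))%N by ring.
    by rewrite -q2; apply: leq_trans e4 _; rewrite q1 e3 mulnDr -addnA leq_add2l; lia.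
  move: e5; rewrite leq_mul2l eqn0Ngt s0 /=.
  by case: (E) E0 => // E' _ /=; nia.
apply: leq_trans fin _; rewrite leq_mul2l; apply/orP; right.
by rewrite [(gm i * _)%N]mulnC -mulnA leq_mul2l leMi orbT.
Qed.
End Count.

Lemma card_arith (P L : nat) (z : int) : (0 < P)%N ->
  #|` [fset z + P%:Z * (nat_of_ord j)%:Z | j in 'I_L]| = L.
Proof.
move=> P0; rewrite card_imfset /=; first exact: size_enum_ord.
move=> i j /addrI h; apply/val_inj; have : (P%:Z != 0) by rewrite eqz_nat -lt0n.
by move=> /mulfI /(_ _ _ h) [].
Qed.

Lemma card_full_node (P L : nat) (X R : {fset int}) (z : int) :
  (0 < P)%N -> (0 < L)%N -> full P L X z ->
  (forall x, x \in X -> exists2 r, r \in R & cg (P * L) x r) ->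
  (L <= #|` cls P z R|)%N.
Proof.
move=> P0 L0 /(fullP _ _ _ L0) fz cR; rewrite -{1}(card_arith L z P0).
apply: (@card_inj_mod (P * L)).
  move=> _ _ /imfsetP[i /= _ ->] /imfsetP[j /= _ ->].
  by rewrite cgDl cgMlE // => /cg_ord_inj ->.
move=> _ /imfsetP[i /= _ ->].
have [x xX hx] := fz (i : nat)%:Z; have [r rR hr] := cR _ xX.
rewrite cg_sym in hx; exists r; last exact: cg_trans hx hr.
rewrite in_cls rR /=; apply: (@cg_trans _ (z + P%:Z * (i : nat)%:Z)); last exact: cg_addM.
by rewrite cg_sym; apply: cg_dvd (cg_trans hx hr); apply: dvdn_mulr.
Qed.

(** Converts a number of full classes into the number of classes modulo [P * L] that [card_add_dil]
    asks for. *)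
Lemma card_full_reps (P L : nat) (X R Z : {fset int}) :
  (0 < P)%N -> (0 < L)%N -> inj_mod P Z -> (forall z, z \in Z -> full P L X z) ->
  (forall x, x \in X -> exists2 r, r \in R & cg (P * L) x r) ->
  (L * #|` Z| <= #|` R|)%N.
Proof.
move=> P0 L0 iZ fZ cR.
apply: (@leq_trans (\sum_(z <- Z) #|` cls P z R|)%N).
  rewrite card_fset_sum1 big_distrr /= big_seq [X in (_ <= X)%N]big_seq.
  by apply: leq_sum => z zZ; rewrite muln1; apply: card_full_node (fZ _ zZ) cR.
apply: (@sum_card_le _ _ P _ _ id); rewrite ?fset_uniq //.
- by move=> z _; apply: cls_sub.
- by move=> z x _; rewrite in_cls => /andP[].
Qed.

(** [Q s] is the part of [gd (Y s)] on the primes of [l]. Starting inside one class modulo [R0]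
    makes [R0] divide it, and the size of [B] leaves two elements in [Y s] up to level [N], so that
    [gd (Y s)] is positive. *)
Lemma nested_moduli (l : int) (R0 N : nat) (B : {fset int}) :
  l != 0 -> (0 < R0)%N -> (forall p, prime p -> (p %| R0)%N -> (p %| `|l|)%N) ->
  (R0 * `|l| ^ N < #|` B|)%N ->
  exists (Q : nat -> nat) (Y : nat -> {fset int}),
  [/\ [/\ Y 0%N `<=` dil l B, forall s, Y s.+1 `<=` Y s,
      forall s, (0 < Q s)%N, forall s p, prime p -> (p %| Q s)%N -> (p %| `|l|)%N &
      forall s, constm (Q s) (Y s)],
      forall s, constm (Q s * `|l|) (Y s.+1),
      forall s, (#|` B| <= R0 * `|l| ^ s * #|` Y s|)%N &
      forall s, (s <= N)%N -> [/\ exists y, y \in Y s,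
        (R0 %| Q s)%N, (s < N)%N -> (Q s * `|l| %| Q s.+1)%N &
        forall p, prime p -> (p %| `|l|)%N ->
          exists2 y, y \in Y s & exists2 y', y' \in Y s & ~~ cg (Q s * p) y y']].
Proof.
move=> lnz R00 pR0 big; set L := `|l|%N in pR0 big *.
have L0 : (0 < L)%N by rewrite lt0n absz_eq0.
have c1 : constm 1 B by move=> x y _ _; rewrite /cg dvd1z.
have [A0 [A0B cA0 leA0]] := pigeon R00 c1; rewrite mul1n in cA0.
have [Y [Y0 sY cY leY]] := nested_classes (dil l A0) L0.
rewrite card_dil // in leY.
have le s : (#|` B| <= R0 * L ^ s * #|` Y s|)%N.
  by apply: leq_trans leA0 _; rewrite -mulnA leq_mul2l leY orbT.
have two s : (s <= N)%N -> exists y y', [/\ y \in Y s, y' \in Y s & y != y'].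
  move=> sN; have : (1 < #|` Y s|)%N.
    rewrite ltnNge; apply/negP => h; move: big; rewrite ltnNge => /negP; apply.
    apply: leq_trans (le s) _; rewrite -[X in (_ <= X)%N]muln1 leq_mul // leq_mul2l.
    by rewrite leq_pexp2l ?orbT.
  move=> h; have [E|[y yY]] := fset_0Vmem (Y s); first by rewrite E cardfs0 in h.
  have [E|[y' y'Y]] := fset_0Vmem (Y s `\ y).
    by move: h; rewrite (cardfsD1 y) yY E cardfs0.
  by exists y, y'; move: y'Y; rewrite !inE eq_sym => /andP[-> ->].
have gpos s : (s <= N)%N -> (0 < gd (Y s))%N.
  by move=> /two[y [y' [yY y'Y ne]]]; apply: gd_gt0 yY y'Y ne.
have sub0 s : Y s `<=` Y 0%N.
  by elim: s => // s IH; apply: fsubset_trans (sY s) IH.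
pose Q s := ((gd (Y s))`_\pi(L))%N.
exists Q, Y; split => //.
- split => //.
  + by rewrite Y0; apply: dilS.
  + by move=> s; apply: part_gt0.
  + by move=> s p pp; apply: part_prime.
  + by move=> s; apply/gdP/dvdn_part.
- move=> s; apply: constm_dvd (cY s); apply: dvdn_mul => //; exact: dvdn_part.
move=> s sN; have g0 := gpos s sN; split.
- by have [y [_ [yY _ _]]] := two s sN; exists y.
- have -> : R0 = (R0`_\pi(L))%N.
    rewrite part_pnat_id //; apply/pnatP => // p pp pR.
    by rewrite mem_primes pp L0 pR0.
  apply: partn_dvd => //; apply/gdP; apply: constm_sub (sub0 s) _.
  by rewrite Y0; apply: constm_dil.
- move=> sN'; have g1 := gpos s.+1 sN'.
  have -> : (Q s * L = (gd (Y s) * L)`_\pi(L))%N.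
    by rewrite partnM // [(L`_ _)%N]part_pnat_id // pnat_pi.
  by apply: partn_dvd => //; apply/gdP/cY.
- move=> p pp pL; apply: contrapT => no.
  have : constm (Q s * p) (Y s).
    move=> y y' yY y'Y; apply: contrapT => /negP h; apply: no; exists y => //.
    by exists y'.
  move=> /gdP; rewrite -(partnC \pi(L) g0) dvdn_pmul2l ?part_gt0 // => pc.
  have := part_pnat (\pi(L)^') (gd (Y s)) => /pnatP h'.
  by have := h' (part_gt0 _ _) _ pp pc; rewrite !inE /= mem_primes pp L0 pL.
Qed.

(** Averaging over the [W * H] levels: one failing slot per level would make the total too large,
    because [W] exceeds [#|P| * (e * K)]. *)
Lemma common_level (I : finType) (P : {set I}) (bad : I -> nat -> nat) (e H K W N b : nat) :
  W = (#|P| * (e * K) + 1)%N -> N = (W * H)%N -> (0 < H)%N -> (0 < b)%N ->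
  (forall i, i \in P -> (\sum_(t < N) bad i t <= H * (K * b))%N) ->
  exists2 t : 'I_N, true & forall i, i \in P -> (bad i t * e <= b)%N.
Proof.
move=> WE NE H0 b0 hb; apply: contrapT => no.
have hs (t : 'I_N) : (b <= \sum_(i in P) bad i t * e)%N.
  rewrite leqNgt; apply/negP => lt; apply: no; exists t => // i iP.
  by apply: leq_trans (ltnW lt); rewrite (bigD1 i) //= leq_addr.
have : (N * b <= \sum_(t < N) \sum_(i in P) bad i t * e)%N.
  by rewrite -{1}[N]card_ord -sum_nat_const; apply: leq_sum.
rewrite exchange_big /=.
have : (\sum_(i in P) \sum_(t < N) bad i t * e <= \sum_(i in P) H * (K * b) * e)%N.
  by apply: leq_sum => i iP; rewrite -big_distrl leq_mul2r hb ?orbT.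
rewrite sum_nat_const => h1 h2; have := leq_trans h2 h1.
rewrite NE WE leqNgt => /negP; apply.
set n := #|P|.
have -> : ((n * (e * K) + 1) * H * b = n * (H * (K * b) * e) + H * b)%N by ring.
by rewrite -[X in (X < _)%N]addn0 ltn_add2l muln_gt0 H0.
Qed.

Section Core.
Context (I : finType) (lam : I -> int) (P : {set I}) (l : int).
Context (l0 : l != 0) (nz : forall i, i \in P -> lam i != 0) (P2 : (1 < #|P|)%N).
Context (cop : forall p, prime p -> (p %| `|l|)%N -> exists2 i, i \in P & ~~ (p %| `|lam i|)%N).
Context (A B : {fset int}) (BA : B `<=` A).
Context (fullA : forall x, exists2 a, a \in A & cg (Gam lam P `|l| ^ 2) a x).
Context (redA : forall p, prime p -> (p %| `|l|)%N ->
     exists2 a, a \in A & exists2 a', a' \in A & ~~ cg p a a').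
Local Notation ell := (`|l|%N).
Local Notation gm := (gam lam P ell).
Local Notation R0 := (ell * Gam lam P ell)%N.
Local Notation T := (SL lam P A).
Local Notation T1 i := (SL lam (P :\ i) A).

Lemma modulus_gt0 : (0 < R0)%N.
Proof. by rewrite muln_gt0 (ell0 l0) Gam_gt0. Qed.

(* The translates of Zi by [lam i * a], with [a] in the various classes modulo [gm i], lie
   in disjoint parts of ZT, so few classes of ZT congruent to [lam i * a] escape
   [lam i * a + Zi]; the latter move freely to [lam i * a' + Zi]. *)
Lemma move_count i a a' x Q (ZT Zi : {fset int}) :
  i \in P -> a \in A -> a' \in A -> (0 < Q)%N -> (R0 %| Q)%N ->
  inj_mod Q ZT -> inj_mod Q Zi ->
  (forall y, y \in T -> full Q ell T y -> exists2 z, z \in ZT & cg Q y z) ->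
  Zi `<=` T1 i -> (forall z, z \in Zi -> full Q ell (T1 i) z) ->
  cg (gm i) x (lam i * a) ->
  (#|` cls R0 x ZT| + gm i * #|` Zi| <= #|` cls R0 (x + lam i * (a' - a)) ZT| + #|` ZT|)%N.
Proof using l0 fullA nz P2 cop.
move=> iP aA a'A Q0 RQ iT iZ cT ZiT fZ xa; have L0 := ell0 l0.
have gR : (gm i %| R0)%N by rewrite dvdn_mull // gam_Gam.
have gQ : (gm i %| Q)%N := dvdn_trans gR RQ.
have g0 : (0 < gm i)%N := gam_gt0 _ _ _ _.
have T1g y : y \in T1 i -> cg (gm i) y 0.
  move=> /SL_dec[c _ ->].
  rewrite /cg subr0; apply: rpred_sum => j; rewrite !inE => /andP[ji jP].
  by rewrite dvdzE abszM dvdn_mulr // absz_nat; exact: gam_dvd.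
(* A full class of [T1 i], translated by [lam i * b], is a full class of [T]. *)
have inT b z : b \in A -> z \in Zi -> exists2 y, y \in ZT & cg Q (lam i * b + z) y.
  move=> bA zZ; rewrite addrC; apply: cT.
    rewrite (SL_D1 _ _ iP) addrC; apply: mem_addS; first exact: mem_dil.
    exact: (fsubsetP ZiT).
  apply/(fullP _ _ _ L0) => j; have /(fullP _ _ _ L0) h := fZ _ zZ.
  have [y yT hy] := h j; exists (lam i * b + y).
    by rewrite (SL_D1 _ _ iP); apply: mem_addS => //; apply: mem_dil.
  by rewrite [z + _]addrC -addrA cgDl.
have itr b (S : {fset int}) : S `<=` Zi -> inj_mod Q [fset lam i * b + z | z in S].
  move=> SZ _ _ /imfsetP[z /= zS ->] /imfsetP[z' /= z'S ->]; rewrite cgDl => h.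
  by congr (_ + _); apply: iZ => //; apply: (fsubsetP SZ).
have big c : (#|` Zi| <= #|` cls (gm i) (lam i * c) ZT|)%N.
  have [b bA hb] := fullA c; rewrite -(card_transl (lam i * b)).
  apply: (card_inj_mod (itr b Zi (fsubset_refl _))) => _ /imfsetP[z /= zZ ->].
  have [y yZ hy] := inT _ _ bA zZ; exists y => //.
  rewrite in_cls yZ /=; apply: (@cg_trans _ (lam i * b + z)).
    by rewrite cg_sym; apply: cg_dvd gQ hy.
  rewrite -[lam i * c]addr0; apply: cgD; last exact: T1g (fsubsetP ZiT _ zZ).
  apply/cgM/(cg_dvd _ hb); rewrite expnS dvdn_mulr //; exact: gam_Gam.
pose n c := #|` cls (gm i) (lam i * c) ZT|.
have hsum : (n a + (gm i).-1 * #|` Zi| <= #|` ZT|)%N.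
  have [c0 hc0] := cg_ord a g0.
  have := @sum_card_le _ (index_enum 'I_(gm i)) (gm i) ZT
    (fun c => cls (gm i) (lam i * (c : nat)%:Z) ZT) (fun c => lam i * (c : nat)%:Z)
    (index_enum_uniq _).
  rewrite (bigD1 c0) //= => h; apply: (leq_trans _ (h _ _ _)).
  - apply: leq_add.
      by rewrite /n (cls_eq _ (cgM (lam i) hc0)).
    apply: (@leq_trans (\sum_(c < gm i | c != c0) #|` Zi|)%N).
      by rewrite sum_nat_const cardC1 card_ord.
    by apply: leq_sum => c _; apply: big.
  - by move=> c _; apply: cls_sub.
  - by move=> c y _; rewrite in_cls => /andP[].
  - move=> c c' _ _; rewrite /cg -mulrBr dvdzE abszM Gauss_dvdr => [hc|].
      by apply: cg_ord_inj; rewrite /cg dvdzE.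
    exact: (coprime_gam_lam L0 nz P2 cop).
pose S1 := [fset z in Zi | cg R0 (z + lam i * a) x].
pose S2 := [fset z in Zi | ~~ cg R0 (z + lam i * a) x].
have S12 : #|` Zi| = (#|` S1| + #|` S2|)%N.
  have e1 : Zi `&` S1 = S1 by apply/fsetP => z; rewrite !inE; case: (z \in Zi).
  have e2 : Zi `\` S1 = S2.
    by apply/fsetP => z; rewrite !inE; case: (z \in Zi); rewrite ?andbF ?andbT.
  by rewrite -(cardfsID S1 Zi) e1 e2.
have S1Z : S1 `<=` Zi by apply: fset_sub.
have S2Z : S2 `<=` Zi by apply: fset_sub.
have le1 : (#|` S1| <= #|` cls R0 (x + lam i * (a' - a)) ZT|)%N.
  rewrite -(card_transl (lam i * a')).
  apply: (card_inj_mod (itr a' _ S1Z)) => _ /imfsetP[z /= + ->].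
  rewrite !inE => /andP[zZ hz].
  have [y yZ hy] := inT _ _ a'A zZ; exists y => //.
  rewrite in_cls yZ /=; apply: (@cg_trans _ (lam i * a' + z)).
    by rewrite cg_sym; apply: cg_dvd RQ hy.
  have -> : lam i * a' + z = z + lam i * a + lam i * (a' - a).
    by rewrite mulrBr -addrA subrKC addrC.
  by rewrite cgDr.
have le2 : (#|` cls R0 x ZT| + #|` S2| <= n a)%N.
  pose X1 := cls R0 x ZT; pose U2 := [fset lam i * a + z | z in S2].
  have sepU y : y \in U2 -> ~~ cg R0 y x.
    by move=> /imfsetP[z /= + ->]; rewrite !inE addrC => /andP[].
  have dis : [disjoint X1 & U2]%fset.
    apply/fdisjointP => y; rewrite in_cls => /andP[_ hy]; apply/negP => /sepU.
    by rewrite hy.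
  have cU : #|` X1 `|` U2| = (#|` X1| + #|` S2|)%N.
    by rewrite cardfsU (disjoint_fsetI0 dis) cardfs0 subn0 card_transl.
  rewrite -cU; apply: (@card_inj_mod Q).
    move=> y y'; rewrite !in_fsetU => /orP[yX|yU] /orP[yX'|yU'] h.
    - by apply: iT => //; apply: (fsubsetP (cls_sub R0 x ZT)).
    - move: yX; rewrite in_cls => /andP[_ yx]; case/negP: (sepU _ yU').
      by apply: cg_trans yx; rewrite cg_sym; apply: cg_dvd RQ h.
    - move: yX'; rewrite in_cls => /andP[_ yx]; case/negP: (sepU _ yU).
      by apply: cg_trans yx; apply: cg_dvd RQ h.
    - exact: itr S2Z _ _ yU yU' h.
  move=> y0; rewrite in_fsetU => /orP[|/imfsetP[z /= zS ->]].
    rewrite in_cls => /andP[yZ hy]; exists y0; last exact: cg_refl.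
    by rewrite in_cls yZ /=; apply: cg_trans xa; apply: cg_dvd gR hy.
  have zZ := fsubsetP S2Z _ zS.
  have [y yZ hy] := inT _ _ aA zZ; exists y => //.
  rewrite in_cls yZ /=; apply: (@cg_trans _ (lam i * a + z)).
    by rewrite cg_sym; apply: cg_dvd gQ hy.
  by rewrite -[X in cg _ _ X]addr0 cgDl; apply: T1g (fsubsetP ZiT _ zZ).
move: le1 le2 hsum S12; case: (gm i) g0 => // g _ /=; rewrite /n mulSn.
clear BA B redA; lia.
Qed.

(** With [M] the largest class of [B] modulo [Q], either [T] has at least b / M full classes and
    [card_add_dil] applies with [m = Q], or the full classes of every [T1 i] nearly exhaust those of
    [T], and moving among them makes [T] meet every class modulo [l]. *)
Lemma card_add_dil_level (K Q c1 : nat) (B' : {fset int}) :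
  let b := #|` B| in let E := (R0 * R0.+1)%N in
  let e := (2 * E * (2 * E * K))%N in
  (0 < K)%N -> (0 < Q)%N -> (R0 %| Q)%N ->
  (forall p, prime p -> (p %| Q)%N -> (p %| ell)%N) ->
  (#|` addS T (dil l B)| <= K * b)%N ->
  (forall i, i \in P -> (#|` [fset x in T1 i | ~~ full Q ell (T1 i) x]| * e <= b)%N) ->
  B' `<=` B -> constm Q B' -> (b <= c1 * #|` B'|)%N -> (0 < b)%N ->
  (#|` T| + ell * b <= #|` addS T (dil l B)| + ell * c1.+1)%N.
Proof.
move=> b E e K0 Q0 RQ pQ leK lebad B'B cB' leB' b0.
have L0 := ell0 l0; have R00 := modulus_gt0.
have [b1 b1B] : exists x, x \in B by apply/fset0Pn; rewrite -cardfs_gt0.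
have [bm bmB hbm] := fset_argmax (fun z => #|` cls Q z B|) b1B.
set M := #|` cls Q bm B| in hbm.
have M0 : (0 < M)%N by rewrite cardfs_gt0; apply/fset0Pn; exists bm; rewrite in_cls bmB cg_refl.
have leM c : (#|` cls Q c B| <= M)%N.
  have [->|[x]] := fset_0Vmem (cls Q c B); first by rewrite cardfs0.
  by rewrite in_cls => /andP[xB xc]; rewrite -(cls_eq _ xc); apply: hbm.
have b'M : (#|` B'| <= M)%N.
  have [->|[x xB]] := fset_0Vmem B'; first by rewrite cardfs0.
  apply: leq_trans (leM x); apply: fsubset_leq_card; apply/fsubsetP => y yB.
  by rewrite in_cls (fsubsetP B'B) //=; apply: cB'.
have lebM : (b <= c1 * M)%N by apply: leq_trans leB' _; rewrite leq_mul2l b'M orbT.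
have [ZT [ZTs iZT cZT]] := reps_exist Q [fset x in T | full Q ell T x].
have ZTf z : z \in ZT -> full Q ell T z.
  by move/(fsubsetP ZTs); rewrite !inE => /andP[].
have cT y : y \in T -> full Q ell T y -> exists2 z, z \in ZT & cg Q y z.
  by move=> yT fy; apply: cZT; rewrite !inE yT.
have [le|lt] := leqP b (#|` ZT| * M)%N.
  have [R [RT iR cR]] := reps_exist (ell * Q) T.
  have h1 := card_add_dil l0 RT iR (cls_sub Q bm B) (constm_cls (m:=Q) (c:=bm) (X:=B))
    (_ : bm \in cls Q bm B).
  have {}h1 := h1 ltac:(by rewrite in_cls bmB cg_refl).
  have h2 : (ell * #|` ZT| <= #|` R|)%N.
    by apply: (card_full_reps Q0 L0 iZT ZTf) => x /cR[r rR hr]; exists r; rewrite // mulnC.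
  (* Passing from [M] to [M - 1] loses |ZT|, which is unbounded; when [ZT] is large, [b <= c1 * M]
     is used instead. *)
  have h3 : (b <= #|` ZT| * M.-1 + c1.+1)%N.
    move: le lebM; rewrite -(prednK M0) /= !mulnS => le lebM.
    have [h|h] := leqP #|` ZT| c1.+1; first by rewrite (leq_trans le) // addnC leq_add2l.
    apply: leq_trans lebM _; rewrite addnC leq_add //.
    by rewrite leq_mul2r (leq_trans (leqnSn _) (ltnW h)) orbT.
  have h4 : (ell * #|` ZT| * M.-1 <= #|` R| * M.-1)%N by rewrite leq_mul2r h2 orbT.
  rewrite -/M in h1.
  have h5 : (ell * b <= ell * #|` ZT| * M.-1 + ell * c1.+1)%N.
    by rewrite -mulnA -mulnDr leq_mul2l h3 orbT.
  by apply: leq_trans (leq_add h1 (leqnn _)); rewrite -addnA leq_add2l (leq_trans h5) // leq_add2r.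
have E0 : (1 < E)%N by rewrite /E; case: (R0) R00 => // n _; rewrite mulnS.
have /choice[Zf hZf] i := reps_exist Q [fset x in T1 i | full Q ell (T1 i) x].
have ZiT i : Zf i `<=` T1 i.
  by have [h _ _] := hZf i; apply: fsubset_trans h (fset_sub _ _).
have Zif i z : z \in Zf i -> full Q ell (T1 i) z.
  by have [h _ _] := hZf i; move/(fsubsetP h); rewrite !inE => /andP[].
have iZi i : inj_mod Q (Zf i) by have [] := hZf i.
have cnt i : i \in P -> (E.-1 * b <= E * (gm i * #|` Zf i| * M))%N.
  move=> iP; have [_ _ cZi] := hZf i.
  apply: (@count_T1 I lam P l l0 nz P2 cop A B BA i Q K E M (Zf i)) => //.
  - by apply: dvdn_trans RQ; rewrite dvdn_mull // gam_Gam.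
  - by rewrite /E muln_gt0 R00.
  - exact: lebad.
  - by move=> x xT fx; apply: cZi; rewrite !inE xT.
have cnt2 i : i \in P -> (E.-1 * #|` ZT| <= E * (gm i * #|` Zf i|))%N.
  move=> iP; rewrite -(leq_pmul2r M0) -mulnA -[X in (_ <= X)%N]mulnA.
  by apply: leq_trans (cnt i iP); rewrite leq_mul2l (ltnW lt) orbT.
pose tau x := #|` cls R0 x ZT|.
have mvc i a a' x : i \in P -> a \in A -> a' \in A -> cg (gm i) x (lam i * a) ->
    (tau x + gm i * #|` Zf i| <= tau (x + lam i * (a' - a))%R + #|` ZT|)%N.
  move=> iP aA a'A hx; apply: (move_count iP aA a'A Q0 RQ) => //; exact: Zif.
have [i0 i0P] : exists i, i \in P by apply/set0Pn; rewrite -card_gt0; apply: ltnW.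
have ZT0 : (0 < #|` ZT|)%N.
  rewrite lt0n; apply/negP => /eqP Z0.
  have [a aA _] := fullA 0.
  have := mvc i0 a a (lam i0 * a) i0P aA aA (cg_refl _ _).
  rewrite subrr mulr0 addr0 Z0 addn0 -[X in (_ <= X)%N]addn0 leq_add2l leqn0 => /eqP z0.
  have := cnt _ i0P; rewrite z0 mul0n muln0 leqn0 muln_eq0 => /orP[|/eqP h].
    by case: (E) E0 => [|[]].
  by rewrite h in b0.
have tau_per x z : tau (x + R0%:Z * z) = tau x.
  by rewrite /tau (cls_eq _ (cg_addM R0 x z)).
have [x0 hx0] : exists x0, (#|` ZT| <= R0 * tau x0)%N.
  have c1Z : constm 1 ZT by move=> x y _ _; rewrite /cg dvd1z.
  have [X' [X'Z cX' leX']] := pigeon R00 c1Z; rewrite mul1n in cX'.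
  have [X0|[x xX']] := fset_0Vmem X'.
    by exists 0; apply: leq_trans leX' _; rewrite X0 cardfs0 muln0.
  exists x; apply: leq_trans leX' _; rewrite leq_mul2l; apply/orP; right.
  apply: fsubset_leq_card; apply/fsubsetP => y yX.
  by rewrite in_cls (fsubsetP X'Z) //=; apply: cX'.
have tau_pos x : (0 < tau x)%N.
  (* A move costs [tau] at most |ZT| / E. It starts at |ZT| / R0, that is [R0 + 1] such units, so
     one is left after [R0] moves; hence [E = R0 * (R0 + 1)]. *)
  pose V j x := ((R0.+1 - j) * #|` ZT| <= E * tau x)%N.
  pose mv x y := exists i a a', [/\ i \in P, a \in A, a' \in A,
     cg (gm i) x (lam i * a) & y = x + lam i * (a' - a)].
  suff : V R0 x.
    rewrite /V subSnn mul1n => h.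
    by rewrite lt0n; apply: contraTneq h => ->; rewrite muln0 -ltnNge.
  apply: (@chain_full R0 V mv x0 R00).
  - by move=> j y z; rewrite /V tau_per.
  - move=> j y; apply: leq_trans; rewrite leq_mul2r; apply/orP; right; clear; lia.
  - move=> j y z jR Vy [i [a [a' [iP aA a'A hy ->]]]].
    have h1 := mvc _ _ _ _ iP aA a'A hy; have h2 := cnt2 _ iP.
    move: Vy; rewrite /V; move: h1 h2; set t1 := tau y; set t2 := tau _.
    set G := (gm i * _)%N; set Z := #|` ZT|; rewrite subSS => h1 h2.
    have -> : (R0.+1 - j = (R0 - j).+1)%N by rewrite subSn // ltnW.
    rewrite mulSn => h3.
    have h4 : (E * (t1 + G) <= E * (t2 + Z))%N by rewrite leq_mul2l h1 orbT.
    move: h2 h3 h4 E0; rewrite !mulnDr; case: (E) => // E' /=; rewrite mulSn.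
    lia.
  - rewrite /V subn0 mulnC /E -mulnA [(R0.+1 * _)%N]mulnC mulnA leq_mul2r.
    by rewrite hx0 orbT.
  - move=> W perW W0 clW; apply: (closed_all L0 nz P2 cop fullA redA perW _ W0).
    by move=> i a a' y iP aA a'A hy Wy; apply: (clW y) => //; exists i, a, a'.
have [R [RT iR cR]] := reps_exist (ell * 1) T.
have leR : (ell <= #|` R|)%N.
  have f1 : full 1 ell T 0.
    apply/(fullP _ _ _ L0) => j.
    have /fset0Pn[z] : cls R0 j ZT != fset0 by rewrite -cardfs_gt0; apply: tau_pos.
    rewrite in_cls => /andP[zZ hz]; exists z.
      by have := fsubsetP ZTs _ zZ; rewrite !inE => /andP[].
    by rewrite mul1n add0r mul1r; apply: cg_dvd hz; apply: dvdn_mulr.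
  apply: leq_trans (card_full_node (R := R) _ L0 f1 _) _ => //.
    by move=> x /cR; rewrite mulnC.
  exact: fsubset_leq_card (cls_sub _ _ _).
have c1B : constm 1 B by move=> x y _ _; rewrite /cg dvd1z.
have h1 := card_add_dil l0 RT iR (fsubset_refl B) c1B b1B.
have h2 : (ell * #|` B|.-1 <= #|` R| * #|` B|.-1)%N by rewrite leq_mul2r leR orbT.
have h3 : (ell * b <= ell * #|` B|.-1 + ell * c1.+1)%N.
  by rewrite -mulnDr leq_mul2l; apply/orP; right; rewrite -{1}(prednK b0) addnS ltnS leq_addr.
apply: leq_trans (leq_add h1 (leqnn _)); rewrite -addnA leq_add2l.
by apply: leq_trans h3 _; rewrite leq_add2r.
Qed.
End Core.

(** * The sharp bound for sets meeting all classes *)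

Lemma card_add_dil_sharp_of2 (I : finType) (lam : I -> int) (P : {set I}) (l : int) (K : nat) :
  l != 0 -> (forall i, i \in P -> lam i != 0) -> (1 < #|P|)%N ->
  (forall p, prime p -> (p %| `|l|)%N -> exists2 i, i \in P & ~~ (p %| `|lam i|)%N) ->
  (0 < K)%N ->
  exists C0 : nat, forall A B : {fset int}, B `<=` A -> B != fset0 ->
  (forall x, exists2 a, a \in A & cg (Gam lam P `|l| ^ 2) a x) ->
  (forall p, prime p -> (p %| `|l|)%N ->
     exists2 a, a \in A & exists2 a', a' \in A & ~~ cg p a a') ->
  (#|` addS (SL lam P A) (dil l B)| <= K * #|` B|)%N ->
  (#|` SL lam P A| + `|l| * #|` B| <= #|` addS (SL lam P A) (dil l B)| + C0)%N.
Proof.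
move=> l0 nz P2 cop K0; have L0 := ell0 l0.
set ell := `|l|%N in cop L0 *; set R0 := (ell * Gam lam P ell)%N.
have R00 : (0 < R0)%N by rewrite muln_gt0 L0 Gam_gt0.
(* [E] and [e] are dictated by [card_add_dil_level], [W] by [common_level] and [H] by [node_gain]. A
   [B] with at most [c1] elements is absorbed by the constant; a larger one keeps a proportion 1 /
   c1 down to the last level. *)
pose E := (R0 * R0.+1)%N; pose e := (2 * E * (2 * E * K))%N.
pose W := (#|P| * (e * K) + 1)%N; pose H := (2 * (ell * (2 * W) ^ ell))%N.
pose N := (W * H)%N; pose c1 := (R0 * ell ^ N)%N.
have W0 : (0 < W)%N by rewrite /W addn1.
have H0 : (0 < H)%N by rewrite /H !muln_gt0 L0 expn_gt0 muln_gt0 W0.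
exists (ell * c1.+1)%N => A B BA B0 fullA redA leK.
have b0 : (0 < #|` B|)%N by rewrite cardfs_gt0.
have [small|big] := leqP #|` B| c1.
  apply: leq_add.
    by have /fset0Pn[b bB] := B0; apply: card_addSl (mem_dil l bB).
  by rewrite leq_mul2l (leq_trans small) ?orbT.
have pR0 p : prime p -> (p %| R0)%N -> (p %| ell)%N.
  move=> pp; rewrite Euclid_dvdM // => /orP[//|] /(Gam_prime pp)[i iP].
  by move/(gam_prime L0 nz P2 i pp) => [].
have [Q [Y [[Y0 sY Q0 pQ cY] cY' leY hN]]] := nested_moduli l0 R00 pR0 big.
have hbad i : i \in P -> (\sum_(t < N) #|` [fset x in SL lam (P :\ i) A |
      ~~ full (Q t) ell (SL lam (P :\ i) A) x]| <= H * (K * #|` B|))%N.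
  move=> iP; apply: leq_trans (@sum_nonfull_le ell W Q Y _ L0 W0 Q0 _ _ _ _ _ _) _ => //.
  - by move=> s sN; have [_ _ h _] := hN s (ltnW sN); apply: h.
  - by move=> s sN; have [h _ _ _] := hN s sN.
  - by move=> s p sN pp pl; have [_ _ _ h] := hN s (ltnW sN); apply: h.
  rewrite -/H leq_mul2l; apply/orP; right; apply: leq_trans leK.
  have [a aA _] := fullA 0.
  apply: leq_trans (fsubset_leq_card (addSS (fsubset_refl _) Y0)) _.
  rewrite (SL_D1 _ _ iP) -addSA; exact: card_addSr (mem_dil _ aA).
have [t _ ht] := @common_level I P (fun i t => #|` [fset x in SL lam (P :\ i) A |
      ~~ full (Q t) ell (SL lam (P :\ i) A) x]|) e H K W N #|` B|
   (erefl _) (erefl _) H0 b0 hbad.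
have [_ RQ _ _] := hN t (ltnW (ltn_ord t)).
have sub0 s : Y s `<=` dil l B by elim: s => // s IH; apply: fsubset_trans (sY s) IH.
(* [Y t.+1] is constant modulo [Q t * ell]; cancelling [l], its preimage is constant modulo
   [Q t]. *)
pose B' := [fset x in B | l * x \in Y t.+1].
have YB' : Y t.+1 `<=` dil l B'.
  apply/fsubsetP => y yY; have /in_dil[x xB ex] := fsubsetP (sub0 _) _ yY.
  by rewrite ex mem_dil // !inE xB -ex.
apply: (@card_add_dil_level I lam P l l0 nz P2 cop A B BA fullA redA K (Q t) c1 B') => //.
- by move=> p; apply: pQ.
- exact: fset_sub.
- move=> x x'; rewrite !inE => /andP[_ xY] /andP[_ x'Y].
  have := cY' _ _ _ xY x'Y; rewrite /cg -mulrBr !dvdzE abszM absz_nat mulnC.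
  by rewrite dvdn_pmul2l.
- apply: leq_trans (leY t.+1) _; rewrite leq_mul //.
    by rewrite leq_mul2l leq_pexp2l ?orbT.
  by rewrite -(card_dil B' l0); apply: fsubset_leq_card.
Qed.

Lemma reps_full (g : nat) (A R : {fset int}) : (0 < g)%N ->
  (forall x, exists2 a, a \in A & cg g a x) -> inj_mod g R ->
  (forall x, x \in A -> exists2 z, z \in R & cg g x z) -> #|` R| = g.
Proof.
move=> g0 fA iR cR; apply/eqP; rewrite eqn_leq; apply/andP; split.
  rewrite -[X in (_ <= X)%N](card_arith g 0 (ltn0Sn 0)); apply: card_inj_mod iR _ => u uR.
  have [i hi] := cg_ord u g0; exists (0 + 1 * (i : nat)%:Z); last by rewrite mul1r add0r.
  by apply/imfsetP; exists i.
rewrite -{1}(card_arith g 0 (ltn0Sn 0)); apply: (@card_inj_mod g).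
  move=> _ _ /imfsetP[i /= _ ->] /imfsetP[j /= _ ->].
  by rewrite !mul1r !add0r => /cg_ord_inj ->.
move=> u _; have [a aA ha] := fA u; have [z zR hz] := cR _ aA.
by exists z => //; apply: cg_trans hz; rewrite cg_sym.
Qed.

Lemma coprime_gcdS (I : finType) (lam : I -> int) (P : {set I}) k :
  k \in P -> lam k != 0 -> gcdS lam P = 1%N -> coprime `|lam k| (gcdS lam (P :\ k)).
Proof.
move=> kP nk g1; apply: coprime_primeP; last by rewrite absz_gt0.
move=> p pp pk /dvdn_gcdS h.
have : (p %| gcdS lam P)%N.
  apply/dvdn_gcdS => j jP; have [->//|jk] := eqVneq j k.
  by apply: h; rewrite !inE jk.
by rewrite g1 dvdn1 => /eqP p1; rewrite p1 in pp.
Qed.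

(** [F] is the modulus whose classes [A] must all meet. The condition on its primes makes it divide
    a power of [Gprod], which fibres of nearly extremal sets can supply. *)
Lemma card_add_dil_sharp (I : finType) (lam : I -> int) (P : {set I}) k (K : nat) :
  (forall i, i \in P -> lam i != 0) -> k \in P -> (1 < #|P|)%N -> gcdS lam P = 1%N ->
  (0 < K)%N ->
  exists F C0 : nat, [/\ (0 < F)%N,
    forall p, prime p -> (p %| F)%N -> exists2 i, i \in P & (p %| gcdS lam (P :\ i))%N &
  forall A B : {fset int}, B `<=` A -> B != fset0 ->
  (forall x, exists2 a, a \in A & cg F a x) -> gd A = 1%N ->
  (#|` addS (SL lam (P :\ k) A) (dil (lam k) B)| <= K * #|` B|)%N ->
  (#|` SL lam (P :\ k) A| + `|lam k| * #|` B| <=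
   #|` addS (SL lam (P :\ k) A) (dil (lam k) B)| + C0)%N].
Proof.
move=> nz kP P2 g1 K0; set l := lam k; set P' := P :\ k.
have l0 : l != 0 := nz _ kP; have L0 := ell0 l0.
have nz' i : i \in P' -> lam i != 0 by rewrite !inE => /andP[_ /nz].
have cop p : prime p -> (p %| `|l|)%N -> exists2 i, i \in P' & ~~ (p %| `|lam i|)%N.
  move=> pp pl; apply: contrapT => no.
  have cc : coprime `|l| (gcdS lam P') := @coprime_gcdS I lam P k kP l0 g1.
  have : (p %| gcdn `|l| (gcdS lam P'))%N.
    rewrite dvdn_gcd pl; apply/dvdn_gcdS => i iP; apply: contrapT => /negP h.
    by apply: no; exists i.
  by rewrite (eqP cc) dvdn1 => /eqP p1; rewrite p1 in pp.
have [P'2|P'1] := ltnP 1 #|P'|.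
  have [C0 hC] := card_add_dil_sharp_of2 l0 nz' P'2 cop K0.
  exists (Gam lam P' `|l| ^ 2)%N, C0; split.
  - by rewrite expn_gt0 Gam_gt0.
  - move=> p pp; rewrite Euclid_dvdX // => /andP[/(Gam_prime pp)[i iP']].
    move=> /(gam_prime L0 nz' P'2 i pp)[pl h] _; exists i.
      by move: iP'; rewrite !inE => /andP[].
    apply/dvdn_gcdS => j; rewrite !inE => /andP[ji jP].
    have [->//|jk] := eqVneq j k; apply: h => //; by rewrite !inE jk.
  - move=> A B BA B0 fA gA; apply: hC => // p pp pl.
    apply: contrapT => no; have : (p %| gd A)%N.
      apply/gdP => x y xA yA; apply: contrapT => /negP h; apply: no.
      by exists x => //; exists y.
    by rewrite gA dvdn1 => /eqP p1; rewrite p1 in pp.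
(* With a single other slot, [lam i] is coprime to [l], so [lam i * A] meets every class modulo [l]
   and [card_add_dil] with [m = 1] suffices. *)
have /eqP/cards1P[i Pi] : #|P'| = 1%N.
  by apply/eqP; rewrite eqn_leq P'1 /=; move: P2; rewrite (cardsD1 k P) kP add1n ltnS.
have iP' : i \in P' by rewrite Pi inE.
have /andP[ik iP] : (i != k) && (i \in P) by move: iP'; rewrite !inE.
exists `|l|%N, `|l|%N; split => //.
  move=> p pp pl; exists i => //; apply/dvdn_gcdS => j; rewrite !inE => /andP[ji jP].
  have [->//|jk] := eqVneq j k.
  have : j \in P' by rewrite !inE jk.
  by rewrite Pi inE (negbTE ji).
move=> A B BA /fset0Pn[b bB] fA _ _; set T := SL lam P' A.
have cli : coprime `|l| `|lam i|.
  apply: coprime_primeP L0 => p pp pl pi; have [j] := cop p pp pl.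
  by rewrite Pi inE => /eqP ->; rewrite pi.
have [R [RT iR cR]] := reps_exist (`|l| * 1) T.
have cR' x : x \in T -> exists2 z, z \in R & cg `|l| x z.
  by move: (cR x); rewrite muln1; apply.
have leR : #|` R| = `|l|%N.
  apply: (reps_full (A := T) L0 _ _ cR'); last by move: iR; rewrite muln1.
  move=> x; have [y hy] := solve_cg x cli; have [a aA ha] := fA y.
  exists (lam i * a); last by apply: cg_trans hy; apply: cgM.
  by rewrite /T /SL Pi big_set1; apply: mem_dil.
have c1B : constm 1 B by move=> x y _ _; rewrite /cg dvd1z.
have := card_add_dil l0 RT iR (fsubset_refl B) c1B bB.
have : (0 < #|` B|)%N by rewrite cardfs_gt0; apply/fset0Pn; exists b.
rewrite leR; case: #|` B| => //= n _ h.
by rewrite mulnS addnCA addnC leq_add2r.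
Qed.

(** [T] consists of multiples of [g] and [lam k] is a unit modulo [g], so [S(A)] splits into
    [T + lam k * B] over the [g] classes [B] of [A]. Summing the sharp bounds gives [g] copies of
    |T|, which [hT] bounds. [D] transfers the bound [K] from [A] to its classes. *)
Lemma exact_step (I : finType) (lam : I -> int) (P : {set I}) k (K D L1 C1 : nat) :
  (forall i, i \in P -> lam i != 0) -> k \in P -> (1 < #|P|)%N -> gcdS lam P = 1%N ->
  (0 < K)%N -> (0 < D)%N ->
  (forall A : {fset int}, (L1 * #|` A| <= gcdS lam (P :\ k) * #|` SL lam (P :\ k) A| + C1)%N) ->
  exists F C0 : nat, [/\ (0 < F)%N,
    forall p, prime p -> (p %| F)%N -> exists2 i, i \in P & (p %| gcdS lam (P :\ i))%N &
  forall A : {fset int},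
  (forall x, exists2 a, a \in A & cg F a x) -> gd A = 1%N ->
  (#|` SL lam P A| <= K * #|` A|)%N ->
  (forall a, a \in A -> (#|` A| <= D * #|` cls (gcdS lam (P :\ k)) a A|)%N) ->
  ((L1 + `|lam k|) * #|` A| <= #|` SL lam P A| + C0)%N].
Proof.
move=> nz kP P2 g1 K0 D0 hT; set g := gcdS lam (P :\ k) in hT *.
have KD0 : (0 < K * D)%N by rewrite muln_gt0 K0.
have [F [C0 [F0 pF hF]]] := card_add_dil_sharp nz kP P2 g1 KD0.
have g0 : (0 < g)%N := gcd_rest_gt0 nz P2 k.
exists (F * g)%N, (g * C0 + C1)%N; split.
- by rewrite muln_gt0 F0.
- by move=> p pp; rewrite Euclid_dvdM // => /orP[/(pF _ pp)//|pg]; exists k.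
move=> A fA gA leK hD; set T := SL lam (P :\ k) A.
have fF x : exists2 a, a \in A & cg F a x.
  by have [a aA ha] := fA x; exists a => //; apply: cg_dvd ha; apply: dvdn_mulr.
have fg x : exists2 a, a \in A & cg g a x.
  by have [a aA ha] := fA x; exists a => //; apply: cg_dvd ha; apply: dvdn_mull.
have SE : SL lam P A = addS T (dil (lam k) A) by rewrite (SL_D1 _ _ kP) addSC.
have [R [RA iR cR]] := reps_exist g A.
have cRg := reps_full g0 fg iR cR.
have hsum : (\sum_(r <- R) #|` addS T (dil (lam k) (cls g r A))| <= #|` SL lam P A|)%N.
  rewrite SE; apply: (@sum_card_le _ _ g _ _ (fun r => lam k * r)).
  - exact: fset_uniq.
  - by move=> r _; apply: addSS => //; apply/dilS/cls_sub.
  - move=> r _ _ /in_addS[t [_ [tT /in_dil[x xc ->] ->]]].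
    rewrite -[lam k * r]add0r; apply: cgD; last first.
      by move: xc; rewrite in_cls => /andP[_ h]; apply: cgM.
    have [c _ ->] := SL_dec tT; rewrite /cg subr0; apply: rpred_sum => j jP.
    by rewrite dvdzE abszM dvdn_mulr // absz_nat; apply: gcdS_dvd.
  - move=> r r' rR r'R; rewrite /cg -mulrBr dvdzE abszM absz_nat Gauss_dvdr => [h|].
      by apply: iR => //; rewrite /cg dvdzE.
    by rewrite coprime_sym; apply: coprime_gcdS => //; apply: nz.
have each r : r \in R -> (#|` T| + `|lam k| * #|` cls g r A| <=
    #|` addS T (dil (lam k) (cls g r A))| + C0)%N.
  move=> rR; have rA := fsubsetP RA _ rR; apply: hF => //.
  - exact: cls_sub.
  - by apply/fset0Pn; exists r; rewrite in_cls rA cg_refl.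
  - rewrite -mulnA; apply: (@leq_trans (K * #|` A|)%N); last by rewrite leq_mul2l hD ?orbT.
    apply: leq_trans leK; rewrite SE; apply: fsubset_leq_card; apply: addSS => //.
    by apply/dilS/cls_sub.
have h1 : (\sum_(r <- R) (#|` T| + `|lam k| * #|` cls g r A|) <=
    #|` SL lam P A| + g * C0)%N.
  apply: (@leq_trans (\sum_(r <- R) (#|` addS T (dil (lam k) (cls g r A))| + C0))%N).
    by rewrite big_seq [X in (_ <= X)%N]big_seq; apply: leq_sum.
  rewrite big_split /= leq_add //.
  by rewrite big_const_seq count_predT iter_addn_0 cRg mulnC.
have h2 : (#|` A| <= \sum_(r <- R) #|` cls g r A|)%N.
  apply: card_le_cover => x xA; have [z zR h] := cR _ xA.
  by exists z; rewrite // in_cls xA.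
have h3 : (`|lam k| * #|` A| <= `|lam k| * \sum_(r <- R) #|` cls g r A|)%N.
  by rewrite leq_mul2l h2 orbT.
move: h1; rewrite big_split /= -big_distrr /= big_const_seq count_predT iter_addn_0 cRg.
have := hT A; rewrite -/T mulnDl; move: h3; rewrite [(#|` T| * g)%N]mulnC; set x1 := (`|lam k| * #|` A|)%N; set x2 := (`|lam k| * _)%N; set x3 := (g * #|` T|)%N; set x4 := (g * C0)%N; set x5 := (L1 * _)%N; clear; lia.
Qed.

(** * Nearly extremal sets *)

Lemma card_disjoint_sub (X Y Z : {fset int}) : X `<=` Z -> Y `<=` Z ->
  (forall x, x \in X -> x \notin Y) -> (#|` X| + #|` Y| <= #|` Z|)%N.
Proof.
move=> XZ YZ dis.
have /disjoint_fsetI0 e : [disjoint X & Y]%fset by apply/fdisjointP.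
have -> : (#|` X| + #|` Y| = #|` X `|` Y|)%N by rewrite cardfsU e cardfs0 subn0.
by apply: fsubset_leq_card; rewrite fsubUset XZ.
Qed.

Lemma card_SL (I : finType) (lam : I -> int) (P : {set I}) i A :
  i \in P -> lam i != 0 -> (#|` A| <= #|` SL lam P A|)%N.
Proof.
move=> iP nz; have [->|[a aA]] := fset_0Vmem A; first by rewrite cardfs0.
rewrite (SL_D1 _ _ iP) -(card_dil A nz).
have [x hx] := SL_ne lam (P :\ i) aA; exact: card_addSl hx.
Qed.

Lemma cg_cancel m (l x y : int) : coprime m `|l| -> cg m (l * x) (l * y) -> cg m x y.
Proof. by move=> c; rewrite /cg -mulrBr dvdzE abszM absz_nat Gauss_dvdr. Qed.

Lemma SL_affine (I : finType) (lam : I -> int) (P : {set I}) (a d : int) (X : {fset int}) :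
  SL lam P [fset a + d * y | y in X] =
  [fset (\sum_(i in P) lam i) * a + d * y | y in SL lam P X].
Proof.
have e (c : I -> int) : \sum_(i in P) lam i * (a + d * c i) =
    (\sum_(i in P) lam i) * a + d * \sum_(i in P) lam i * c i.
  rewrite mulr_suml mulr_sumr -big_split /=; apply: eq_bigr => i _; ring.
apply/fsetP => x; apply/idP/imfsetP => [/SL_dec[c hc ->]|[_ /= /SL_dec[c hc ->] ->]].
  have /choice[f hf] i : exists y, i \in P -> y \in X /\ c i = a + d * y.
    have [iP|] := boolP (i \in P); last by exists 0.
    by have /imfsetP[y /= yX e'] := hc i iP; exists y.
  exists (\sum_(i in P) lam i * f i); first by apply: mem_SL => i /hf[].
  by rewrite -e; apply: eq_bigr => i /hf[_ ->].
rewrite -e; apply: mem_SL => i /hc ci; apply/imfsetP; exists (c i) => //.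
Qed.

Lemma card_affine (a d : int) (X : {fset int}) : d != 0 ->
  #|` [fset a + d * y | y in X]| = #|` X|.
Proof. by move=> d0; apply: card_imfset => x y /addrI /(mulfI d0). Qed.

Lemma card_SL_affine (I : finType) (lam : I -> int) (P : {set I}) (a d : int) X : d != 0 ->
  #|` SL lam P [fset a + d * y | y in X]| = #|` SL lam P X|.
Proof. by move=> d0; rewrite SL_affine card_affine. Qed.

(** A class of [A] rescaled: the preimage of [A] under [y |-> a + m * y]. *)
Definition sec (m : nat) (a : int) (A : {fset int}) : {fset int} :=
  [fset ((x - a) %/ m)%Z | x in cls m a A].

Lemma in_sec m a A y : (0 < m)%N -> (y \in sec m a A) = (a + m%:Z * y \in A).
Proof.
move=> m0; have mz : m%:Z != 0 by rewrite eqz_nat -lt0n.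
apply/imfsetP/idP => [[x /= + ->]|h].
  by rewrite in_cls => /andP[xA h]; rewrite mulrC divzK // subrKC.
exists (a + m%:Z * y) => /=; last by rewrite addrAC subrr add0r mulKz.
by rewrite in_cls h cg_addM.
Qed.

Lemma secE m a A : (0 < m)%N -> cls m a A = [fset a + m%:Z * y | y in sec m a A].
Proof.
move=> m0; apply/fsetP => x; apply/idP/imfsetP => [|[y /= + ->]].
  rewrite in_cls => /andP[xA /dvdzP[y hy]].
  have e : x = a + m%:Z * y by rewrite mulrC -hy subrKC.
  by exists y => //=; rewrite in_sec // -e.
by rewrite in_sec // => h; rewrite in_cls h cg_addM.
Qed.

Lemma card_sec m a A : (0 < m)%N -> #|` sec m a A| = #|` cls m a A|.
Proof. by move=> m0; rewrite secE // card_affine // eqz_nat -lt0n. Qed.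

Lemma card_SL_sec (I : finType) (lam : I -> int) (P : {set I}) m a A : (0 < m)%N ->
  #|` SL lam P (sec m a A)| = #|` SL lam P (cls m a A)|.
Proof. by move=> m0; rewrite secE // card_SL_affine // eqz_nat -lt0n. Qed.

Section Near.
Context (I : finType) (lam : I -> int) (P : {set I}).
Context (nz : forall i, i \in P -> lam i != 0) (P2 : (1 < #|P|)%N) (g1 : gcdS lam P = 1%N).
Local Notation gg i := (gcdS lam (P :\ i)).
Definition Gprod : nat := \prod_(i in P) gcdS lam (P :\ i).
Local Notation G := Gprod.
Definition Lsum : nat := \sum_(i in P) `|lam i|%N.
Local Notation D := (4 * Lsum ^ 2)%N.
Local Notation S := (SL lam P).
Local Notation s := (\sum_(i in P) lam i).

Lemma gg_gt0 i : (0 < gg i)%N. Proof. exact: gcd_rest_gt0 nz P2 i. Qed.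

Lemma G_gt0 : (0 < G)%N. Proof. by apply: prodn_gt0 => i; apply: gg_gt0. Qed.

Lemma gg_G i : i \in P -> (gg i %| G)%N.
Proof. by move=> iP; rewrite /Gprod (bigD1 i) //= dvdn_mulr. Qed.

Lemma gg_lam i j : j \in P -> j != i -> (gg i %| `|lam j|)%N.
Proof. by move=> jP ji; apply: gcdS_dvd; rewrite !inE ji. Qed.

Lemma coprime_gg_lam i : i \in P -> coprime (gg i) `|lam i|.
Proof. by move=> iP; rewrite coprime_sym; apply: (@coprime_gcdS I lam P i iP (nz iP) g1). Qed.

Lemma coprime_gg i j : i \in P -> j \in P -> i != j -> coprime (gg i) (gg j).
Proof. by move=> iP jP ij; apply: coprime_dvdr (coprime_gg_lam iP); apply: gg_lam. Qed.

Lemma coprime_prodr (r : seq I) (Q : pred I) (F : I -> nat) m :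
  (forall i, Q i -> coprime m (F i)) -> coprime m (\prod_(i <- r | Q i) F i).
Proof.
by move=> h; elim/big_ind: _ => [|u v hu hv|//]; rewrite ?coprimen1 // coprimeMr hu.
Qed.

Lemma cg_G x y : (forall i, i \in P -> cg (gg i) x y) -> cg G x y.
Proof.
move=> h; rewrite /Gprod -big_enum.
have : {subset enum P <= P} by move=> i; rewrite mem_enum.
elim: (enum P) (enum_uniq P) => [|k r IH] /=; first by rewrite big_nil /cg dvd1z.
move=> /andP[kr ur] sub; rewrite big_cons; apply: cg_coprime.
- rewrite big_seq; apply: coprime_prodr => j jr; apply: coprime_gg.
  + by apply: sub; rewrite mem_head.
  + by apply: sub; rewrite inE jr orbT.
  + by apply: contraNneq kr => ->.
- by apply/h/sub/mem_head.
- by apply: IH => // j jr; apply: sub; rewrite inE jr orbT.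
Qed.

(** For [j != i], [gg j] divides [lam i], so only the class modulo [gg i] matters. *)
Lemma cg_lam i x y : i \in P -> cg (gg i) x y -> cg G (lam i * x) (lam i * y).
Proof.
move=> iP h; apply: cg_G => j jP; have [->|ij] := eqVneq j i; first exact: cgM.
rewrite /cg -mulrBr dvdzE abszM dvdn_mulr // absz_nat; apply: gg_lam => //.
by rewrite eq_sym.
Qed.

(** Modulo [gg i] the sum of the coefficients reduces to [lam i], a unit there. *)
Lemma cg_sum_lam x y : cg G (s * x) (s * y) -> cg G x y.
Proof.
move=> h; apply: cg_G => i iP; apply: (cg_cancel (coprime_gg_lam iP)).
have := cg_dvd (gg_G iP) h.
rewrite (bigD1 i) //= !mulrDl => h1.
have h2 z : cg (gg i) (lam i * z + (\sum_(j in P | j != i) lam j) * z) (lam i * z).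
  rewrite /cg addrAC subrr add0r mulr_suml; apply: rpred_sum => j /andP[jP ji].
  by rewrite dvdzE abszM dvdn_mulr // absz_nat; apply: gg_lam.
by apply: cg_trans (h2 y); apply: cg_trans h1; rewrite cg_sym.
Qed.

Lemma cg_SL c A x : (forall y, y \in A -> cg G y c) -> x \in S A -> cg G x (s * c).
Proof.
move=> h /SL_dec[a ha ->]; rewrite mulr_suml; apply: cg_sum => i iP.
by apply/cgM/h/ha.
Qed.

Lemma Lsum_gt0 : (0 < Lsum)%N.
Proof.
have [i iP] : exists i, i \in P by apply/set0Pn; rewrite -card_gt0; apply: ltnW.
by rewrite /Lsum (bigD1 i) //= addn_gt0 absz_gt0 nz.
Qed.

Context (q n C : nat) (hP : forall A, (n * #|` A| <= q * (#|` S A| + C))%N).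
Context (nq : (n <= q * Lsum)%N).
(* Everything is multiplied by the common denominator q: the hypothesis on n reads
   [|S(A)| >= (n / q) |A| - C], and [near t A] reads [|S(A)| <= ((n + t) / q) |A|]. *)
Definition near t (A : {fset int}) : bool := (q * #|` S A| <= (n + t) * #|` A|)%N.
(** Beyond this size the additive errors [q * C] and [q * (G * C)] together cost at most one unit of
    [t]. *)
Definition big (A : {fset int}) : bool := (q * (G.+1 * C) <= #|` A|)%N.

(** The other classes of [A] produce sums outside the class of [s * c], hence disjoint from [X], and
    [hP] applies to each of these at most [G] classes. *)
Lemma excess c A X : X `<=` S A -> (forall x, x \in X -> cg G x (s * c)) ->
  (n * #|` A| + q * #|` X| <= q * #|` S A| + q * (G * C) + n * #|` cls G c A|)%N.
Proof.
move=> XS Xc; pose B := A `\` cls G c A.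
have BA : B `<=` A by apply: fsubsetDl.
have cAB : #|` A| = (#|` cls G c A| + #|` B|)%N.
  rewrite -(cardfsID (cls G c A) A); congr addn; congr (#|` _|).
  by apply/fsetIidPr/cls_sub.
have [R [RB iR cR]] := reps_exist G B.
pose Y := [fset x in S A | ~~ cg G x (s * c)].
have hXY : (#|` X| + #|` Y| <= #|` S A|)%N.
  apply: card_disjoint_sub => //; first exact: fset_sub.
  by move=> x xX; rewrite !inE Xc // andbF.
have leR : (#|` R| <= G)%N.
  rewrite -[X in (_ <= X)%N](card_arith G 0 (ltn0Sn 0)); apply: card_inj_mod iR _ => u uR.
  have [i hi] := cg_ord u G_gt0; exists (0 + 1 * (i : nat)%:Z); last by rewrite mul1r add0r.
  by apply/imfsetP; exists i.
have hY : (\sum_(r <- R) #|` S (cls G r B)| <= #|` Y|)%N.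
  apply: (@sum_card_le _ _ G _ _ (fun r => s * r)).
  - exact: fset_uniq.
  - move=> r rR; apply/fsubsetP => x xS.
    have hx : cg G x (s * r) by apply: cg_SL xS => y; rewrite in_cls => /andP[].
    rewrite !inE (fsubsetP (SLS _ _ (fsubset_trans (cls_sub _ _ _) BA)) _ xS) /=.
    have := fsubsetP RB _ rR; rewrite !inE => /andP[+ rA]; rewrite rA /=; apply: contra => h.
    by apply: cg_sum_lam; apply: cg_trans h; rewrite cg_sym.
  - by move=> r x rR; apply: cg_SL => y; rewrite in_cls => /andP[].
  - by move=> r r' rR r'R /cg_sum_lam; apply: iR.
have hB : (n * #|` B| <= q * #|` Y| + q * (G * C))%N.
  apply: (@leq_trans (n * \sum_(r <- R) #|` cls G r B|)%N).
    rewrite leq_mul2l; apply/orP; right; apply: card_le_cover => x xB.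
    by have [z zR h] := cR _ xB; exists z; rewrite // in_cls xB.
  apply: (@leq_trans (\sum_(r <- R) q * (#|` S (cls G r B)| + C))%N).
    by rewrite big_distrr; apply: leq_sum => r _; apply: hP.
  rewrite -big_distrr /= big_split /= -mulnDr leq_mul2l; apply/orP; right.
  apply: leq_add => //; rewrite big_const_seq count_predT iter_addn_0 mulnC.
  by rewrite leq_mul2r leR orbT.
have h : (q * (#|` X| + #|` Y|) <= q * #|` S A|)%N by rewrite leq_mul2l hXY orbT.
by move: h hB; rewrite cAB !mulnDr; lia.
Qed.

Lemma some_slot : exists i, i \in P.
Proof. by apply/set0Pn; rewrite -card_gt0; apply: ltnW. Qed.

Lemma two_lt t : (D * t.+1 < q)%N -> (2 * t.+1 <= q)%N /\ (4 * Lsum * t.+1 <= q)%N.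
Proof.
have := Lsum_gt0; case: Lsum => // m _ h.
by split; apply: leq_trans (ltnW h); rewrite leq_mul2r; apply/orP; right; nia.
Qed.

Lemma big_le A : big A -> (q * C + q * (G * C) <= #|` A|)%N.
Proof. by rewrite /big mulSn mulnDr. Qed.

(** Even a tiny class in slot [i], with [A] in the others, yields at least |A| sums, disjoint from
    [S] of the rest of [A]. A small class would therefore contradict near-extremality. *)
Lemma class_size t A i a : near t A -> (D * t.+1 < q)%N -> big A -> i \in P -> a \in A ->
  (#|` A| <= 2 * Lsum * #|` cls (gg i) a A|)%N.
Proof.
move=> nA /two_lt[t2 _] /big_le bA iP aA.
pose X := cls (gg i) a A; pose B := A `\` X.
have cAB : #|` A| = (#|` X| + #|` B|)%N.
  rewrite -(cardfsID X A); congr addn; congr (#|` _|).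
  by apply/fsetIidPr/cls_sub.
have BA : B `<=` A by apply: fsubsetDl.
have [j jP] := rest_ex P2 i; have := jP; rewrite !inE => /andP[ji jP'].
have h1 : (#|` A| <= #|` addS (SL lam (P :\ i) A) (dil (lam i) X)|)%N.
  apply: leq_trans (card_SL A jP (nz jP')) _; apply: (@card_addSl _ _ (lam i * a)).
  by apply: mem_dil; rewrite in_cls aA cg_refl.
have rest0 B' x : x \in SL lam (P :\ i) B' -> cg (gg i) x 0.
  move=> /SL_dec[c _ ->]; rewrite /cg subr0; apply: rpred_sum => k kP.
  by rewrite dvdzE abszM dvdn_mulr // absz_nat; apply: gcdS_dvd.
have h2 : (#|` addS (SL lam (P :\ i) A) (dil (lam i) X)| + #|` S B| <= #|` S A|)%N.
  apply: card_disjoint_sub.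
  - by rewrite (SL_D1 _ _ iP) addSC; apply: addSS => //; apply/dilS/cls_sub.
  - exact: SLS.
  - move=> _ /in_addS[x [_ [xT /in_dil[b bX ->] ->]]]; apply/negP.
    rewrite (SL_D1 _ _ iP) => /in_addS[_ [y [/in_dil[b' b'B ->] yT e]]].
    move: b'B; rewrite !inE => /andP[/negP h b'A]; apply: h; rewrite b'A /=.
    have e1 : cg (gg i) (lam i * b) (lam i * b').
      have := cgDr (gg i) x (lam i * b) (lam i * b'); rewrite [lam i * b + x]addrC e => <-.
      by rewrite cgDl; apply: cg_trans (rest0 _ _ yT) _; rewrite cg_sym; apply: rest0 xT.
    move: bX; rewrite in_cls => /andP[_]; apply: cg_trans; rewrite cg_sym.
    exact: cg_cancel (coprime_gg_lam iP) e1.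
have h3 := hP B.
have h4 : (q * (#|` A| + #|` S B|) <= q * #|` S A|)%N.
  by rewrite leq_mul2l (leq_trans _ h2) ?orbT // leq_add2r.
have h5 : (q * #|` A| <= n * #|` X| + t.+1 * #|` A|)%N.
  move: h3 h4 nA bA; rewrite /near cAB !mulnDr !mulnDl; lia.
have h6 : (n * #|` X| <= q * Lsum * #|` X|)%N by rewrite leq_mul2r nq orbT.
have q0 : (0 < q)%N by apply: leq_trans t2.
rewrite -(leq_pmul2l q0).
have h7 : (2 * t.+1 * #|` A| <= q * #|` A|)%N by rewrite leq_mul2r t2 orbT.
move: h5 h6 h7; rewrite -/X -!mulnA; lia.
Qed.

(** Restrict each slot [i] to the class of [c] modulo [gg i]. By [cg_lam] these sums lie in one
    class modulo [G]; by [class_size] they are many, so [excess] forces the class of [c] modulo [G]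
    to be large. *)
Lemma joint_class t A c : near t A -> (D * t.+1 < q)%N -> big A -> 
  (forall i, i \in P -> exists2 a, a \in A & cg (gg i) a c) ->
  (#|` A| <= D * #|` cls G c A|)%N.
Proof.
move=> nA tq bA hc; have [t2 t4] := two_lt tq.
have [i iP] := some_slot; have [a aA ha] := hc i iP.
pose X := \big[addS/[fset 0]]_(i in P) dil (lam i) (cls (gg i) c A).
have XS : X `<=` S A by apply: big_addS_sub => j _; apply/dilS/cls_sub.
have Xc x : x \in X -> cg G x (s * c).
  move=> /(big_dec (index_enum_uniq I))[b hb ->]; rewrite mulr_suml.
  apply: cg_sum => j jP; have /in_dil[y yA ->] := hb j (mem_index_enum _) jP.
  by apply: cg_lam => //; move: yA; rewrite in_cls => /andP[].
have h1 := excess XS Xc.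
have h2 : (#|` A| <= 2 * Lsum * #|` X|)%N.
  apply: leq_trans (class_size nA tq bA iP aA) _; rewrite leq_mul2l; apply/orP; right.
  rewrite (cls_eq _ ha) -(card_dil (cls (gg i) c A) (nz iP)) /X (bigD1 i) //=.
  have /choice[f hf] j : exists y, j \in P -> y \in A /\ cg (gg j) y c.
    by have [jP|] := boolP (j \in P); [have [y ? ?] := hc j jP; exists y | exists 0].
  apply: (@card_addSl _ _ (\sum_(j in P | j != i) lam j * f j)).
  apply: mem_big => j /andP[jP _]; apply: mem_dil; rewrite in_cls.
  by have [-> ->] := hf j jP.
move: bA => /big_le bA.
have L0 := Lsum_gt0; have q0 : (0 < q)%N by apply: leq_trans t2.
set x := #|` X| in h1 h2; set y := #|` cls G c A| in h1 *; set b := #|` A| in h1 h2 bA nA *.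
have h3 : (q * x <= n * y + t.+1 * b)%N by move: nA; rewrite /near -/b mulnDl mulSn; lia.
have h4 : (n * y <= q * Lsum * y)%N by rewrite leq_mul2r nq orbT.
have h5 : (q * b <= q * (2 * Lsum * x))%N by rewrite leq_mul2l h2 orbT.
have h6 : (4 * Lsum * t.+1 * b <= q * b)%N by rewrite leq_mul2r t4 orbT.
have h7 : (2 * Lsum * (q * x) <= 2 * Lsum * (q * Lsum * y + t.+1 * b))%N.
  by rewrite leq_mul2l (leq_trans h3) ?orbT // leq_add2r.
rewrite -(leq_pmul2l q0).
have e1 : (2 * Lsum * (q * x) = q * (2 * Lsum * x))%N by ring.
have e2 : (2 * (2 * Lsum * (q * Lsum * y + t.+1 * b)) = q * (D * y) + 4 * Lsum * t.+1 * b)%N by ring.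
move: h5 h6 h7 e2; rewrite e1; lia.
Qed.

(** By [excess] the fibre inherits the deficit [t.+1 * |A|], measured against a size of at least |A|
    / D. *)
Lemma near_cls t A a : near t A -> (D * t.+1 < q)%N -> big A -> a \in A ->
  near (t.+1 * D) (cls G a A).
Proof.
move=> nA tq bA aA.
have hc x : x \in S (cls G a A) -> cg G x (s * a).
  by apply: cg_SL => y; rewrite in_cls => /andP[].
have h1 := excess (SLS lam P (cls_sub G a A)) hc.
have h2 : (#|` A| <= D * #|` cls G a A|)%N.
  by apply: joint_class nA tq bA _ => i iP; exists a; rewrite ?cg_refl.
have h3 : (t.+1 * #|` A| <= t.+1 * (D * #|` cls G a A|))%N by rewrite leq_mul2l h2 orbT.
move: bA nA h1 h3 => /big_le; rewrite /near mulnDl [(_ * D)%N]mulnC -mulnA => e1 e2 e3 e4.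
rewrite mulnDl -mulnA mulSn in e4 *.
move: e1 e2 e3 e4; set u := (n * _)%N; set v := (D * _)%N; clear; lia.
Qed.

(* If the shifted class were missed, the sums having an element of [cls G u A] in slot
   l would enlarge the part of [S A] over the class of a by [#|` A| / D]. *)
Lemma fibre_closed t A i l a u y : near t A -> (D * t.+1 < q)%N -> big A ->
  i \in P -> l \in P -> l != i -> a \in A -> u \in A -> cg (gg l) u a ->
  (exists2 b, b \in cls G a A & cg (G * gg i) (lam i * b) y) ->
  exists2 b, b \in cls G a A & cg (G * gg i) (lam i * b) (y + lam l * (u - a)).
Proof.
move=> nA tq bA iP lP li aA uA ua [b bJ hb]; apply: contrapT => no.
(* [v + lam l * u'] has [b] in slot [i], [u'] in slot [l] and [a] elsewhere. *)
pose v := lam i * b + (\sum_(j in P | (j != i) && (j != l)) lam j) * a.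
pose N := [fset v + lam l * u' | u' in cls G u A].
pose X := S (cls G a A) `|` N.
have sE x : s * x = lam i * x + lam l * x + (\sum_(j in P | (j != i) && (j != l)) lam j) * x.
  rewrite (bigD1 i) //= (bigD1 l) /=; last by rewrite lP.
  by rewrite !mulrDl addrA; congr (_ + _ * _); apply: eq_bigl => j; rewrite andbA.
have NS : N `<=` S A.
  apply/fsubsetP => _ /imfsetP[u' /= + ->]; rewrite in_cls => /andP[u'A _].
  have -> : v + lam l * u' =
      \sum_(j in P) lam j * (if j == i then b else if j == l then u' else a).
    rewrite (bigD1 i) //= (bigD1 l) /=; last by rewrite lP.
    rewrite eqxx (negbTE li) eqxx /v mulr_suml -addrA; congr (_ + _).
    rewrite addrC; congr (_ + _); apply: eq_big => j; first by rewrite andbA.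
    by move=> /and3P[_ /negbTE -> /negbTE ->].
  apply: mem_SL => j _; case: ifP => _; last by case: ifP.
  exact: (fsubsetP (cls_sub G a A)).
have XS : X `<=` S A by rewrite fsubUset NS SLS // cls_sub.
have Xc x : x \in X -> cg G x (s * a).
  rewrite in_fsetU => /orP[|/imfsetP[u' /= + ->]].
    by apply: cg_SL => z; rewrite in_cls => /andP[].
  rewrite in_cls => /andP[_ u'u]; rewrite sE /v addrAC cgDr; apply: cgD.
    by apply: cgM; move: bJ; rewrite in_cls => /andP[].
  by apply: cg_lam => //; apply: cg_trans ua; apply: cg_dvd u'u; apply: gg_G.
(* Modulo [G * gg i], a slot other than [i] sees its argument only modulo [G]. *)
have Gl j x z : j \in P -> j != i -> cg G x z -> cg (G * gg i) (lam j * x) (lam j * z).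
  move=> jP ji; rewrite /cg -mulrBr !dvdzE abszM !absz_nat mulnC => h.
  by apply: dvdn_mul => //; apply: gg_lam.
have dis x : x \in S (cls G a A) -> x \notin N.
  move=> /SL_dec[c hc ->]; apply/negP => /imfsetP[u' /=]; rewrite in_cls => /andP[u'A u'u] e.
  apply: no; exists (c i); first exact: hc.
  have e1 : cg (G * gg i) (\sum_(j in P) lam j * c j)
      (lam i * c i + lam l * a + (\sum_(j in P | (j != i) && (j != l)) lam j) * a).
    rewrite (bigD1 i) //= (bigD1 l) /=; last by rewrite lP.
    rewrite addrA mulr_suml; apply: cgD; first apply: cgD; first exact: cg_refl.
      by apply: Gl => //; have := hc l lP; rewrite in_cls => /andP[].
    rewrite (eq_bigl (fun j => (j \in P) && ((j != i) && (j != l)))); last first.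
      by move=> j; rewrite andbA.
    apply: cg_sum => j /and3P[jP ji _]; apply: Gl => //.
    by have := hc j jP; rewrite in_cls => /andP[].
  rewrite e /v [_ + lam l * u']addrAC cgDr in e1.
  have e2 : cg (G * gg i) (lam i * b + lam l * u) (lam i * c i + lam l * a).
    by apply: cg_trans e1; rewrite cgDl; apply: Gl; rewrite // cg_sym.
  rewrite -(cgDr _ (lam l * a)) mulrBr -addrA subrK cg_sym.
  by apply: cg_trans e2; rewrite cgDr cg_sym.
have cX : #|` X| = (#|` S (cls G a A)| + #|` cls G u A|)%N.
  have /disjoint_fsetI0 e : [disjoint S (cls G a A) & N]%fset by apply/fdisjointP.
  rewrite /X cardfsU e cardfs0 subn0; congr addn; apply: card_imfset.
  by move=> x x' /addrI /(mulfI (nz lP)).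
have h1 := excess XS Xc; rewrite cX in h1.
have h2 := hP (cls G a A).
have h3 : (#|` A| <= D * #|` cls G u A|)%N.
  by apply: joint_class nA tq bA _ => j jP; exists u; rewrite ?cg_refl.
have A0 : (0 < #|` A|)%N by rewrite cardfs_gt0; apply/fset0Pn; exists a.
move: bA nA h1 h2 => /big_le; rewrite /near !mulnDl !mulnDr => e1 e2 e3 e4.
have h4 : (q * #|` cls G u A| <= t.+1 * #|` A|)%N.
  rewrite mulSn; move: e1 e2 e3 e4.
  set x1 := (q * C)%N; set x2 := (q * (G * C))%N; set x3 := (n * #|` A|)%N.
  set x4 := (t * _)%N; set x5 := (q * #|` S A|)%N; set x6 := (n * _)%N.
  set x7 := (q * #|` S _|)%N; set x8 := (q * _)%N; set x9 := #|` A|; clear; lia.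
have h5 : (q * #|` A| <= q * (D * #|` cls G u A|))%N by rewrite leq_mul2l h3 orbT.
have h6 : (D * (q * #|` cls G u A|) <= D * (t.+1 * #|` A|))%N by rewrite leq_mul2l h4 orbT.
have h7 : (D * t.+1 * #|` A| < q * #|` A|)%N by rewrite ltn_pmul2r.
by move: h7; rewrite ltnNge => /negP; apply; apply: leq_trans h5 _; rewrite mulnCA -[X in (_ <= X)%N]mulnA.
Qed.

Definition reduced (A : {fset int}) : Prop := forall i p, i \in P -> prime p ->
  (p %| gg i)%N -> exists2 a, a \in A & exists2 a', a' \in A & ~~ cg p a a'.

(** The Chinese remainder theorem gives a class that agrees with [a] in all slots but [i] and
    differs from it modulo [p]; by [joint_class], [A] meets it. *)
Lemma separating_point t A i l a p : near t A -> (D * t.+1 < q)%N -> big A -> reduced A ->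
  i \in P -> l \in P -> l != i -> a \in A -> prime p -> (p %| gg i)%N ->
  exists2 u, u \in A & cg (gg l) u a /\ ~~ cg p u a.
Proof.
move=> nA tq bA rA iP lP li aA pp pg.
have [v vA va] : exists2 v, v \in A & ~~ cg p v a.
  have [v vA [v' v'A ne]] := rA i p iP pp pg.
  have [h|h] := boolP (cg p v a); last by exists v.
  exists v' => //; apply: contra ne => h'; apply: cg_trans h _; by rewrite cg_sym.
have cop : coprime (gg i) (\prod_(j in P | j != i) gg j).
  by apply: coprime_prodr => j /andP[jP ji]; apply: coprime_gg; rewrite // eq_sym.
have [c [c1 c2]] := chinese_int v a cop.
have ca j : j \in P -> j != i -> cg (gg j) c a.
  by move=> jP ji; apply: cg_dvd c2; rewrite (bigD1 j) ?jP //= dvdn_mulr.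
have h : (#|` A| <= D * #|` cls G c A|)%N.
  apply: joint_class nA tq bA _ => j jP; have [->|ji] := eqVneq j i.
    by exists v; rewrite // cg_sym.
  by exists a; rewrite // cg_sym; apply: ca.
have /fset0Pn[u] : cls G c A != fset0.
  rewrite -cardfs_gt0 lt0n; apply/negP => /eqP e; move: h; rewrite e muln0 leqn0.
  by rewrite cardfs_eq0 => /eqP A0; rewrite A0 in aA.
rewrite in_cls => /andP[uA uc]; exists u => //; split.
  by apply: cg_trans (ca l lP li); apply: cg_dvd uc; apply: gg_G.
apply: contra va => h'; apply: cg_trans h'; apply: (@cg_trans _ c).
  by rewrite cg_sym; apply: cg_dvd pg c1.
by rewrite cg_sym; apply: cg_dvd uc; apply: dvdn_trans pg (gg_G iP).
Qed.

(** The period [h] of the residues [lam i * b] divides [lam l * (u - a)] by [fibre_closed]. For a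
    prime [p] of [gg i], choose [u - a] prime to [p] and [lam l] with no higher power of [p] than
    [gg i]; thus [h] divides [G]. *)
Lemma fibre_full t A i a z : near t A -> (D * t.+1 < q)%N -> big A -> reduced A ->
  i \in P -> a \in A -> exists2 b, b \in A & cg (G * gg i) b (a + G%:Z * z).
Proof.
move=> nA tq bA rA iP aA; have G0 := G_gt0; have gi0 := gg_gt0 i.
pose W y := exists2 b, b \in cls G a A & cg (G * gg i) (lam i * b) y.
have per y x : W y -> W (y + (G * gg i)%N%:Z * x).
  move=> [b bJ hb]; exists b => //; apply: cg_trans hb _; rewrite cg_sym; exact: cg_addM.
have GG0 : (0 < G * gg i)%N by rewrite muln_gt0 G0.
have [h h0 hh] := shift_group GG0 per.
have hG' : (h %| G * gg i)%N.
  have /hh : forall x, W x -> W (x + (G * gg i)%N%:Z).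
    by move=> x Wx; rewrite -[X in _ + X]mulr1; apply: per.
  by rewrite dvdzE.
have hd l u : l \in P -> l != i -> u \in A -> cg (gg l) u a -> (h%:Z %| lam l * (u - a))%Z.
  by move=> lP li uA ua; apply/hh => y; apply: (fibre_closed nA tq bA).
have hG : (h %| G)%N.
  apply/dvdn_partP => // p; rewrite mem_primes => /and3P[pp _ ph].
  have phd : (h`_p %| h)%N := dvdn_part _ _.
  have [pg|pg] := boolP (p %| gg i)%N; last first.
    have : (h`_p %| G * gg i)%N := dvdn_trans phd hG'.
    by rewrite Gauss_dvdl // p_part coprimeXl // prime_coprime.
  have [l lP [li nl]] : exists2 l, l \in P & l != i /\ ~~ ((gg i)`_p * p %| `|lam l|)%N.
    apply: contrapT => no.
    have : ((gg i)`_p * p %| gg i)%N.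
      apply/dvdn_gcdS => l; rewrite !inE => /andP[li lP].
      by apply: contrapT => /negP nl; apply: no; exists l.
    by rewrite p_part -expnSr pfactor_dvdn // ltnn.
  have [u uA [ua nu]] := separating_point nA tq bA rA iP lP li aA pp pg.
  have := hd l u lP li uA ua; rewrite dvdzE abszM absz_nat => d1.
  have d2 : (h`_p %| `|lam l|)%N.
    have := dvdn_trans phd d1; rewrite Gauss_dvdl // p_part coprimeXl // prime_coprime //.
  apply: dvdn_trans (gg_G iP); move: d2 nl.
  rewrite !p_part -expnSr !pfactor_dvdn ?absz_gt0 ?nz // -leqNgt => d2.
  exact: leq_trans d2.
have W0 : W (lam i * a) by exists a; rewrite ?cg_refl // in_cls aA cg_refl.
have /hh /(_ _ W0) : (h%:Z %| lam i * (G%:Z * z))%Z.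
  by rewrite dvdz_mull // dvdz_mulr // dvdzE.
rewrite -mulrDr => -[b]; rewrite in_cls => /andP[bA' bG] hb; exists b => //.
have /dvdzP[w hw] := bG.
have bE : b = a + G%:Z * w by rewrite mulrC -hw subrKC.
rewrite bE cgDl cgMlE //; apply: (cg_cancel (coprime_gg_lam iP)).
have := hb; rewrite bE !mulrDr cgDl.
rewrite ![lam i * (_ * _)]mulrCA cgMlE //.
Qed.

Definition loss (t : nat) : nat := (t.+1 * D)%N.

Lemma le_loss f t : (t <= iter f loss t)%N.
Proof.
elim: f => //= f IH; apply: leq_trans IH _; apply: leq_trans (leqnSn _) _.
by rewrite /loss leq_pmulr // muln_gt0 expn_gt0 Lsum_gt0.
Qed.

Lemma near_sec t A a : near t A -> (D * t.+1 < q)%N -> big A -> a \in A ->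
  near (loss t) (sec G a A).
Proof.
move=> nA tq bA aA; rewrite /near card_sec ?G_gt0 // card_SL_sec ?G_gt0 //.
exact: near_cls.
Qed.

Lemma le_sec t A a : near t A -> (D * t.+1 < q)%N -> big A -> a \in A ->
  (#|` A| <= D * #|` sec G a A|)%N.
Proof.
move=> nA tq bA aA; rewrite card_sec ?G_gt0 //.
by apply: joint_class nA tq bA _ => i iP; exists a; rewrite ?cg_refl.
Qed.

(* A fibre is again nearly extremal, with loss [(t + 1) D], so the full classes modulo
   G can be refined f times. *)
Lemma deep_full f t A a x : near t A -> (D * (iter f loss t).+1 < q)%N ->
  (q * (G.+1 * C) * D ^ f <= #|` A|)%N -> reduced A -> a \in A ->
  exists2 b, b \in sec G a A & cg (G ^ f) b x.
Proof.
have G0 := G_gt0; have D0 : (0 < D)%N by rewrite muln_gt0 expn_gt0 Lsum_gt0.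
elim: f t A a x => [|f IH] t A a x nA tq bA rA aA.
  exists 0; first by rewrite in_sec // mulr0 addr0.
  by rewrite expn0 /cg dvd1z.
have tq0 : (D * t.+1 < q)%N.
  by apply: leq_ltn_trans tq; rewrite leq_mul2l ltnS le_loss orbT.
have bA0 : big A.
  by apply: leq_trans bA; rewrite leq_pmulr // expn_gt0 D0.
have tq1 : (D * (loss t).+1 < q)%N.
  by apply: leq_ltn_trans tq; rewrite leq_mul2l ltnS iterSr le_loss orbT.
set A' := sec G a A.
have nA' := near_sec nA tq0 bA0 aA; rewrite -/A' in nA'.
have bA' : (q * (G.+1 * C) * D ^ f <= #|` A'|)%N.
  rewrite -(leq_pmul2r D0) -mulnA -expnSr; apply: leq_trans bA _.
  by rewrite mulnC; apply: le_sec nA tq0 bA0 aA.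
have fA' i y : i \in P -> exists2 b, b \in A' & cg (gg i) b y.
  move=> iP; have [b bA1 hb] := fibre_full y nA tq0 bA0 rA iP aA.
  have : b \in cls G a A.
    rewrite in_cls bA1 /=; apply: (@cg_trans _ (a + G%:Z * y)); last exact: cg_addM.
    by apply: cg_dvd hb; apply: dvdn_mulr.
  rewrite secE // => /imfsetP[w /= wA e]; exists w => //.
  by move: hb; rewrite e cgDl cgMlE.
have rA' : reduced A'.
  move=> i p iP pp pg; have [b bA1 hb] := fA' i 0 iP; have [c cA hc] := fA' i 1 iP.
  exists b => //; exists c => //; apply/negP => h.
  have : cg p 0 1.
    by apply: cg_trans (cg_dvd pg hc); apply: cg_trans h; rewrite cg_sym; apply: cg_dvd pg hb.
  by rewrite /cg sub0r dvdzE abszN absz_nat dvdn1 => /eqP p1; rewrite p1 in pp.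
have bA1 : big A' by apply: leq_trans bA'; rewrite leq_pmulr // expn_gt0 D0.
have h : (#|` A'| <= D * #|` cls G x A'|)%N.
  by apply: joint_class nA' tq1 bA1 _ => i iP; apply: fA'.
have A'0 : (0 < #|` A'|)%N.
  by rewrite cardfs_gt0; apply/fset0Pn; exists 0; rewrite in_sec // mulr0 addr0.
have /fset0Pn[a1] : cls G x A' != fset0.
  by rewrite -cardfs_gt0 lt0n; apply/negP => /eqP e; move: h; rewrite e muln0 leqNgt A'0.
rewrite in_cls => /andP[a1A a1x].
(* An expansion in base [G]: [a1] gives the first digit of [x], and the fibre of [A'] at [a1] gives
   the others. *)
have [w hw] := dvdzP a1x.
have tq2 : (D * (iter f loss (loss t)).+1 < q)%N by move: tq; rewrite iterSr.
have [b bS hb] := IH (loss t) A' a1 (- w) nA' tq2 bA' rA' a1A.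
exists (a1 + G%:Z * b); first by rewrite -in_sec.
have -> : x = a1 + G%:Z * (- w) by rewrite mulrN mulrC -hw opprB addrC subrK.
by rewrite cgDl expnS cgMlE.
Qed.
End Near.

(** * Raising the constant *)

Lemma dvdn_exp_primes F G : (0 < F)%N ->
  (forall p, prime p -> (p %| F)%N -> (p %| G)%N) -> (F %| G ^ F)%N.
Proof.
move=> F0 h; apply/dvdn_partP => // p; rewrite mem_primes => /and3P[pp _ pF].
rewrite p_part; apply: (@dvdn_trans (G ^ logn p F)); first by rewrite dvdn_exp2r // h.
by apply/dvdn_exp2l/ltnW/ltn_logl.
Qed.

Lemma sec_full_set (A : {fset int}) a : a \in A -> cls (gd A) a A = A.
Proof.
move=> aA; apply/fsetP => x; rewrite in_cls; case: (boolP (x \in A)) => //= xA.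
exact: constm_gd.
Qed.

Lemma gd_sec (A : {fset int}) a : a \in A -> (0 < gd A)%N -> gd (sec (gd A) a A) = 1%N.
Proof.
move=> aA d0; set d := gd A in d0 *; set e := gd _.
have : (d * e %| d)%N.
  apply/gdP => x y; rewrite -{1 2}(sec_full_set aA) -/d secE //.
  move=> /imfsetP[u /= uS ->] /imfsetP[v /= vS ->].
  by rewrite cgDl; apply/cgMl/constm_gd.
by rewrite -{2}[d]muln1 dvdn_pmul2l // dvdn1 => /eqP.
Qed.

Lemma gd_gt0_card (A : {fset int}) : (1 < #|` A|)%N -> (0 < gd A)%N.
Proof.
move=> h; have [E|[x xA]] := fset_0Vmem A; first by rewrite E cardfs0 in h.
have [E|[y]] := fset_0Vmem (A `\ x); first by move: h; rewrite (cardfsD1 x) xA E cardfs0.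
by rewrite !inE => /andP[ne yA]; apply: gd_gt0 yA xA ne.
Qed.

Lemma sum_SL_cls (I : finType) (lam : I -> int) (P : {set I}) (A R : {fset int}) :
  (forall i, i \in P -> lam i != 0) -> gcdS lam P = 1%N -> R `<=` A ->
  inj_mod (Gprod lam P) R ->
  (\sum_(r <- R) #|` SL lam P (cls (Gprod lam P) r A)| <= #|` SL lam P A|)%N.
Proof.
move=> nz g1 RA iR.
apply: (@sum_card_le _ _ (Gprod lam P) _ _ (fun r => (\sum_(i in P) lam i) * r)).
- exact: fset_uniq.
- by move=> r _; apply/SLS/cls_sub.
- by move=> r x rR; apply: cg_SL => y; rewrite in_cls => /andP[].
- by move=> r r' rR r'R /(cg_sum_lam nz g1); apply: iR.
Qed.

Section Gain.
Context (I : finType) (lam : I -> int) (P : {set I}) (k : I).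
Context (nz : forall i, i \in P -> lam i != 0) (P2 : (1 < #|P|)%N) (g1 : gcdS lam P = 1%N).
Context (kP : k \in P).
Local Notation G := (Gprod lam P).
Local Notation La := (Lsum lam P).
Local Notation D := (4 * La ^ 2)%N.
Local Notation S := (SL lam P).
Local Notation ls := (loss lam P).
Context (F C0 : nat) (F0 : (0 < F)%N).
Context (pF : forall p, prime p -> (p %| F)%N ->
  exists2 i, i \in P & (p %| gcdS lam (P :\ i))%N).
Context (hF : forall A : {fset int}, (forall x, exists2 a, a \in A & cg F a x) ->
  gd A = 1%N -> (#|` S A| <= La.+1 * #|` A|)%N ->
  (forall a, a \in A -> (#|` A| <= 2 * La * #|` cls (gcdS lam (P :\ k)) a A|)%N) ->
  (La * #|` A| <= #|` S A| + C0)%N).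
(** Large enough for [F + 1] successive losses from [t = 1], and independent of [n] and [C], so that
    the induction on [n] keeps a fixed step. *)
Definition denom : nat := (D * (iter F.+1 ls 1).+1).+1.
Local Notation q := denom.

Lemma F_dvd : (F %| G ^ F)%N.
Proof.
apply: dvdn_exp_primes F0 _ => p pp /(pF pp)[i iP h].
exact: dvdn_trans h (gg_G lam iP).
Qed.

(** A fibre is still nearly extremal and meets all classes modulo [G ^ F], a multiple of [F]; once
    the gcd of its differences is divided out, [hF] applies. *)
Lemma fibre_exact n C A a :
  (forall A, n * #|` A| <= q * (#|` S A| + C))%N -> (n <= q * La)%N ->
  near lam P q n 1 A -> (q * (G.+1 * C) * D ^ F.+1 <= #|` A|)%N -> (D < #|` A|)%N ->
  gd A = 1%N -> a \in A -> (La * #|` cls G a A| <= #|` S (cls G a A)| + C0)%N.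
Proof.
move=> hP nq nA bA DA gA aA.
have G0 := G_gt0 nz P2; have L0 := Lsum_gt0 nz P2.
have D0 : (0 < D)%N by rewrite muln_gt0 expn_gt0 L0.
have tq : (D * (iter F ls 1).+1 < q)%N.
  by rewrite ltnS leq_mul2l ltnS /= (le_loss nz P2 1) orbT.
have tq1 : (D * (ls 1).+1 < q)%N.
  by rewrite ltnS leq_mul2l ltnS iterSr (le_loss nz P2) orbT.
have tq0 : (D * 1.+1 < q)%N.
  by rewrite ltnS leq_mul2l ltnS (le_loss nz P2) orbT.
have le1 m : (m <= m * D)%N by rewrite leq_pmulr.
have leX m j : (m <= m * D ^ j)%N by rewrite leq_pmulr // expn_gt0 D0.
have bA1 : (q * (G.+1 * C) * D ^ F <= #|` A|)%N.
  by apply: leq_trans bA; rewrite leq_mul2l (leq_pexp2l D0 (leqnSn F)) orbT.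
have bA0 : big lam P q C A by apply: leq_trans bA.
have rA : reduced lam P A.
  move=> i p iP pp pg; apply: contrapT => no; have : (p %| gd A)%N.
    apply/gdP => x y xA yA; apply: contrapT => /negP h; apply: no.
    by exists x => //; exists y.
  by rewrite gA dvdn1 => /eqP p1; rewrite p1 in pp.
set A' := sec G a A.
have full' x : exists2 b, b \in A' & cg (G ^ F) b x.
  exact: (deep_full nz P2 g1 hP nq x nA tq bA1 rA aA).
have nA' : near lam P q n (ls 1) A' by apply: (near_sec nz P2 g1 hP nq nA tq0 bA0 aA).
have leA' : (#|` A| <= D * #|` A'|)%N := le_sec nz P2 g1 hP nq nA tq0 bA0 aA.
have A'1 : (1 < #|` A'|)%N.
  by rewrite -(ltn_pmul2l D0) muln1; apply: leq_trans leA'.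
have bA' : big lam P q C A'.
  apply: leq_trans (leX _ F) _; rewrite -(leq_pmul2l D0); apply: leq_trans leA'.
  by apply: leq_trans bA; rewrite [(D * _)%N]mulnC -mulnA leq_mul2l -expnSr leqnn orbT.
have zA' : 0 \in A' by rewrite in_sec // mulr0 addr0.
have d0 := gd_gt0_card A'1; set d := gd A' in d0.
set A2 := sec d 0 A'.
have cA2 : #|` A2| = #|` A'| by rewrite card_sec // sec_full_set.
have cS2 : #|` S A2| = #|` S A'| by rewrite card_SL_sec // sec_full_set.
have nA2 : near lam P q n (ls 1) A2 by rewrite /near cA2 cS2.
have bA2 : big lam P q C A2 by rewrite /big cA2.
(* [A'] has elements congruent to 0 and to 1 modulo every prime of [G], so division by [d] permutes
   the classes modulo [G ^ F]. *)
have cop : coprime (G ^ F) d.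
  rewrite coprimeXl //; apply: coprime_primeP G0 => p pp pG pd.
  have pGF : (p %| G ^ F)%N by rewrite Euclid_dvdX // pG.
  have [b bA'' hb] := full' 0; have [c cA' hc] := full' 1.
  have : cg p 0 1.
    apply: (@cg_trans _ b); first by rewrite cg_sym; apply: cg_dvd hb.
    apply: cg_trans (cg_dvd pGF hc); exact: cg_dvd pd (constm_gd bA'' cA').
  by rewrite /cg sub0r dvdzE abszN absz_nat dvdn1 => /eqP p1; rewrite p1 in pp.
have : (La * #|` A2| <= #|` S A2| + C0)%N.
  apply: hF.
  - move=> x; have [b bA'' hb] := full' (d%:Z * x).
    move: bA''; rewrite -(sec_full_set zA') -/d secE // => /imfsetP[y /= yA e].
    exists y => //; apply: cg_dvd F_dvd _.
    by apply: (@cg_cancel _ d%:Z); rewrite ?absz_nat //; rewrite e add0r in hb.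
  - exact: gd_sec.
  - have q0 : (0 < q)%N by [].
    rewrite -(leq_pmul2l q0); apply: leq_trans nA2 _; rewrite mulnA leq_mul2r; apply/orP; right.
    rewrite mulnS addnC; apply: leq_add => //; apply: leq_trans (ltnW tq1).
    by apply: leq_trans (leqnSn _) _; rewrite mulnC.
  - by move=> b bA''; apply: (class_size nz P2 g1 hP nq nA2 tq1 bA2 kP bA'').
by rewrite cA2 cS2 card_sec // card_SL_sec.
Qed.

(** A large [A] violating the bound for [n + 1] is nearly extremal for [n], and summing
    [fibre_exact] over at most [G] fibres gives it the final factor [La] at once. Small sets go into
    the constant. *)
Lemma card_SL_ge_frac n : (n <= q * La)%N ->
  exists C, forall A : {fset int}, (n * #|` A| <= q * (#|` S A| + C))%N.
Proof.
elim: n => [|n IH] nq; first by exists 0%N => A; rewrite mul0n.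
have [C hP] := IH (ltnW nq).
have G0 := G_gt0 nz P2; have L0 := Lsum_gt0 nz P2.
pose thr := (q * (G.+1 * C) * D ^ F.+1 + D + 1)%N.
exists (n.+1 * thr + G * C0)%N => A.
have q0 : (0 < q)%N by [].
have [small|large] := leqP #|` A| thr.
  apply: (@leq_trans (n.+1 * thr)%N); first by rewrite leq_mul2l small orbT.
  rewrite addnA; apply: leq_trans (leq_pmull _ q0); rewrite addnAC leq_addl //.
wlog gA : A large / gd A = 1%N.
  move=> h; have A1 : (1 < #|` A|)%N by apply: leq_ltn_trans large; rewrite /thr addn1.
  have d0 := gd_gt0_card A1.
  have [a aA] : exists a, a \in A by apply/fset0Pn; rewrite -cardfs_gt0; apply: ltnW.
  have := h (sec (gd A) a A); rewrite card_SL_sec // card_sec // sec_full_set //.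
  by apply=> //; apply: gd_sec.
have [done|nA] := leqP (n.+1 * #|` A|)%N (q * #|` S A|)%N.
  by apply: leq_trans done _; rewrite leq_mul2l leq_addr orbT.
have near1 : near lam P q n 1 A by rewrite /near addn1 ltnW.
have [R [RA iR cR]] := reps_exist G A.
have each r : r \in R -> (La * #|` cls G r A| <= #|` S (cls G r A)| + C0)%N.
  move=> rR; apply: fibre_exact hP (ltnW nq) near1 _ _ gA (fsubsetP RA _ rR).
    by apply: leq_trans (ltnW large); rewrite /thr -addnA leq_addr.
  by apply: leq_trans (ltnW large); rewrite /thr addn1 ltnS leq_addl.
have hsum := sum_SL_cls nz g1 RA iR.
have leR : (#|` R| <= G)%N.
  rewrite -[X in (_ <= X)%N](card_arith G 0 (ltn0Sn 0)); apply: card_inj_mod iR _ => u uR.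
  have [i hi] := cg_ord u G0; exists (0 + 1 * (i : nat)%:Z); last by rewrite mul1r add0r.
  by apply/imfsetP; exists i.
have hA : (La * #|` A| <= #|` S A| + G * C0)%N.
  apply: (@leq_trans (La * \sum_(r <- R) #|` cls G r A|)%N).
    rewrite leq_mul2l; apply/orP; right; apply: card_le_cover => x xA.
    by have [z zR h] := cR _ xA; exists z; rewrite // in_cls xA.
  apply: (@leq_trans (\sum_(r <- R) (#|` S (cls G r A)| + C0))%N).
    by rewrite big_distrr /= big_seq [X in (_ <= X)%N]big_seq; apply: leq_sum.
  rewrite big_split /= leq_add // big_const_seq count_predT iter_addn_0 mulnC.
  by rewrite leq_mul2r leR orbT.
apply: (@leq_trans (q * La * #|` A|)%N); first by rewrite leq_mul2r nq orbT.
rewrite -mulnA leq_mul2l; apply/orP; right; apply: leq_trans hA _.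
by rewrite leq_add2l leq_addl.
Qed.
End Gain.

(** * Induction on the number of coefficients and return to sequences *)

Lemma SL_scale (I : finType) (lam : I -> int) (P : {set I}) (g : int) A :
  SL (fun i => g * lam i) P A = dil g (SL lam P A).
Proof.
apply/fsetP => x; apply/idP/in_dil => [/SL_dec[c hc ->]|[_ /SL_dec[c hc ->] ->]].
  exists (\sum_(i in P) lam i * c i); first exact: mem_SL.
  by rewrite mulr_sumr; apply: eq_bigr => i _; rewrite mulrA.
have -> : g * (\sum_(i in P) lam i * c i) = \sum_(i in P) (g * lam i) * c i.
  by rewrite mulr_sumr; apply: eq_bigr => i _; rewrite mulrA.
exact: mem_SL.
Qed.

Lemma eq_SL (I : finType) (lam lam' : I -> int) (P : {set I}) A :
  (forall i, i \in P -> lam i = lam' i) -> SL lam P A = SL lam' P A.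
Proof. by move=> h; apply: eq_bigr => i iP; rewrite h. Qed.

(** The coefficients other than [lam k] may have a gcd [g > 1]. The induction hypothesis is applied
    to their quotients by [g], and the factor [g] returns through the [g] classes in
    [exact_step]. *)
Theorem card_SL_ge (I : finType) (lam : I -> int) (P : {set I}) :
  (forall i, i \in P -> lam i != 0) -> (0 < #|P|)%N -> gcdS lam P = 1%N ->
  exists C, forall A : {fset int}, (Lsum lam P * #|` A| <= #|` SL lam P A| + C)%N.
Proof.
elim: {P}#|P| {-2}P (leqnn #|P|) lam => [|m IH] P Pm lam nz P0 g1.
  by move: P0; rewrite ltnNge Pm.
have [P2|P1] := ltnP 1 #|P|; last first.
  have /eqP/cards1P[i Pi] : #|P| = 1%N by apply/eqP; rewrite eqn_leq P1.
  exists 0%N => A; have iP : i \in P by rewrite Pi inE.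
  have l1 : Lsum lam P = 1%N by rewrite -g1 /Lsum /gcdS Pi !big_set1.
  by rewrite l1 mul1n addn0; apply: card_SL (nz _ iP).
have [k kP] : exists k, k \in P by apply/set0Pn; rewrite -card_gt0.
set P' := P :\ k; set g := gcdS lam P'.
have g0 : (0 < g)%N := gg_gt0 nz P2 k.
have gz : g%:Z != 0 by rewrite eqz_nat -lt0n.
pose lam' i := (lam i %/ g%:Z)%Z.
have lamE i : i \in P' -> lam i = g%:Z * lam' i.
  by move=> iP; rewrite mulrC divzK // dvdzE absz_nat; apply: gcdS_dvd.
have cP : #|P| = #|P'|.+1 by rewrite (cardsD1 k) kP.
have [||||C1 hC1] := IH P' _ lam'.
- by rewrite -ltnS -cP.
- move=> i iP; have := nz i; move: (iP); rewrite !inE => /andP[_ ->] /(_ isT).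
  by rewrite lamE //; apply: contraNneq => ->; rewrite mulr0.
- by rewrite -ltnS -cP.
- have : (g * gcdS lam' P' %| g)%N.
    apply/dvdn_gcdS => i iP; rewrite lamE // abszM absz_nat dvdn_pmul2l //.
    exact: gcdS_dvd.
  by rewrite -{2}[g]muln1 dvdn_pmul2l // dvdn1 => /eqP.
have hT (A : {fset int}) : (Lsum lam P' * #|` A| <= g * #|` SL lam P' A| + g * C1)%N.
  rewrite (eq_SL A lamE) SL_scale card_dil // -mulnDr.
  have -> : Lsum lam P' = (g * Lsum lam' P')%N.
    by rewrite /Lsum big_distrr /=; apply: eq_bigr => i iP; rewrite lamE // abszM absz_nat.
  by rewrite -mulnA leq_mul2l hC1 orbT.
have D1 : (0 < 2 * Lsum lam P)%N by rewrite muln_gt0 Lsum_gt0.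
have [F [C0 [F0 pF hF]]] := exact_step nz kP P2 g1 (ltn0Sn (Lsum lam P)) D1 hT.
have LE : (Lsum lam P' + `|lam k| = Lsum lam P)%N.
  rewrite addnC /Lsum [RHS](bigD1 k) //=; congr addn.
  by apply: eq_bigl => j; rewrite !inE andbC.
rewrite LE in hF.
(* At [n = q * Lsum lam P] the denominator cancels. *)
have [C hC] := card_SL_ge_frac nz P2 g1 kP F0 pF hF (leqnn _).
exists C => A; have := hC A; rewrite -mulnA leq_pmul2l //.
Qed.

Lemma mem_dilated (A ls : seq int) (S : seq int) (b : nat -> int) x : x \in S ->
  (forall i, (i < size ls)%N -> b i \in A) ->
  x + \sum_(i < size ls) ls`_i * b i \in foldl (fun S d => sumset S (dilate d A)) S ls.
Proof.
elim: ls S b x => [|l ls IH] S b x xS hb /=; first by rewrite big_ord0 addr0.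
rewrite big_ord_recl addrA; apply: (IH _ (fun i => b i.+1)) => [|i]; last exact: (hb i.+1).
by apply: allpairs_f => //; apply: map_f; apply: hb.
Qed.

Lemma dvdn_gcd_list d lam : (forall l, l \in lam -> (d %| `|l|)%N) -> (d %| gcd_list lam)%N.
Proof.
elim: lam => [|l ls IH] h /=; first exact: dvdn0.
by rewrite dvdn_gcd h ?mem_head // IH // => x xs; apply: h; rewrite inE xs orbT.
Qed.

Theorem theorem1 (lam : seq int) (hk : (1 <= size lam)%N) (hgcd : gcd_list lam = 1%N) :
  exists C : nat, forall A : seq int,
    ((abs_sum lam)%:Z * (card_set A)%:Z - C%:Z <= (card_set (dilated_sumset lam A))%:Z).
Proof.
(* Zero coefficients contribute nothing to either side and are left out of [P]. *)
pose la (i : 'I_(size lam)) := lam`_i; pose P := [set i | la i != 0].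
have nz i : i \in P -> la i != 0 by rewrite inE.
have dvd_all d : (forall i, i \in P -> (d %| `|la i|)%N) -> (d %| gcd_list lam)%N.
  move=> h; apply: dvdn_gcd_list => l /(nthP 0)[i ilt <-].
  have [e|ne] := eqVneq (la (Ordinal ilt)) 0; first by rewrite (e : lam`_i = 0) dvdn0.
  by apply: (h (Ordinal ilt)); rewrite inE.
have g1 : gcdS la P = 1%N.
  by apply/eqP; rewrite -dvdn1 -hgcd; apply: dvd_all => i; apply: gcdS_dvd.
have P0 : (0 < #|P|)%N.
  rewrite card_gt0; apply/negP => /eqP e.
  have : (2 %| gcd_list lam)%N by apply: dvd_all => i; rewrite e inE.
  by rewrite hgcd.
have [C hC] := card_SL_ge nz P0 g1.
exists C => A; pose A' := [fset x in A].
have cA : card_set A = #|` A'| by rewrite /card_set card_fseq.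
have LE : abs_sum lam = Lsum la P.
  rewrite /abs_sum (big_nth 0) big_mkord /Lsum [RHS]big_mkcond /=; apply: eq_bigr => i _.
  by rewrite inE /la; case: eqVneq => //= ->.
rewrite lerBlDr -PoszM -PoszD lez_nat LE cA; apply: leq_trans (hC A') _; rewrite leq_add2r.
have -> : card_set (dilated_sumset lam A) = #|` [fset x in dilated_sumset lam A]|.
  by rewrite /card_set card_fseq.
apply: fsubset_leq_card; apply/fsubsetP => _ /SL_dec[a ha ->]; rewrite inE /=.
have [i0 i0P] : exists i, i \in P by apply/set0Pn; rewrite -card_gt0.
have a0A := ha _ i0P; rewrite inE /= in a0A.
(* A slot with zero coefficient still needs an element of [A]; it borrows that of [i0]. *)
pose b (i : nat) := if insub i is Some j then (if j \in P then a j else a i0) else a i0.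
have bA i : b i \in A.
  rewrite /b; case: insubP => // j _ _; case: ifP => // jP.
  by have := ha _ jP; rewrite inE.
have -> : \sum_(i in P) la i * a i = \sum_(i < size lam) lam`_i * b i.
  rewrite big_mkcond /=; apply: eq_bigr => i _.
  rewrite /b insubT //= => ilt; rewrite (_ : Sub _ _ = i); last exact: val_inj.
  case: ifP => // /negbT; rewrite inE negbK => /eqP e.
  by rewrite (e : lam`_i = 0) mul0r.
case: (lam) hk b bA => [//|l ls] _ b' bA' /=; rewrite big_ord_recl.
apply: (mem_dilated (b := fun i => b' i.+1)) => [|i _]; last exact: bA'.
by apply: map_f; apply: bA'.
Qed.
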